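(* Let $\boldsymbol{\Omega}$ be the Berry-curvature pseudovector field on the three-dimensional Brillouin torus $\mathbb{T}^3$, decomposed into harmonic, exact and co-exact sectors as in the context. (1) For any scalar $g$ the functional $\int_{\mathbb{T}^3}g\,(\nabla\times\boldsymbol{\Omega})$ is exact-sector-only: the curl annihilates the harmonic (constant) and co-exact (gradient) parts identically. (2) Taking $g=f_0$ gives the observable $$\mathbf{P}(\mu)=\int_{\mathbb{T}^3}f_0\,(\nabla\times\boldsymbol{\Omega})=\oint_{\mathrm{FS}}\hat{\mathbf{n}}\times\boldsymbol{\Omega}\,dS,$$ the circulation of the Berry curvature around the Fermi surface, which is precisely the antisymmetric part of the Berry-curvature dipole: $P_l=\epsilon_{lij}D_{ij}$. (3) Under a point-group operation $\mathbf{P}$ transforms as a polar vector. So, by Neumann's principle, $\mathbf{P}$ is nonzero only in the ten polar (pyroelectric) crystal classes.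
   Context: The Brillouin zone is the flat torus $\mathbb{T}^3$. The Berry curvature 2-form of a band is identified with the pseudovector $\Omega_a=\frac12\epsilon_{abc}\Omega_{bc}$. Its Hodge decomposition is the Helmholtz decomposition $\boldsymbol{\Omega}=\langle\boldsymbol{\Omega}\rangle+\boldsymbol{\Omega}_\perp+\boldsymbol{\Omega}_\parallel$ into a constant field (harmonic sector), a transverse divergence-free field (exact sector) and a longitudinal curl-free gradient field (co-exact sector, sourced by Weyl nodes). The curvature may be singular at Weyl nodes ($|\boldsymbol{\Omega}|\sim1/r^2$). In that case the decomposition is understood in the distributional sense, and statements are read mode by mode (spectrally) or at finite lattice resolution. $f_0$ is the equilibrium occupation function of the band at chemical potential $\mu$, FS is the Fermi surface, and $\hat{\mathbf{n}}$ is its unit normal pointing out of the occupied region. $D_{ij}=\int_{\mathbb{T}^3}f_0\,\partial_i\Omega_j\,d^3k$ is the Berry-curvature dipole tensor, and repeated indices are summed. Neumann's principle: a property of a crystal is invariant under the point group of the crystal. A polar (pyroelectric) class is a crystallographic point group that fixes some nonzero polar vector; ten of the 32 classes are polar. *)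

(* Defs.v *)
From HB Require Import structures.
From mathcomp Require Import all_boot all_order all_algebra.
From mathcomp Require Import all_classical all_reals all_analysis.
Set Implicit Arguments.
Unset Strict Implicit.
Unset Printing Implicit Defensive.
Import Order.TTheory GRing.Theory Num.Theory.
Import numFieldNormedType.Exports.
Local Open Scope classical_set_scope.
Local Open Scope ring_scope.

(* Vectors are rows; a point operation g acts on the right, v |-> v *m g. *)

Section VectorCalculus.
Context {R : realType}.
Implicit Types (k u v : 'rV[R]_3) (f : 'rV[R]_3 -> R) (F : 'rV[R]_3 -> 'rV[R]_3).

(* The product of differences is 2 on (0,1,2), alternating, and 0 on repeats. *)
Definition eps (i j l : 'I_3) : R :=
  (j%:R - i%:R) * (l%:R - i%:R) * (l%:R - j%:R) / 2.

Definition cross u v : 'rV[R]_3 :=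
  \row_l \sum_(i < 3) \sum_(j < 3) eps l i j * u 0 i * v 0 j.

Definition dot u v : R := \sum_(i < 3) u 0 i * v 0 i.

Definition component F (i : 'I_3) : 'rV[R]_3 -> R := fun k => F k 0 i.

Definition pd (i : 'I_3) f : 'rV[R]_3 -> R := fun k => 'D_('e_i) f k.

(* pds [:: i1; ...; im] f = d_i1 ... d_im f *)
Definition pds (s : seq 'I_3) f : 'rV[R]_3 -> R := foldr pd f s.

Definition gradient f k : 'rV[R]_3 := \row_i pd i f k.

Definition curl F k : 'rV[R]_3 :=
  \row_l \sum_(i < 3) \sum_(j < 3) eps l i j * pd i (component F j) k.

Definition divergence F k : R := \sum_(i < 3) pd i (component F i) k.

Definition C1 f : Prop :=
  (forall k, differentiable f k) /\ (forall i, continuous (pd i f)).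

Definition C1_field F : Prop := forall i, C1 (component F i).

Definition smooth f : Prop := forall s k, differentiable (pds s f) k.

End VectorCalculus.

(* The torus is R^3 modulo the lattice spanned by the rows of B, the reciprocal
   lattice of the crystal; functions on it are the periodic functions on R^3. *)
Section Torus.
Context {R : realType}.
Variable B : 'M[R]_3.

Definition lattice (k : 'rV[R]_3) : Prop :=
  exists n : 'rV[int]_3, k = map_mx intr n *m B.

Definition lattice_periodic {T : Type} (f : 'rV[R]_3 -> T) : Prop :=
  forall k l, lattice l -> f (k + l) = f k.

Definition leb2 := (@lebesgue_measure R \x @lebesgue_measure R)%E.
Definition leb3 := (leb2 \x @lebesgue_measure R)%E.

Definition unit_cube : set (R * R * R) := `[0, 1] `*` `[0, 1] `*` `[0, 1].

Definition cell_point (t : R * R * R) : 'rV[R]_3 :=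
  (\row_i [:: t.1.1; t.1.2; t.2]`_i) *m B.

Definition torus_integrable (f : 'rV[R]_3 -> R) : Prop :=
  leb3.-integrable unit_cube (fun t => (f (cell_point t))%:E).

Definition cell_volume : R := `|\det B|.

Definition torus_int (f : 'rV[R]_3 -> R) : R :=
  cell_volume * \int[leb3]_(t in unit_cube) f (cell_point t).

Definition torus_mean (F : 'rV[R]_3 -> 'rV[R]_3) : 'rV[R]_3 :=
  \row_i (cell_volume^-1 * torus_int (component F i)).

(* Oh is the harmonic, Oe the exact and Oc the co-exact part. Exact: the 2-form
   is d of a periodic 1-form A, so its vector is curl A. *)
Definition helmholtz (Om Oh Oe Oc : 'rV[R]_3 -> 'rV[R]_3) : Prop :=
  [/\ forall k, Om k = Oh k + Oe k + Oc k,
      forall k, Oh k = torus_mean Om,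
      [/\ C1_field Oe, lattice_periodic Oe, forall k, divergence Oe k = 0 &
        exists A, [/\ C1_field A, lattice_periodic A & forall k, Oe k = curl A k]] &
      [/\ C1_field Oc, lattice_periodic Oc &
        exists phi, [/\ C1 phi, lattice_periodic phi & forall k, Oc k = gradient phi k]]].

Definition test_fun (g : 'rV[R]_3 -> R) : Prop := smooth g /\ lattice_periodic g.

Definition functional := ('rV[R]_3 -> R) -> R.

Definition torus_distribution (T : functional) : Prop :=
  [/\ forall g h, test_fun g -> test_fun h -> T (fun k => g k + h k) = T g + T h,
      forall c g, test_fun g -> T (fun k => c * g k) = c * T g &
      exists m C, forall g M, test_fun g ->
        (forall s k, (size s <= m)%N -> `|pds s g k| <= M) -> `|T g| <= C * M].

Definition distr_of (f : 'rV[R]_3 -> R) : functional :=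
  fun g => torus_int (fun k => f k * g k).

Definition distr_field (F : 'rV[R]_3 -> 'rV[R]_3) : 'I_3 -> functional :=
  fun i => distr_of (component F i).

Definition distr_pd (i : 'I_3) (T : functional) : functional :=
  fun g => - T (pd i g).

Definition distr_curl (T : 'I_3 -> functional) (l : 'I_3) : functional :=
  fun g => \sum_(i < 3) \sum_(j < 3) eps l i j * distr_pd i (T j) g.

Definition distr_helmholtz (Om : 'rV[R]_3 -> 'rV[R]_3)
    (Th Te Tc : 'I_3 -> functional) : Prop :=
  [/\ forall i, [/\ torus_distribution (Th i), torus_distribution (Te i)
        & torus_distribution (Tc i)],
      forall i g, test_fun g -> distr_field Om i g = Th i g + Te i g + Tc i g,
      forall i g, test_fun g -> Th i g = distr_field (fun=> torus_mean Om) i g,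
      (forall g, test_fun g -> \sum_(i < 3) distr_pd i (Te i) g = 0) /\
      (exists A : 'I_3 -> functional, (forall i, torus_distribution (A i)) /\
        forall i g, test_fun g -> Te i g = distr_curl A i g) &
      exists phi : functional, torus_distribution phi /\
        forall i g, test_fun g -> Tc i g = distr_pd i phi g].

(* dot (wavevector n) (t *m B) = 2 pi (n . t) *)
Definition wavevector (n : 'rV[int]_3) : 'rV[R]_3 :=
  (2 * pi) *: (map_mx intr n *m (invmx B)^T).

Definition cos_coef (Om : 'rV[R]_3 -> 'rV[R]_3) n : 'rV[R]_3 :=
  \row_i torus_int (fun k => Om k 0 i * cos (dot (wavevector n) k)).
Definition sin_coef (Om : 'rV[R]_3 -> 'rV[R]_3) n : 'rV[R]_3 :=
  \row_i torus_int (fun k => Om k 0 i * sin (dot (wavevector n) k)).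

(* The real part of the Fourier sum of Om over the modes in Q, hence that sum
   itself when Q = - Q. *)
Definition fourier_sum (Q : seq 'rV[int]_3) (Om : 'rV[R]_3 -> 'rV[R]_3) k :=
  \sum_(n <- Q) cell_volume^-1 *:
    (cos (dot (wavevector n) k) *: cos_coef Om n
     + sin (dot (wavevector n) k) *: sin_coef Om n).

(* A regular curvature is used as it is; a curvature that is only integrable,
   such as one with 1/r^2 singularities, is read through finitely many modes. *)
Inductive resolution := Full | Modes of seq 'rV[int]_3.

Definition resolve (r : resolution) (Om : 'rV[R]_3 -> 'rV[R]_3) :=
  if r is Modes Q then fourier_sum Q Om else Om.

Definition curvature (r : resolution) (Om : 'rV[R]_3 -> 'rV[R]_3) : Prop :=
  lattice_periodic Om /\
  match r with
  | Full => C1_field Om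
  | Modes Q => uniq Q /\ forall i, torus_integrable (component Om i)
  end.

Definition resolution_invariant (r : resolution) (g : 'M[R]_3) : Prop :=
  if r is Modes Q then
    forall n, n \in Q ->
      exists2 m, m \in Q & wavevector m = wavevector n *m g
  else True.

(* A piece of the periodic surface S that is a graph over an open rectangle of a
   coordinate plane, with its weight in a partition of unity on the torus. *)
Record graph_patch := Patch {
  axis : 'I_3;
  corner0 : R * R;
  corner1 : R * R;
  height : R * R -> R;
  weight : 'rV[R]_3 -> R }.

Definition patch_dom (p : graph_patch) : set (R * R) :=
  `](corner0 p).1, (corner1 p).1[ `*` `](corner0 p).2, (corner1 p).2[.

Definition graph_point (p : graph_patch) (x : R * R) : 'rV[R]_3 :=
  \row_j if unlift (axis p) j is Some j'
         then (if j' == ord0 then x.1 else x.2) else height p x.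

Definition height1 (p : graph_patch) (x : R * R) : R := 'D_(1, 0) (height p) x.
Definition height2 (p : graph_patch) (x : R * R) : R := 'D_(0, 1) (height p) x.

Definition area_element (p : graph_patch) (x : R * R) : R :=
  Num.sqrt (1 + height1 p x ^+ 2 + height2 p x ^+ 2).

Definition patch_of (S : set 'rV[R]_3) (p : graph_patch) : Prop :=
  [/\ forall x, patch_dom p x ->
        [/\ differentiable (height p) x, {for x, continuous (height1 p)}
          & {for x, continuous (height2 p)}],
      forall x, patch_dom p x -> S (graph_point p x),
      forall x y, patch_dom p x -> patch_dom p y ->
        lattice (graph_point p x - graph_point p y) -> x = y,
      [/\ continuous (weight p), lattice_periodic (weight p)
        & forall k, 0 <= weight p k] &
      exists K : set (R * R), [/\ compact K, K `<=` patch_dom p &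
        forall k, S k -> weight p k != 0 ->
          exists2 x, K x & lattice (k - graph_point p x)]].

Definition atlas (S : set 'rV[R]_3) (ps : seq graph_patch) : Prop :=
  (forall i : 'I_(size ps), patch_of S (tnth (in_tuple ps) i)) /\
  (forall k, S k -> \sum_(p <- ps) weight p k = 1).

Definition atlas_int (ps : seq graph_patch) (f : 'rV[R]_3 -> R) : R :=
  \sum_(p <- ps) \int[leb2]_(x in patch_dom p)
    (weight p (graph_point p x) * f (graph_point p x) * area_element p x).

(* The integral over S is v: the value does not depend on the atlas. *)
Definition is_surface_int (S : set 'rV[R]_3) (f : 'rV[R]_3 -> R) (v : R) : Prop :=
  (exists ps, atlas S ps) /\ (forall ps, atlas S ps -> atlas_int ps f = v).

End Torus.

Arguments leb2 {R}.
Arguments leb3 {R}.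

Section Band.
Context {R : realType}.
Implicit Types (E : 'rV[R]_3 -> R) (Om : 'rV[R]_3 -> 'rV[R]_3).

Definition band (B : 'M[R]_3) E : Prop := continuous E /\ lattice_periodic B E.

(* Zero temperature: the occupation is a step, so that its boundary is the Fermi
   surface. *)
Definition f0 E (mu : R) (k : 'rV[R]_3) : R := (E k <= mu)%R%:R.

Definition fermi_surface E (mu : R) : set 'rV[R]_3 := [set k | E k = mu].

(* E is only required to be C^1 near the Fermi surface, since bands have conical
   points at Weyl nodes. *)
Definition regular_fermi_surface E (mu : R) : Prop :=
  (exists U : set 'rV[R]_3, [/\ open U, fermi_surface E mu `<=` U &
    forall k, U k ->
      differentiable E k /\ forall i, {for k, continuous (pd i E)}]) /\
  (forall k, fermi_surface E mu k -> gradient E k != 0).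

(* E increases out of the occupied region. *)
Definition fermi_normal E (k : 'rV[R]_3) : 'rV[R]_3 :=
  (Num.sqrt (dot (gradient E k) (gradient E k)))^-1 *: gradient E k.

Definition curl_functional (B : 'M[R]_3) (g : 'rV[R]_3 -> R) Om : 'rV[R]_3 :=
  \row_l torus_int B (fun k => g k * curl Om k 0 l).

Definition P_obs (B : 'M[R]_3) E mu Om : 'rV[R]_3 :=
  curl_functional B (f0 E mu) Om.

Definition dipole (B : 'M[R]_3) E mu Om : 'M[R]_3 :=
  \matrix_(i, j) torus_int B (fun k => f0 E mu k * pd i (component Om j) k).

End Band.

Section Symmetry.
Context {R : realType}.
Implicit Types (g h : 'M[R]_3) (G H : set 'M[R]_3).

Definition O3 : set 'M[R]_3 := [set g | g *m g^T = 1%:M].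

Definition lattice_preserving (B : 'M[R]_3) g : Prop :=
  forall k, lattice B (k *m g) <-> lattice B k.

Definition act_scalar g (E : 'rV[R]_3 -> R) : 'rV[R]_3 -> R :=
  fun k => E (k *m invmx g).

Definition act_pseudovector g (Om : 'rV[R]_3 -> 'rV[R]_3) :
    'rV[R]_3 -> 'rV[R]_3 :=
  fun k => \det g *: (Om (k *m invmx g) *m g).

(* Preserving the reciprocal lattice is the same as preserving the direct one. *)
Definition point_group (B : 'M[R]_3) G : Prop :=
  [/\ G 1%:M, forall g h, G g -> G h -> G (g *m h),
      forall g, G g -> G (invmx g), G `<=` O3 &
      forall g, G g -> lattice_preserving B g].

Definition crystallographic G : Prop :=
  exists2 B : 'M[R]_3, B \in unitmx & point_group B G.

(* The conjugates of G in O(3) *)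
Definition crystal_class G : set (set 'M[R]_3) :=
  [set H | exists2 h, O3 h &
                      H = [set invmx h *m g *m h | g in G]].

Definition polar G : Prop :=
  exists v : 'rV[R]_3, v != 0 /\ forall g, G g -> v *m g = v.

Definition polar_classes : set (set (set 'M[R]_3)) :=
  [set crystal_class G | G in [set G | crystallographic G /\ polar G]].

End Symmetry.

(* Main.v *)
Require Import Defs.
From HB Require Import structures.
From mathcomp Require Import all_boot all_order all_algebra perm.
From mathcomp Require Import all_classical all_reals all_analysis.
From mathcomp Require Import measurable_realfun ring lra zify.
Set Implicit Arguments.
Unset Strict Implicit.
Unset Printing Implicit Defensive.
Import Order.TTheory GRing.Theory Num.Theory.
Import numFieldNormedType.Exports.
Local Open Scope classical_set_scope.
Local Open Scope ring_scope.

(** The curl of a gradient vanishes because second derivatives are symmetric: pointwise for a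
regular field, after moving the derivatives to the test function for a distribution.

For the Fermi surface formula, replace the step [f0] by C^1 cut-offs psi_n(E) that fall from 1
to 0 for E in [mu, mu + 1/(n+1)]. Integration by parts turns the integral of psi_n(E) curl W into
that of - psi_n'(E) (grad E x W), and - psi_n'(E) concentrates on the Fermi surface: along an axis
transverse to the surface, the substitution s = E(t) exhibits it as a Dirac mass divided by
|dE/dt|. On a graph patch |grad E| is |dE/dt| times the area element, so that the limit is the
surface integral. A partition of unity on the torus glues the patches, and the implicit function
theorem provides them.

P is a polar vector because the determinant by which the curl fails to be equivariant cancels the
one in the action on pseudovectors. A polar crystallographic group, conjugated so that it fixes the
third axis, consists of rotations about that axis, with integral traces, and possibly of reflections
through planes that contain it. This leaves the groups C_n and C_nv for n = 1, 2, 3, 4, 6, which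
are told apart by the traces of their rotations and by the presence of a determinant -1. *)

(** * Lebesgue measure on R^2 and R^3 *)

(** The surface integral must take the same value on every atlas, including atlases whose weights
    sum to 1, and have controlled supports, only on the surface itself. Two atlases are therefore
    never compared: the volume integrals of [level_bump] times a density mention no atlas, and each
    atlas integral is shown to be their limit. For this every patch is cut up again, by a second
    partition of unity, into boxes where [E] is monotone along the axis of the patch. What is left
    over vanishes on the surface but perhaps not near it; the same limit, for a density that is zero
    on the surface, disposes of it.

    [E] is differentiable only near the surface, yet the integration by parts runs over the whole
    torus. The cut-off of [E] is locally constant wherever [E] may be singular, and derivatives of
    [E], default values there, come multiplied by a bump that vanishes.

    Invariance of the torus integral under a point operation is proved on the torus itself, where
    the operation is an integer matrix in lattice coordinates. Changes of variables in R^3 serve to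
    unfold a torus integral onto a box and to single out an axis. *)

Section Affine.
Context {R : realType}.
Local Notation Rm := (measurableTypeR R).
Local Notation mu := (@lebesgue_measure R).

Let measurable_affine (a b : R) : measurable_fun [set: Rm] (fun t : Rm => a * t + b : Rm).
Proof. by apply: measurable_funD => //; exact: measurable_funM. Qed.

Let affine_pushforward (a b : R) : exists nu : {measure set Rm -> \bar R},
  forall A, nu A = (pushforward mu (fun t : Rm => a * t + b : Rm) A).
Proof.
by exists (measure_function_pushforward__canonical__measure_function_Measure mu
  (measurable_affine a b)).
Qed.

(** Both sides are measures in [A] and agree on half-open intervals, which determine Lebesgue
    measure. A negative [a] turns the preimage of []c, d]] into an interval closed on the left, of
    the same length. *)
Lemma lebesgue_measure_affine (a b : R) : a != 0 ->
  forall A : set Rm, measurable A ->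
  mu A = (`|a|%:E * mu ((fun t : Rm => a * t + b : Rm)%R @^-1` A))%E.
Proof.
move=> a0 A mA; have [nu nuE] := affine_pushforward a b.
transitivity (mscale (NngNum (normr_ge0 a)) nu A); last by rewrite /mscale nuE.
apply: lebesgue_measure_unique => // _ [[c d]] _ <-.
rewrite /= /mscale/= nuE /pushforward.
have [a_gt0|a_le0] := ltP 0 a.
  rewrite (_ : _ @^-1` _ = `](c - b) / a, (d - b) / a]%classic); last first.
    apply/seteqP; split=> x /=; rewrite !in_itv/= ltr_pdivrMr // ler_pdivlMr //; lra.
  rewrite !lebesgue_measure_itv/= !lte_fin ltr_pM2r ?invr_gt0//.
  rewrite (_ : c - b < d - b = (c < d)); last by lra.
  case: ifPn; rewrite ?mule0// => _; rewrite -EFinD -EFinM gtr0_norm//.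
  by congr EFin; field.
have {a_le0 a0} a0 : a < 0 by rewrite lt_neqAle a0.
rewrite (_ : _ @^-1` _ = `[(d - b) / a, (c - b) / a[%classic); last first.
  apply/seteqP; split=> x /=; rewrite !in_itv/= ler_ndivrMr // ltr_ndivlMr //; lra.
rewrite !lebesgue_measure_itv/= !lte_fin ltr_nM2r ?invr_lt0//.
rewrite (_ : d - b > c - b = (c < d)); last by lra.
case: ifPn; rewrite ?mule0// => _; rewrite -EFinD -EFinM ltr0_norm//.
by congr EFin; field; rewrite lt_eqF.
Qed.

Lemma ge0_integral_affine (a b : R) (f : Rm -> \bar R) :
  a != 0 -> measurable_fun setT f -> (forall x, 0 <= f x)%E ->
  (\int[mu]_x f x = `|a|%:E * \int[mu]_x f (a * x + b)%R)%E.
Proof.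
move=> a0 mf f0.
have := @ge0_integral_pushforward _ _ Rm Rm R _ (measurable_affine a b) mu setT f
  measurableT mf (fun x _ => f0 x).
rewrite preimage_setT /comp => <-.
have [nu nuE] := affine_pushforward a b.
rewrite [X in (_ * X)%E](_ : _ = (\int[nu]_y f y)%E); last first.
  by apply: eq_measure_integral => // A mA _; rewrite nuE.
rewrite -(@ge0_integral_mscale _ _ _ nu setT measurableT (NngNum (normr_ge0 a)) f)//.
by apply: eq_measure_integral => A mA _; rewrite /= /mscale/= nuE -lebesgue_measure_affine.
Qed.

End Affine.

Section OpenMeasurable.
Context {R : realType}.

(** The sigma-algebra is the product one, so an open set has to be written as a countable union of
    measurable boxes: balls of the sup norm with rational centre and radius 1/(m+1). *)
Lemma open_measurable3 (U : set (R * R * R)) : open U ->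
  measurable (U : set (measurableTypeR R * measurableTypeR R * measurableTypeR R)).
Proof.
move=> oU.
pose B (p : rat * rat * rat * nat) : set (R * R * R) :=
  ball ((ratr p.1.1.1, ratr p.1.1.2, ratr p.1.2) : R * R * R) p.2.+1%:R^-1.
have BE p : B p = (ball (ratr p.1.1.1 : R) p.2.+1%:R^-1 `*` ball (ratr p.1.1.2 : R) p.2.+1%:R^-1)
    `*` ball (ratr p.1.2 : R) p.2.+1%:R^-1 by [].
rewrite (_ : U = \bigcup_(p in [set p | B p `<=` U]) B p); last first.
  apply/seteqP; split=> [x Ux|x [p /= BU Bx]]; last exact: BU.
  have /nbhs_ballP[e /= e0 eU] : nbhs x U by apply: open_nbhs_nbhs.
  have [m me] : exists m, m.+1%:R^-1 < e / 2 by
    have [m _ h] := near_infty_natSinv_lt (PosNum (divr_gt0 e0 (ltr0n R 2))); exists m; apply: h => /=.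
  have rt (y : R) : exists q : rat, ball (ratr q : R) m.+1%:R^-1 y.
    have [|q /andP[]] := @rat_in_itvoo R (y - m.+1%:R^-1) (y + m.+1%:R^-1).
      by rewrite ltrD2l gtrN// invr_gt0.
    move=> q1 q2; exists q; rewrite /ball/= distrC ltr_distlC; apply/andP; split => //.
  case: x Ux eU => -[x y] z Ux eU.
  have [q1 h1] := rt x; have [q2 h2] := rt y; have [q3 h3] := rt z.
  exists (q1, q2, q3, m); last by rewrite BE.
  rewrite /= BE/= => -[[x' y'] z'] /= [[h1' h2'] h3']; apply: eU.
  have tri (u v q : R) : ball q m.+1%:R^-1 u -> ball q m.+1%:R^-1 v -> ball u e v.
    move=> hu hv; apply: le_ball (ltW _) _ (ball_triangle (ball_sym hu) hv).
    by rewrite (splitr e) ltrD.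
  by split=> /=; [split => /=|]; [exact: tri h1 h1'|exact: tri h2 h2'|exact: tri h3 h3'].
rewrite bigcup_mkcond; apply: countable_bigcupT_measurable => // p.
case: ifP => _ //; rewrite BE.
by apply: measurableX => //; [apply: measurableX|]; exact: measurable_ball.
Qed.

Lemma continuous_measurable3 (g : R * R * R -> R) : continuous g ->
  measurable_fun [set: measurableTypeR R * measurableTypeR R * measurableTypeR R]
    (g : _ -> measurableTypeR R).
Proof.
move=> cg; apply: (measurability _ (RGenOInfty.measurableE R)) => _ [_ [x ->] <-].
rewrite setTI; apply: open_measurable3; apply: open_comp => // *; exact: cg.
Qed.

End OpenMeasurable.

Section SigmaFinite.

(* The library attaches the sigma-finite structure of a product measure to
   products of subprobabilities only. *)
Lemma sigma_finite_product d1 d2 (T1 : measurableType d1) (T2 : measurableType d2)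
    (R : realType) (m1 : {sigma_finite_measure set T1 -> \bar R})
    (m2 : {sigma_finite_measure set T2 -> \bar R}) :
  sigma_finite setT (m1 \x m2)%E.
Proof.
have /sigma_finiteP[F [TF ndF Foo]] := sigma_finiteT m1.
have /sigma_finiteP[G [TG ndG Goo]] := sigma_finiteT m2.
exists (fun n => F n `*` G n).
  rewrite -setXTT TF TG predeqE => -[x y]; split.
    move=> [/= [n _ Fnx] [k _ Gky]]; exists (maxn n k) => //; split.
    - by move: x Fnx; exact/subsetPset/ndF/leq_maxl.
    - by move: y Gky; exact/subsetPset/ndG/leq_maxr.
  by move=> [n _ []/= ? ?]; split; exists n.
move=> k; have [? ?] := Foo k; have [? ?] := Goo k.
split; first exact: measurableX.
by rewrite product_measure1E// lte_mul_pinfty// ge0_fin_numE.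
Qed.

Context {R : realType}.

HB.instance Definition _ :=
  Measure.copy (@leb2 R) (@lebesgue_measure R \x @lebesgue_measure R)%E.
HB.instance Definition _ := Measure_isSigmaFinite.Build _ _ _ (@leb2 R)
  (sigma_finite_product lebesgue_measure lebesgue_measure).
HB.instance Definition _ := Measure.copy (@leb3 R) (leb2 \x @lebesgue_measure R)%E.
HB.instance Definition _ := Measure_isSigmaFinite.Build _ _ _ (@leb3 R)
  (sigma_finite_product leb2 lebesgue_measure).

End SigmaFinite.

Section Tonelli.
Local Open Scope ereal_scope.
Context d1 d2 (T1 : measurableType d1) (T2 : measurableType d2) (R : realType).
Variables (m1 : {sigma_finite_measure set T1 -> \bar R})
  (m2 : {sigma_finite_measure set T2 -> \bar R}).
Variables (A : set T1) (B : set T2).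
Hypotheses (mA : measurable A) (mB : measurable B).
Variable f : T1 * T2 -> \bar R.
Hypotheses (mf : measurable_fun setT f) (f0 : forall x, 0 <= f x).

Let g := f \_ (A `*` B).
Let mg : measurable_fun setT g.
Proof.
by apply/(measurable_restrictT f (measurableX mA mB)); exact: measurable_funS mf.
Qed.

Let g0 x : 0 <= g x. Proof. by rewrite /g patchE; case: ifP. Qed.

Lemma ge0_integralX1 :
  \int[m1 \x m2]_(z in A `*` B) f z = \int[m1]_(x in A) \int[m2]_(y in B) f (x, y).
Proof.
rewrite integral_mkcond fubini_tonelli1 // [RHS]integral_mkcond.
apply: eq_integral => x _; rewrite /fubini_F patchE; case: ifPn => [xA|xA].
  rewrite [RHS]integral_mkcond; apply: eq_integral => y _.
  by rewrite !patchE in_setX xA.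
by apply: integral0_eq => y _; rewrite patchE in_setX (negbTE xA).
Qed.

Lemma ge0_integralX2 :
  \int[m1 \x m2]_(z in A `*` B) f z = \int[m2]_(y in B) \int[m1]_(x in A) f (x, y).
Proof.
rewrite integral_mkcond fubini_tonelli2 // [RHS]integral_mkcond.
apply: eq_integral => y _; rewrite /fubini_G patchE; case: ifPn => [yB|yB].
  rewrite [RHS]integral_mkcond; apply: eq_integral => x _.
  by rewrite !patchE in_setX yB andbT.
by apply: integral0_eq => x _; rewrite patchE in_setX (negbTE yB) andbF.
Qed.

Lemma measurable_integralX1 : measurable_fun setT (fun x => \int[m2]_(y in B) f (x, y)).
Proof.
have mf' : measurable_fun setT (f \_ (setT `*` B)).
  by apply/(measurable_restrictT f (measurableX measurableT mB)); exact: measurable_funS mf.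
have f'0 x : 0 <= (f \_ (setT `*` B)) x by rewrite patchE; case: ifP.
apply: eq_measurable_fun (measurable_fun_fubini_tonelli_F _ mf' f'0) => x _.
rewrite /fubini_F [RHS]integral_mkcond; apply: eq_integral => y _.
by rewrite !patchE in_setX in_setT.
Qed.

End Tonelli.

(** * Periodic functions on the unit cube *)

Section CubeIntegral.
Context {R : realType}.
Local Notation Rm := (measurableTypeR R).
Local Notation T3 := (Rm * Rm * Rm)%type.
Local Notation mu := (@lebesgue_measure R).
Local Notation I01 := (`[0%R, 1%R]%classic : set R).
Local Open Scope ereal_scope.

Lemma ge0_integral3 (A B C : set Rm) (f : T3 -> \bar R) :
  measurable A -> measurable B -> measurable C ->
  measurable_fun setT f -> (forall x, 0 <= f x) ->
  \int[leb3]_(t in A `*` B `*` C) f t =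
  \int[mu]_(x in A) \int[mu]_(y in B) \int[mu]_(z in C) f (x, y, z).
Proof.
move=> mA mB mC mf f0.
have -> := @ge0_integralX1 _ _ (Rm * Rm)%type Rm R leb2 mu _ _ (measurableX mA mB) mC f mf f0.
have mF := @measurable_integralX1 _ _ _ _ R mu _ mC f mf f0.
have -> // := @ge0_integralX1 _ _ _ _ R mu mu _ _ mA mB _ mF.
by move=> t; apply: integral_ge0.
Qed.

(** By periodicity only the fractional part [v] of the shift matters. The translated interval [[v, 1
    + v[] is cut at 1, and its second piece is moved back by one period to [[0, v[]. *)
Lemma periodic_integral_shift (f : Rm -> \bar R) (u : R) :
  measurable_fun setT f -> (forall x, 0 <= f x) -> (forall x, f (x + 1)%R = f x) ->
  \int[mu]_(x in I01) f (x + u)%R = \int[mu]_(x in I01) f x.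
Proof.
move=> mf f0 f1.
have fn x (n : int) : f (x + n%:~R)%R = f x.
  have fnat y (m : nat) : f (y + m%:R)%R = f y.
    by elim: m => [|m IH]; rewrite ?addr0// -natr1 addrA f1.
  case: n => n; first exact: fnat.
  by rewrite NegzE mulrNz -[LHS](fnat _ n.+1)%R -addrA addNr addr0.
pose v := (u - (Num.floor u)%:~R)%R.
have [v0 v1] : (0 <= v)%R /\ (v < 1)%R.
  by rewrite /v subr_ge0 floor_le_tmp ltrBlDl -[X in (_ + X)%R]/(1%:~R)%R -intrD floorD1_gt.
have shift (a : R) g : measurable_fun setT g -> (forall x, 0 <= g x) ->
    \int[mu]_x g (x + a)%R = \int[mu]_x g x.
  move=> mg g0; rewrite [RHS](@ge0_integral_affine _ 1 a)// normr1 mul1e.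
  by apply: eq_integral => x _; rewrite mul1r.
have mshift (a : R) : measurable_fun setT (fun x : Rm => f (x + a)%R).
  apply: measurableT_comp => //; exact: measurable_funD.
transitivity (\int[mu]_(x in I01) f (x + v)%R).
  by apply: eq_integral => x _; rewrite -(fn _ (- Num.floor u)%R) mulrNz addrA.
have co g : measurable_fun setT g ->
    \int[mu]_(x in I01) g x = \int[mu]_(x in `[0%R, 1%R[%classic) g x.
  by move=> mg; rewrite integral_itv_bndo_bndc//; exact: measurable_funS mg.
have shiftI (a b w : R) : \int[mu]_(x in `[a, b[%classic) f (x + w)%R =
    \int[mu]_(x in `[(a + w)%R, (b + w)%R[%classic) f x.
  rewrite [RHS]integral_mkcond -(shift w); last 2 first.
  - by apply/(measurable_restrictT f) => //; exact: measurable_funS mf.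
  - by move=> x; rewrite patchE; case: ifP.
  rewrite [LHS]integral_mkcond; apply: eq_integral => x _.
  by rewrite !patchE !mem_setE !in_itv/= lerD2r ltrD2r.
rewrite !co// shiftI add0r.
have split3 (a b c : R) : (a <= b)%R -> (b <= c)%R ->
    \int[mu]_(x in `[a, c[%classic) f x =
    \int[mu]_(x in `[a, b[%classic) f x + \int[mu]_(x in `[b, c[%classic) f x.
  move=> ab bc; rewrite -ge0_integral_setU //=.
  - by rewrite -itv_bndbnd_setU// bnd_simp.
  - exact: measurable_funS mf.
  - apply/disj_set2P/seteqP; split=> // x [] /=; rewrite !in_itv/=.
    by move=> /andP[_ /lt_le_trans h] /andP[/h]; rewrite ltxx.
rewrite (split3 v 1%R (1 + v)%R)// ?(ltW v1) ?lerDl//.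
rewrite (split3 0%R v 1%R)// ?(ltW v1)// addeC; congr (_ + _).
transitivity (\int[mu]_(x in `[0%R, v[%classic) f (x + 1)%R).
  by rewrite shiftI add0r addrC.
by apply: eq_integral => x _; rewrite f1.
Qed.

Lemma lebesgue_measure_cube : leb3 (unit_cube : set T3) = 1.
Proof.
rewrite /leb3 /unit_cube product_measure1E //=; last exact: measurableX.
rewrite /leb2 product_measure1E // lebesgue_measure_itv /= lte_fin ltr01.
by rewrite oppr0 adde0 lebesgue_measure_itv /= lte_fin ltr01 sube0 !mule1.
Qed.

Definition unit_periodic {T : Type} (f : T3 -> T) :=
  [/\ forall x y z, f (x + 1, y, z)%R = f (x, y, z),
      forall x y z, f (x, y + 1, z)%R = f (x, y, z) &
      forall x y z, f (x, y, z + 1)%R = f (x, y, z)].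

Lemma unit_periodic_int {T : Type} (f : T3 -> T) (a b c : int) x y z :
  unit_periodic f -> f (x + a%:~R, y + b%:~R, z + c%:~R)%R = f (x, y, z).
Proof.
have fint (h : R -> T) : (forall t, h (t + 1)%R = h t) ->
    forall t (n : int), h (t + n%:~R)%R = h t.
  move=> h1 t n; have fnat s (m : nat) : h (s + m%:R)%R = h s.
    by elim: m => [|m IH]; rewrite ?addr0// -natr1 addrA h1.
  case: n => n; first exact: fnat.
  by rewrite NegzE mulrNz -[LHS](fnat _ n.+1)%R -addrA addNr addr0.
move=> [f1 f2 f3].
rewrite (fint (fun t => f (t, _, _))) => [|t]; last exact: f1.
rewrite (fint (fun t => f (_, t, _))) => [|t]; last exact: f2.
by rewrite (fint (fun t => f (_, _, t))).
Qed.

Lemma cube_integral_shift (f : T3 -> \bar R) (a b c : R) :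
  measurable_fun setT f -> (forall x, 0 <= f x) -> unit_periodic f ->
  \int[leb3]_(t in unit_cube) f (t.1.1 + a, t.1.2 + b, t.2 + c)%R =
  \int[leb3]_(t in unit_cube) f t.
Proof.
move=> mf f0 [f1 f2 f3].
have mfs : measurable_fun setT (fun t : T3 => f (t.1.1 + a, t.1.2 + b, t.2 + c)%R).
  apply: (measurableT_comp mf); apply/measurable_fun_pair; [apply/measurable_fun_pair|];
    apply: measurable_funD; first [exact: measurable_cst|exact: measurable_snd|
      exact: (measurableT_comp measurable_fst measurable_fst)|
      exact: (measurableT_comp measurable_snd measurable_fst)].
have mI : measurable (I01 : set Rm) by exact: measurable_itv.
have -> := @ge0_integral3 _ _ _ _ mI mI mI mf f0.
have -> := @ge0_integral3 _ _ _ _ mI mI mI mfs (fun t => f0 _).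
have mz x y : measurable_fun setT (fun z : Rm => f (x, y, z)).
  by apply: measurableT_comp => //; exact: pair1_measurable.
have mF : measurable_fun setT (fun p : Rm * Rm => \int[mu]_(z in I01) f (p.1, p.2, z)).
  have := @measurable_integralX1 _ _ _ _ R mu I01 mI f mf f0.
  by apply: eq_measurable_fun => -[] /=.
have my x : measurable_fun setT (fun y : Rm => \int[mu]_(z in I01) f (x, y, z)).
  exact: (measurableT_comp mF (pair1_measurable x)).
transitivity (\int[mu]_(x in I01) \int[mu]_(y in I01) \int[mu]_(z in I01) f ((x + a)%R, y, z)).
  apply: eq_integral => x _ /=.
  rewrite -[RHS](@periodic_integral_shift _ b) //; last 2 first.
  - by move=> y; apply: integral_ge0.
  - by move=> y; apply: eq_integral => z _; rewrite f2.
  by apply: eq_integral => y _; rewrite (@periodic_integral_shift (fun z => f (_, _, z))%R c).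
pose G x := \int[mu]_(y in I01) \int[mu]_(z in I01) f (x, y, z).
apply: (@periodic_integral_shift G a).
- have := @measurable_integralX1 _ _ _ _ R mu I01 mI _ mF.
  by apply=> // ?; apply: integral_ge0.
- by move=> x; apply: integral_ge0 => y _; apply: integral_ge0.
- by move=> x; apply: eq_integral => y _; apply: eq_integral => z _; rewrite f1.
Qed.

Let frac (x : Rm) : Rm := (x - (Num.floor x)%:~R)%R.

(** Integrability on the torus gives measurability on the cube only; composing with the fractional
    parts extends it to the whole space, where translations and matrices act. *)
Lemma unit_periodic_measurable d (U : measurableType d) (f : T3 -> U) :
  unit_periodic f -> measurable_fun (unit_cube : set T3) f -> measurable_fun setT f.
Proof.
move=> pf mf.
have mfrac : measurable_fun [set: Rm] frac.
  apply: measurable_funB => //; apply: nondecreasing_measurable => // x y xy.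
  by rewrite ler_int; exact: le_floor.
have fE t : f t = f (frac t.1.1, frac t.1.2, frac t.2).
  by case: t => -[x y] z /=; rewrite /frac -!mulrNz unit_periodic_int.
apply: (@eq_measurable_fun _ _ _ _ _ (f \o (fun t : T3 => (frac t.1.1, frac t.1.2, frac t.2)))).
  by move=> t _ /=; rewrite -fE.
apply: (measurable_comp _ _ mf).
- by apply: measurableX => //; exact: measurableX.
- have fr x : (0 <= frac x <= 1)%R.
    by rewrite /frac subr_ge0 floor_le_tmp/= lerBlDl ltW// -[X in (_ + X)%R]/(1%:~R)%R -intrD floorD1_gt.
  by move=> _ [t _ <-] /=; rewrite /unit_cube /= !in_itv/= !fr.
- apply/measurable_fun_pair; [apply/measurable_fun_pair|]; apply: (measurableT_comp mfrac);
    first [exact: measurable_snd|exact: (measurableT_comp measurable_fst measurable_fst)|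
      exact: (measurableT_comp measurable_snd measurable_fst)].
Qed.

End CubeIntegral.

Section Rowt.
Context {R : realType}.
Local Notation Rm := (measurableTypeR R).
Local Notation T3 := (Rm * Rm * Rm)%type.

(** The product measure lives on triples, the calculus and the matrix action on rows. Measurability
    of a function of rows is stated throughout for its composite with [rowt]. *)
Definition rowt (t : R * R * R) : 'rV[R]_3 := \row_i [:: t.1.1; t.1.2; t.2]`_i.
Definition trow (v : 'rV[R]_3) : R * R * R := (v 0 0, v 0 1, v 0 2).

Lemma ord3P (P : 'I_3 -> Prop) : P 0 -> P 1 -> P 2 -> forall i, P i.
Proof.
move=> P0 P1 P2 [[|[|[|//]]] i3].
- by rewrite (_ : Ordinal i3 = 0)//; exact/val_inj.
- by rewrite (_ : Ordinal i3 = 1)//; exact/val_inj.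
- by rewrite (_ : Ordinal i3 = 2)//; exact/val_inj.
Qed.

Lemma sum3E (V : nmodType) (F : 'I_3 -> V) : \sum_(i < 3) F i = F 0 + F 1 + F 2.
Proof.
rewrite !big_ord_recl big_ord0 addr0 addrA; congr (_ + F _ + F _); exact/val_inj.
Qed.

Lemma rowt0 t : rowt t 0 0 = t.1.1. Proof. by rewrite mxE. Qed.

Lemma rowt1 t : rowt t 0 1 = t.1.2. Proof. by rewrite mxE. Qed.

Lemma rowt2 t : rowt t 0 2 = t.2. Proof. by rewrite mxE. Qed.

Definition rowtE := (rowt0, rowt1, rowt2).

Lemma trowK : cancel trow rowt.
Proof. by move=> v; apply/rowP; apply: ord3P; rewrite rowtE. Qed.

Lemma measurable_rowt_coord i : measurable_fun [set: T3] (fun t : T3 => rowt t 0 i : Rm).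
Proof.
move: i; apply: ord3P; under eq_fun do rewrite rowtE.
- exact: (measurableT_comp measurable_fst measurable_fst).
- exact: (measurableT_comp measurable_snd measurable_fst).
- exact: measurable_snd.
Qed.

Lemma measurable_row_comp d d' (T : measurableType d) (U : measurableType d')
    (f : 'rV[R]_3 -> U) (h : T -> 'rV[R]_3) :
  measurable_fun [set: T3] (fun t : T3 => f (rowt t)) ->
  (forall i, measurable_fun setT (fun x => h x 0 i : Rm)) ->
  measurable_fun setT (fun x => f (h x)).
Proof.
move=> mf mh.
have mt : measurable_fun setT (fun x => trow (h x) : T3).
  by apply/measurable_fun_pair; [apply/measurable_fun_pair|]; exact: mh.
apply: eq_measurable_fun (measurableT_comp mf mt) => x _ /=.
by rewrite trowK.
Qed.

Lemma measurable_mulmx_coord d (T : measurableType d) (h : T -> 'rV[R]_3)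
    (C : 'M[R]_3) i :
  (forall i, measurable_fun setT (fun x => h x 0 i : Rm)) ->
  measurable_fun setT (fun x => (h x *m C) 0 i : Rm).
Proof.
move=> mh; under eq_fun do rewrite mxE sum3E.
by apply: measurable_funD; [apply: measurable_funD|]; apply: measurable_funM => //; exact: mh.
Qed.

Lemma measurable_addmx_coord d (T : measurableType d) (h k : T -> 'rV[R]_3) i :
  (forall i, measurable_fun setT (fun x => h x 0 i : Rm)) ->
  (forall i, measurable_fun setT (fun x => k x 0 i : Rm)) ->
  measurable_fun setT (fun x => (h x + k x) 0 i : Rm).
Proof. by move=> mh mk; under eq_fun do rewrite mxE; apply: measurable_funD; [exact: mh|exact: mk]. Qed.

Lemma measurable_rowt_mulmx d' (U : measurableType d') (f : 'rV[R]_3 -> U)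
    (C : 'M[R]_3) :
  measurable_fun [set: T3] (fun t : T3 => f (rowt t)) ->
  measurable_fun [set: T3] (fun t : T3 => f (rowt t *m C)).
Proof.
move=> mf; apply: (measurable_row_comp mf) => i.
by apply: measurable_mulmx_coord => j; exact: measurable_rowt_coord.
Qed.

Definition int_periodic {T : Type} (f : 'rV[R]_3 -> T) :=
  forall v (n : 'rV[int]_3), f (v + map_mx intr n) = f v.

Lemma int_periodic_unit {T : Type} (f : 'rV[R]_3 -> T) :
  int_periodic f -> @unit_periodic R T (fun t => f (rowt t)).
Proof.
move=> pf; split=> x y z.
- rewrite -[RHS](pf _ (\row_i (i == 0)%:R)); congr f.
  by apply/rowP; apply: ord3P; rewrite !mxE /= ?addr0.
- rewrite -[RHS](pf _ (\row_i (i == 1)%:R)); congr f.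
  by apply/rowP; apply: ord3P; rewrite !mxE /= ?addr0.
- rewrite -[RHS](pf _ (\row_i (i == 2)%:R)); congr f.
  by apply/rowP; apply: ord3P; rewrite !mxE /= ?addr0.
Qed.

Local Open Scope ereal_scope.
Local Notation D := (unit_cube : set T3).

Lemma measurable_unit_cube : measurable D.
Proof. by apply: measurableX => //; exact: measurableX. Qed.

Lemma cube_integral_shift_row (f : 'rV[R]_3 -> \bar R) (u : 'rV[R]_3) :
  measurable_fun setT (fun t : T3 => f (rowt t)) -> (forall v, 0 <= f v) ->
  int_periodic f ->
  \int[leb3]_(t in D) f (rowt t + u)%R = \int[leb3]_(t in D) f (rowt t).
Proof.
move=> mf f0 pf.
have <- := cube_integral_shift (u 0%R 0%R) (u 0%R 1%R) (u 0%R 2%R) mf (fun t => f0 _) (int_periodic_unit pf).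
apply: eq_integral => t _; congr f; apply/rowP; apply: ord3P.
- by rewrite [LHS]mxE !rowtE.
- by rewrite [LHS]mxE !rowtE.
- by rewrite [LHS]mxE !rowtE.
Qed.

(* Averaging f(tK + u) over t and u in the cube in either order gives the two sides. *)
Lemma ge0_cube_integral_mulmx (f : 'rV[R]_3 -> \bar R) (M : 'M[int]_3) :
  measurable_fun setT (fun t : T3 => f (rowt t)) -> (forall v, 0 <= f v) ->
  int_periodic f -> map_mx intr M \in @unitmx R 3 ->
  \int[leb3]_(t in D) f (rowt t *m map_mx intr M) = \int[leb3]_(t in D) f (rowt t).
Proof.
move=> mf f0 pf; set K := map_mx intr M => uK.
pose F (p : T3 * T3) := f (rowt p.1 *m K + rowt p.2)%R.
have mF : measurable_fun setT F.
  apply: (measurable_row_comp mf) => i; apply: measurable_addmx_coord => j.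
    apply: measurable_mulmx_coord => k.
    exact: (measurableT_comp (measurable_rowt_coord k) measurable_fst).
  exact: (measurableT_comp (measurable_rowt_coord j) measurable_snd).
have mD := measurable_unit_cube.
have E1 := @ge0_integralX1 _ _ T3 T3 R leb3 leb3 _ _ mD mD F mF (fun t => f0 _).
have E2 := @ge0_integralX2 _ _ T3 T3 R leb3 leb3 _ _ mD mD F mF (fun t => f0 _).
have cstD (c : \bar R) : \int[leb3]_(t in D) c = c.
  by rewrite integral_cst//= lebesgue_measure_cube mule1.
transitivity (\int[(leb3 \x leb3)%E]_(z in D `*` D) F z).
  rewrite E2 -[LHS]cstD; apply: eq_integral => u _ /=; rewrite /F /=.
  have pK : int_periodic (fun v => f (v *m K)).
    by move=> v n; rewrite mulmxDl -map_mxM pf.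
  rewrite -(@cube_integral_shift_row (fun v => f (v *m K)) (rowt u *m invmx K) (measurable_rowt_mulmx K mf) (fun v => f0 _) pK).
  by apply: eq_integral => t _; rewrite mulmxDl mulmxKV.
rewrite E1 -[RHS]cstD; apply: eq_integral => t _ /=; rewrite /F /=.
rewrite -(cube_integral_shift_row (rowt t *m K) mf)//.
by apply: eq_integral => u _; rewrite addrC.
Qed.

Section RealValued.
Variable g : 'rV[R]_3 -> R.
Hypotheses (mg : measurable_fun D (fun t : T3 => g (rowt t) : Rm)) (pg : int_periodic g).

Let mgT : measurable_fun setT (fun t : T3 => g (rowt t) : Rm).
Proof. exact: unit_periodic_measurable (int_periodic_unit pg) mg. Qed.

Let mpos : measurable_fun setT (fun t : T3 => (Num.max (g (rowt t)) 0)%:E).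
Proof. by apply/measurable_EFinP; apply: measurable_maxr. Qed.

Let mneg : measurable_fun setT (fun t : T3 => (Num.max (- g (rowt t)) 0)%:E).
Proof. by apply/measurable_EFinP; apply: measurable_maxr => //; apply: measurable_funN. Qed.

Let integral_posneg (h : T3 -> 'rV[R]_3) :
  \int[leb3]_(t in D) (g (h t))%:E =
  \int[leb3]_(t in D) (Num.max (g (h t)) 0)%:E - \int[leb3]_(t in D) (Num.max (- g (h t)) 0)%:E.
Proof.
rewrite integralE; congr (_ - _); apply: eq_integral => t _.
  by rewrite funeposE/= EFin_max.
by rewrite funenegE/= EFin_max.
Qed.

Lemma cube_integral_shift_real (u : 'rV[R]_3) :
  \int[leb3]_(t in D) (g (rowt t + u)%R)%:E = \int[leb3]_(t in D) (g (rowt t))%:E.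
Proof.
rewrite !integral_posneg; congr (_ - _).
  apply: (@cube_integral_shift_row (fun v => (Num.max (g v) 0)%:E)) => //.
    by move=> v; rewrite lee_fin le_max lexx orbT.
  by move=> v n; rewrite pg.
apply: (@cube_integral_shift_row (fun v => (Num.max (- g v) 0)%:E)) => //.
  by move=> v; rewrite lee_fin le_max lexx orbT.
by move=> v n; rewrite pg.
Qed.

Lemma cube_integral_mulmx (M : 'M[int]_3) : map_mx intr M \in @unitmx R 3 ->
  \int[leb3]_(t in D) (g (rowt t *m map_mx intr M)%R)%:E = \int[leb3]_(t in D) (g (rowt t))%:E.
Proof.
move=> uM; rewrite !integral_posneg; congr (_ - _).
  apply: (@ge0_cube_integral_mulmx (fun v => (Num.max (g v) 0)%:E)) => //.
    by move=> v; rewrite lee_fin le_max lexx orbT.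
  by move=> v n; rewrite pg.
apply: (@ge0_cube_integral_mulmx (fun v => (Num.max (- g v) 0)%:E)) => //.
  by move=> v; rewrite lee_fin le_max lexx orbT.
by move=> v n; rewrite pg.
Qed.

End RealValued.
End Rowt.

(** * Linear changes of variables *)

Section LinearChange.
Context {R : realType}.
Local Notation Rm := (measurableTypeR R).
Local Notation T3 := (Rm * Rm * Rm)%type.
Local Notation mu := (@lebesgue_measure R).

Lemma ge0_integral3T (f : T3 -> \bar R) :
  measurable_fun setT f -> (forall x, 0 <= f x)%E ->
  (\int[leb3]_t f t = \int[mu]_x \int[mu]_y \int[mu]_z f (x, y, z))%E.
Proof.
move=> mf f0; rewrite -setXTT -(@setXTT Rm Rm).
exact: ge0_integral3.
Qed.

Definition scales_volume (C : 'M[R]_3) := forall f : 'rV[R]_3 -> \bar R,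
  measurable_fun setT (fun t : T3 => f (rowt t)) -> (forall v, 0 <= f v)%E ->
  (`|\det C|%:E * \int[leb3]_t f (rowt t *m C) = \int[leb3]_t f (rowt t))%E.

Lemma scales_volumeM C1 C2 :
  scales_volume C1 -> scales_volume C2 -> scales_volume (C1 *m C2).
Proof.
move=> s1 s2 f mf f0; rewrite -(s2 _ mf f0).
rewrite -(s1 (fun v => f (v *m C2)) (measurable_rowt_mulmx C2 mf))//.
rewrite det_mulmx normrM EFinM -muleA muleCA; congr (_ * (_ * _))%E.
by apply: eq_integral => t _; rewrite mulmxA.
Qed.

Lemma scales_volume1 : scales_volume 1%:M.
Proof.
move=> f mf f0; rewrite det1 normr1 mul1e; apply: eq_integral => t _.
by rewrite mulmx1.
Qed.

Lemma rowt_tperm12 (x y z : R) : rowt (x, y, z) *m tperm_mx 1 2 = rowt (x, z, y).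
Proof.
rewrite -xcolE; apply/rowP; apply: ord3P; by rewrite !mxE ?permE.
Qed.

Lemma rowt_tperm01 (x y z : R) : rowt (x, y, z) *m tperm_mx 0 1 = rowt (y, x, z).
Proof.
rewrite -xcolE; apply/rowP; apply: ord3P; by rewrite !mxE ?permE.
Qed.

Lemma normr_det_tperm (i j : 'I_3) : `|\det (tperm_mx i j : 'M[R]_3)| = 1.
Proof. by rewrite det_perm normrX normrN1 expr1n. Qed.

Lemma scales_volume12 : scales_volume (tperm_mx 1 2).
Proof.
move=> f mf f0; rewrite normr_det_tperm mul1e.
have -> := ge0_integral3T (measurable_rowt_mulmx (tperm_mx 1 2) mf) (fun t => f0 _).
have -> := ge0_integral3T mf (fun t => f0 _).
apply: eq_integral => x _.
have mfx : measurable_fun setT (fun p : Rm * Rm => f (rowt (x, p.1, p.2))).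
  apply: (measurableT_comp mf); apply/measurable_fun_pair; last exact: measurable_snd.
  apply/measurable_fun_pair; [exact: measurable_cst|exact: measurable_fst].
have := @fubini_tonelli _ _ Rm Rm R mu mu _ mfx (fun p => f0 _).
rewrite /fubini_F /fubini_G /= => ->.
by apply: eq_integral => y _; apply: eq_integral => z _; rewrite rowt_tperm12.
Qed.

Lemma scales_volume01 : scales_volume (tperm_mx 0 1).
Proof.
move=> f mf f0; rewrite normr_det_tperm mul1e.
have -> := ge0_integral3T (measurable_rowt_mulmx (tperm_mx 0 1) mf) (fun t => f0 _).
have -> := ge0_integral3T mf (fun t => f0 _).
pose G (p : Rm * Rm) := (\int[mu]_z f (rowt (p.1, p.2, z)))%E.
have mG : measurable_fun setT G.
  have := @measurable_fun_fubini_tonelli_F _ _ (Rm * Rm)%type Rm R mu _ mf (fun t => f0 _).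
  by apply: eq_measurable_fun => -[].
have G0 p : (0 <= G p)%E by apply: integral_ge0.
have := @fubini_tonelli _ _ Rm Rm R mu mu _ mG G0.
rewrite /fubini_F /fubini_G /G /= => ->.
apply: eq_integral => x _; apply: eq_integral => y _; apply: eq_integral => z _.
by rewrite rowt_tperm01.
Qed.

Lemma scales_volume_tperm (i j : 'I_3) : scales_volume (tperm_mx i j).
Proof.
have s02 : scales_volume (tperm_mx 0 2).
  rewrite (_ : tperm_mx 0 2 = tperm_mx 0 1 *m tperm_mx 1 2 *m tperm_mx 0 1).
    apply: scales_volumeM; [apply: scales_volumeM|]; first [exact: scales_volume01|exact: scales_volume12].
  rewrite -!perm_mxM; congr perm_mx; apply/permP; apply: ord3P;
  by rewrite !permM !permE /= ?permE /= ?permE.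
have tC (k l : 'I_3) : tperm_mx k l = tperm_mx l k :> 'M[R]_3 by rewrite /tperm_mx tpermC.
have t1 (k : 'I_3) : tperm_mx k k = 1%:M :> 'M[R]_3 by rewrite /tperm_mx tperm1 perm_mx1.
move: i j; apply: ord3P; apply: ord3P; rewrite ?t1; do ?[exact: scales_volume1|
  exact: scales_volume01|exact: scales_volume12|exact: s02];
  rewrite tC; [exact: scales_volume01|exact: s02|exact: scales_volume12].
Qed.

Lemma scales_volume_perm (s : 'S_3) : scales_volume (perm_mx s).
Proof.
have [ts -> _] := prod_tpermP s; elim: ts => [|t ts IH].
  by rewrite big_nil perm_mx1; exact: scales_volume1.
by rewrite big_cons perm_mxM; apply: scales_volumeM => //; exact: scales_volume_tperm.
Qed.

(** Multiplying a row by this matrix on the right changes the coordinate [j] only, which becomes an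
    affine function of itself. *)
Definition column_replaced (j : 'I_3) (c : 'I_3 -> R) : 'M[R]_3 :=
  \matrix_(a, b) if b == j then c a else (a == b)%:R.

(** For fixed [x] and [y] the innermost integral undergoes the affine substitution of slope [c 2]
    and offset [x * c 0 + y * c 1]. *)
Lemma scales_volume_column2 c : c 2 != 0 -> scales_volume (column_replaced 2 c).
Proof.
move=> c2 f mf f0.
have -> : \det (column_replaced 2 c) = c 2.
  rewrite -det_tr det_trig; last first.
    apply/is_trig_mxP; apply: ord3P; apply: ord3P => //; by rewrite !mxE.
  rewrite !big_ord_recl big_ord0 !mxE /= !mul1r mulr1; congr c; exact/val_inj.
have -> := ge0_integral3T (measurable_rowt_mulmx (column_replaced 2 c) mf) (fun t => f0 _).
have -> := ge0_integral3T mf (fun t => f0 _).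
have mF := @measurable_fun_fubini_tonelli_F _ _ (Rm * Rm)%type Rm R mu _ mf (fun t => f0 _).
have mx : forall x y : Rm, measurable_fun setT (fun z : Rm => f (rowt (x, y, z))).
  by move=> x y; apply: (measurableT_comp mf); exact: pair1_measurable.
have inner x y : (\int[mu]_z f (rowt (x, y, z)) =
    `|c 2%R|%:E * \int[mu]_z f (rowt (x, y, z) *m column_replaced 2%R c))%E.
  rewrite (ge0_integral_affine (x * c 0 + y * c 1) c2)//; congr (_ * _)%E.
  apply: eq_integral => z _; congr f; apply/rowP; apply: ord3P;
  rewrite [RHS]mxE sum3E !mxE /=; ring.
transitivity (`|c 2%R|%:E * \int[mu]_x \int[mu]_y (`|c 2%R|^-1%:E * \int[mu]_z f (rowt (x, y, z))))%E.
  congr (_ * _)%E; apply: eq_integral => x _; apply: eq_integral => y _.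
  by rewrite inner muleA -EFinM mulVf ?normr_eq0// mul1e.
transitivity (`|c 2%R|%:E * \int[mu]_x (`|c 2%R|^-1%:E * \int[mu]_y (\int[mu]_z f (rowt (x, y, z)))))%E.
  congr (_ * _)%E; apply: eq_integral => x _.
  rewrite ge0_integralZl_EFin//.
  - by move=> y _; apply: integral_ge0.
  - exact: (measurableT_comp mF (pair1_measurable x)).
rewrite ge0_integralZl_EFin//; last 2 first.
- by move=> x _; apply: integral_ge0 => y _; apply: integral_ge0.
- have mG : measurable_fun setT (fun p : Rm * Rm => \int[mu]_z f (rowt (p.1, p.2, z)))%E.
    by apply: eq_measurable_fun mF => -[].
  apply: (@measurable_fun_fubini_tonelli_F _ _ Rm Rm R mu _ mG) => p.
  exact: integral_ge0.
by rewrite muleA -EFinM divff ?normr_eq0// mul1e.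
Qed.

Lemma scales_volume_column j c : c j != 0 -> scales_volume (column_replaced j c).
Proof.
move=> cj; rewrite (_ : column_replaced j c =
  tperm_mx j 2 *m column_replaced 2 (fun i => c (tperm j 2 i)) *m tperm_mx j 2).
  apply: scales_volumeM; first apply: scales_volumeM; try exact: scales_volume_tperm.
  by apply: scales_volume_column2; rewrite tpermR.
rewrite -xrowE -xcolE; apply/matrixP => a b; rewrite !mxE tpermK.
by rewrite (inj_eq perm_inj) -(inj_eq (@perm_inj _ (tperm j 2)) b) tpermL.
Qed.

(** The matrices that scale volume by their determinant are closed under products and contain the
    transpositions, by Tonelli, and the identity with one column replaced. A decomposition of a row
    permutation of [C] into triangular factors reduces every invertible matrix to these. *)
Lemma scales_volume_unit (C : 'M[R]_3) : C \in unitmx -> scales_volume C.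
Proof.
move=> uC; have [P [L [U [/existsP[s /eqP Ps] dL Uu Ll PC]]]] :
    exists P L U : 'M[R]_3, [/\ is_perm_mx P, \det L = 1,
      forall i j : 'I_3, (j < i)%N -> U i j = 0,
      forall i j : 'I_3, (i <= j)%N -> L i j = (i == j)%:R & P *m C = L *m U].
  exists (cormen_lup C).1.1, (cormen_lup C).1.2, (cormen_lup C).2; split.
  - exact: cormen_lup_perm.
  - exact: cormen_lup_detL.
  - exact: cormen_lup_upper.
  - exact: cormen_lup_lower.
  - by case: (cormen_lup C) (cormen_lup_correct C) => -[].
have Cn0 : \det C != 0 by move: uC; rewrite unitmxE unitfE.
have Un0 i : U i i != 0.
  have : \det U != 0.
    have /(congr1 (fun A => \det A)) := PC.
    rewrite !det_mulmx dL mul1r => <-; rewrite mulf_neq0//.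
    by rewrite Ps det_perm signr_eq0.
  rewrite -det_tr det_trig; last by apply/is_trig_mxP => a b ab; rewrite mxE Uu.
  by move=> /prodf_neq0 /(_ i isT); rewrite mxE.
have -> : C = perm_mx s^-1 *m (L *m U).
  by rewrite perm_mxV -Ps -PC mulKmx// Ps unitmx_perm.
have [L00 L11 L22] : [/\ L 0 0 = 1, L 1 1 = 1 & L 2 2 = 1] by rewrite !Ll.
have [L01 L02 L12] : [/\ L 0 1 = 0, L 0 2 = 0 & L 1 2 = 0] by rewrite !Ll.
have [U10 U20 U21] : [/\ U 1 0 = 0, U 2 0 = 0 & U 2 1 = 0] by rewrite !Uu.
(* The last column of [L] is that of the identity, so two factors give [L]. [U] takes three, in the
   opposite order, and its pivots are nonzero because [C] is invertible. *)
have -> : L = column_replaced 0 (fun i => L i 0) *m column_replaced 1 (fun i => L i 1).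
  apply/matrixP; apply: ord3P; apply: ord3P; rewrite !mxE sum3E !mxE /= ?(L00, L11, L22, L01, L02, L12); ring.
have -> : U = column_replaced 2 (fun i => U i 2) *m column_replaced 1 (fun i => U i 1)
    *m column_replaced 0 (fun i => U i 0).
  apply/matrixP; apply: ord3P; apply: ord3P; do 2 rewrite !mxE !sum3E; rewrite !mxE /= ?(U10, U20, U21); ring.
apply: scales_volumeM; first exact: scales_volume_perm.
apply: scales_volumeM; first by apply: scales_volumeM; apply: scales_volume_column; rewrite Ll// oner_eq0.
by apply: scales_volumeM; [apply: scales_volumeM|]; apply: scales_volume_column.
Qed.

(** Same formula as [graph_point], with the height as a free coordinate: a graph point is by
    definition the axis point at its height. *)
Definition axis_point (a : 'I_3) (x : R * R) (s : R) : 'rV[R]_3 :=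
  \row_j if unlift a j is Some j' then (if j' == ord0 then x.1 else x.2) else s.

Lemma axis_pointE a x s : axis_point a x s =
  rowt (x.1, x.2, s) *m (if a == 0 then tperm_mx 1 2 *m tperm_mx 0 1
                         else if a == 1 then tperm_mx 1 2 else 1%:M).
Proof.
have axis_point_j (b j : 'I_3) : axis_point b x s 0 j =
    if unlift b j is Some j' then (if j' == ord0 then x.1 else x.2) else s by rewrite mxE.
have liftE (b j : 'I_3) (k : 'I_2) : j = lift b k -> unlift b j = Some k.
  by move=> ->; rewrite liftK.
have l0 (b j : 'I_3) : j = lift b ord0 -> axis_point b x s 0 j = x.1.
  by move=> /liftE e; rewrite axis_point_j e.
have l1 (b j : 'I_3) : j = lift b (lift ord0 ord0) -> axis_point b x s 0 j = x.2.
  by move=> /liftE e; rewrite axis_point_j e.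
have ls (b : 'I_3) : axis_point b x s 0 b = s by rewrite axis_point_j unlift_none.
move: a; apply: ord3P; apply/rowP.
- rewrite /= mulmxA rowt_tperm12 rowt_tperm01.
  apply: ord3P; rewrite !rowtE /=; [exact: ls|apply: l0|apply: l1]; exact/val_inj.
- rewrite /= rowt_tperm12.
  apply: ord3P; rewrite !rowtE /=; [apply: l0|exact: ls|apply: l1]; exact/val_inj.
- rewrite /= mulmx1.
  apply: ord3P; rewrite !rowtE /=; [apply: l0|apply: l1|exact: ls]; exact/val_inj.
Qed.

Lemma ge0_integral_axis_point (a : 'I_3) (f : 'rV[R]_3 -> \bar R) :
  measurable_fun setT (fun t : T3 => f (rowt t)) -> (forall v, 0 <= f v)%E ->
  (\int[leb3]_t f (axis_point a t.1 t.2) = \int[leb3]_t f (rowt t))%E.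
Proof.
move=> mf f0; under eq_integral do rewrite axis_pointE -!surjective_pairing.
set C := if _ then _ else _.
have dC : `|\det C| = 1.
  by rewrite /C; do 2?case: ifP => _; rewrite ?det_mulmx ?normrM ?normr_det_tperm ?mulr1 ?det1 ?normr1.
rewrite -(scales_volume_unit _ mf f0 (C := C)) ?dC ?mul1e//.
by rewrite unitmxE unitfE -normr_eq0 dC oner_eq0.
Qed.

Lemma ge0_integral_rowt_shift (f : 'rV[R]_3 -> \bar R) (u : 'rV[R]_3) :
  measurable_fun setT (fun t : T3 => f (rowt t)) -> (forall v, 0 <= f v)%E ->
  (\int[leb3]_t f (rowt t + u)%R = \int[leb3]_t f (rowt t))%E.
Proof.
move=> mf f0.
have shift (a : R) (g : Rm -> \bar R) : measurable_fun setT g -> (forall x, 0 <= g x)%E ->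
    (\int[mu]_x g (x + a)%R = \int[mu]_x g x)%E.
  move=> mg g0; rewrite [RHS](@ge0_integral_affine _ 1 a) ?oner_eq0// normr1 mul1e.
  by apply: eq_integral => x _; rewrite mul1r.
have mfu : measurable_fun setT (fun t : T3 => f (rowt t + u)).
  apply: (measurable_row_comp mf) => i; apply: measurable_addmx_coord => j.
    exact: measurable_rowt_coord.
  exact: measurable_cst.
have -> := ge0_integral3T mfu (fun t => f0 _).
have -> := ge0_integral3T mf (fun t => f0 _).
have mF := @measurable_fun_fubini_tonelli_F _ _ (Rm * Rm)%type Rm R mu _ mf (fun t => f0 _).
have mG : measurable_fun setT (fun p : Rm * Rm => \int[mu]_z f (rowt (p.1, p.2, z)))%E.
  by apply: eq_measurable_fun mF => -[].
have E x y z : rowt (x, y, z) + u = rowt (x + u 0 0, y + u 0 1, z + u 0 2)%R.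
  by apply/rowP; apply: ord3P; rewrite [LHS]mxE !rowtE.
transitivity (\int[mu]_x \int[mu]_y \int[mu]_z f (rowt (x + u 0 0, y, z)%R))%E.
  apply: eq_integral => x _.
  rewrite -[RHS](shift (u 0 1)); last 2 first.
  - exact: (measurableT_comp mG (pair1_measurable _)).
  - by move=> y; apply: integral_ge0.
  apply: eq_integral => y _; rewrite -[RHS](shift (u 0 2))//.
    by apply: eq_integral => z _; rewrite E.
  by apply: (measurableT_comp mf); exact: pair1_measurable.
rewrite -[RHS](shift (u 0 0))//.
- apply: (@measurable_fun_fubini_tonelli_F _ _ Rm Rm R mu _ mG) => p.
  exact: integral_ge0.
- by move=> x; apply: integral_ge0 => y _; apply: integral_ge0.
Qed.

End LinearChange.

(** * Integration on the torus *)

Section TorusIntegral.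
Context {R : realType}.
Variable B : 'M[R]_3.
Hypothesis uB : B \in unitmx.
Local Notation Rm := (measurableTypeR R).
Local Notation T3 := (Rm * Rm * Rm)%type.
Local Notation mu := (@lebesgue_measure R).
Local Notation D := (unit_cube : set T3).

Lemma latticeD k l : lattice B k -> lattice B l -> lattice B (k + l).
Proof. by move=> [n ->] [m ->]; exists (n + m); rewrite map_mxD mulmxDl. Qed.

Lemma latticeN k : lattice B k -> lattice B (- k).
Proof. by move=> [n ->]; exists (- n); rewrite map_mxN mulNmx. Qed.

Lemma latticeB k l : lattice B k -> lattice B l -> lattice B (k - l).
Proof. by move=> lk ll; apply: latticeD => //; exact: latticeN. Qed.

Lemma lattice_periodicB {T : Type} (f : 'rV[R]_3 -> T) k l :
  lattice_periodic B f -> lattice B l -> f (k - l) = f k.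
Proof. by move=> pf ll; rewrite -(pf (k - l) l ll) subrK. Qed.

Lemma lattice_periodic_int {T : Type} (f : 'rV[R]_3 -> T) :
  lattice_periodic B f -> int_periodic (fun v => f (v *m B)).
Proof. by move=> pf v n; rewrite mulmxDl pf//; exists n. Qed.

Lemma mx_norm_lt (v : 'rV[R]_3) e : 0 < e -> (`|v| < e) = [forall i, `|v 0 i| < e].
Proof.
move=> e0; rewrite [X in X < _]mx_normrE.
apply/idP/forallP => [h i|h].
  apply: le_lt_trans h; rewrite /=.
  have := @le_bigmax_cond _ _ _ (0 : R) (0, i) xpredT (fun x : 'I_1 * 'I_3 => `|v x.1 x.2|) isT.
  by [].
apply/bigmax_ltP; split => // -[i j] _ /=.
by rewrite (ord1 i).
Qed.

(* [f] is integrated on a box containing its support modulo the lattice. *)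
Lemma ge0_torus_integral_box (f : 'rV[R]_3 -> \bar R) (Q : set 'rV[R]_3) (s : 'rV[R]_3) :
  measurable_fun setT (fun t : T3 => f (rowt t)) -> (forall v, 0 <= f v)%E ->
  lattice_periodic B f ->
  measurable [set t : T3 | Q (rowt t)] ->
  (forall v i, Q v -> `|((v - s) *m invmx B) 0 i| < 4^-1) ->
  (forall v, f v != 0%E -> exists2 l, lattice B l & Q (v - l)) ->
  (`|\det B|%:E * \int[leb3]_(t in D) f (rowt t *m B) =
   \int[leb3]_(t in [set t : T3 | Q (rowt t)]) f (rowt t))%E.
Proof.
move=> mf f0 pf mQ Qs fQ.
(* The unit cube is shifted so that [s] becomes the centre of the cell. *)
pose u : 'rV[R]_3 := s *m invmx B - const_mx 2^-1.
have mfB := measurable_rowt_mulmx B mf.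
have := @cube_integral_shift_row _ (fun v => f (v *m B)) u mfB (fun v => f0 _) (lattice_periodic_int pf).
move=> <-.
pose g v := (f v * (\1_Q v)%:E)%E.
have mg : measurable_fun setT (fun t : T3 => g (rowt t)).
  apply: emeasurable_funM => //; apply/measurable_EFinP.
  rewrite (_ : (fun t : T3 => \1_Q (rowt t)) = \1_[set t : T3 | Q (rowt t)]).
    exact: measurable_indic.
  by apply/funext => t; rewrite !indicE; congr (_%:R); apply/idP/idP; rewrite !inE.
have g0 v : (0 <= g v)%E by rewrite mule_ge0// lee_fin.
transitivity (\int[leb3]_t g (rowt t))%E; last first.
  rewrite [RHS]integral_mkcond; apply: eq_integral => t _; rewrite patchE /g indicE.
  rewrite (_ : (rowt t \in Q) = (t \in [set t : T3 | Q (rowt t)])); last by apply/idP/idP; rewrite !inE.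
  by case: ifP; rewrite ?mule1 ?mule0.
rewrite -(scales_volume_unit uB mg)//; congr (_ * _)%E.
have mgB := measurable_rowt_mulmx B mg.
rewrite -(@ge0_integral_rowt_shift _ (fun v => g (v *m B)) u mgB)//.
rewrite integral_mkcond; apply: eq_integral => t _; rewrite patchE.
set v := (rowt t + u)%R *m B.
have vE i : (((v - s) *m invmx B) 0 i = rowt t 0 i - 2^-1)%R.
  by rewrite mulmxBl mulmxK// !mxE; ring.
have tDP : reflect (forall i, 0 <= rowt t 0 i <= 1)%R (t \in D).
  apply: (iffP idP) => [|h].
    rewrite inE => -[[/= ]]; rewrite !in_itv/= => h0 h1 h2.
    by apply: ord3P; rewrite rowtE.
  rewrite inE; split => /=; rewrite ?in_itv/= -?rowt0 -?rowt1 -?rowt2//.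
case: ifPn => [/tDP tD|tD].
  rewrite /g indicE; case: (pselect (Q v)) => [Qv|nQv]; first by rewrite mem_set// mule1.
  rewrite memNset// mule0; apply/eqP/negPn/negP => fv0.
  have [l [n ln] Ql] := fQ _ fv0.
  (* In lattice coordinates relative to [s], the point [v] lies within 1/2 and its translate [v - l]
     in [Q] within 1/4, so the integer coordinates of [l] are smaller than 3/4 in absolute value. *)
  have n0 : n = 0.
    apply/rowP => i; rewrite mxE; apply/eqP; rewrite -normr_le0 -ltz1D.
    have := Qs _ i Ql; rewrite (_ : v - l - s = (v - s) - l)%R; last by rewrite addrAC.
    rewrite mulmxBl mxE vE [X in (_ + X)%R]mxE ln mulmxK// [X in (_ - X)%R]mxE => h.
    have := tD i => /andP[h1 h2].
    rewrite addr0 -(ltr_int R) intr_norm.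
    move: h; rewrite !ltr_norml; lra.
  by apply: nQv; move: Ql; rewrite ln n0 map_mx0 mul0mx subr0.
rewrite /g indicE memNset ?mule0// => Qv; move/negP: tD; apply; apply/tDP => i.
have := Qs _ i Qv; rewrite vE ltr_norml; lra.
Qed.

(** Infinite values are covered as well: [fine] is 0 there, before and after the multiplication. *)
Lemma fine_mulZl (c : R) (x : \bar R) : fine (c%:E * x) = c * fine x.
Proof.
case: x => [r| |] //=; rewrite mulr0.
- by have [->|c0] := eqVneq c 0; rewrite ?mul0e// mulry; case: sgrP c0 => //=; rewrite ?mul1e ?mulN1e.
- by have [->|c0] := eqVneq c 0; rewrite ?mul0e// mulrNy; case: sgrP c0 => //=; rewrite ?mul1e ?mulN1e.
Qed.

Lemma torus_intE (f : 'rV[R]_3 -> R) :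
  torus_int B f = fine (`|\det B|%:E * \int[leb3]_(t in D) (f (rowt t *m B))%:E)%E.
Proof. by rewrite fine_mulZl. Qed.

Lemma torus_integral_box (f : 'rV[R]_3 -> R) (Q : set 'rV[R]_3) (s : 'rV[R]_3) :
  measurable_fun setT (fun t : T3 => f (rowt t) : Rm) ->
  lattice_periodic B f ->
  measurable [set t : T3 | Q (rowt t)] ->
  (forall v i, Q v -> `|((v - s) *m invmx B) 0 i| < 4^-1) ->
  (forall v, f v != 0 -> exists2 l, lattice B l & Q (v - l)) ->
  leb3.-integrable D (fun t => (f (rowt t *m B))%:E) ->
  torus_int B f = \int[leb3]_(t in [set t : T3 | Q (rowt t)]) f (rowt t).
Proof.
move=> mf pf mQ Qs fQ fi.
rewrite torus_intE /Rintegral; congr fine.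
rewrite [X in (_ * X)%E]integralE [in RHS]integralE.
have mp : measurable_fun setT (fun t : T3 => (Num.max (f (rowt t)) 0)%:E).
  by apply/measurable_EFinP; apply: measurable_maxr.
have mn : measurable_fun setT (fun t : T3 => (Num.max (- f (rowt t)) 0)%:E).
  by apply/measurable_EFinP; apply: measurable_maxr => //; exact: measurable_funN.
have fp (h : T3 -> 'rV[R]_3) : (fun t => (f (h t))%:E)^\+%E = (fun t => (Num.max (f (h t)) 0)%:E).
  by apply/funext => t; rewrite funeposE EFin_max.
have fn (h : T3 -> 'rV[R]_3) : (fun t => (f (h t))%:E)^\-%E = (fun t => (Num.max (- f (h t)) 0)%:E).
  by apply/funext => t; rewrite funenegE EFin_max.
rewrite !fp !fn.
rewrite -(@ge0_torus_integral_box (fun v => (Num.max (f v) 0)%:E) Q s mp)//; last 3 first.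
- by move=> v; rewrite lee_fin le_max lexx orbT.
- by move=> v l ll; rewrite pf.
- by move=> v v0; apply: fQ; apply: contraNneq v0 => ->; rewrite maxxx.
rewrite -(@ge0_torus_integral_box (fun v => (Num.max (- f v) 0)%:E) Q s mn)//; last 3 first.
- by move=> v; rewrite lee_fin le_max lexx orbT.
- by move=> v l ll; rewrite pf.
- by move=> v v0; apply: fQ; apply: contraNneq v0 => ->; rewrite oppr0 maxxx.
rewrite muleBr//; rewrite -fp -fn fin_num_adde_defl//.
rewrite fin_numN; exact: (integrable_neg_fin_num measurable_unit_cube fi).
Qed.

Lemma Rintegral_prod_bounded (g : T3 -> R) (S : set (Rm * Rm)) (I : set Rm) (M : R) :
  measurable_fun setT (g : T3 -> Rm) ->
  measurable S -> measurable I -> (leb2 S < +oo)%E -> (mu I < +oo)%E ->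
  (forall x s, S x -> I s -> `|g (x, s)| <= M) ->
  \int[leb3]_(t in S `*` I) g t = \int[leb2]_(x in S) \int[mu]_(s in I) g (x, s).
Proof.
move=> mg mS mI Sfin Ifin gM.
have mSI : measurable (S `*` I) by exact: measurableX.
have SIfin : (leb3 (S `*` I) < +oo)%E.
  by rewrite /leb3 product_measure1E// lte_mul_pinfty// ge0_fin_numE.
have gi : leb3.-integrable (S `*` I) (EFin \o g).
  apply: measurable_bounded_integrable => //; first exact: measurable_funS mg.
  exists M; split; first exact: num_real.
  by move=> x Mx t [St It]; apply: le_trans (ltW Mx); rewrite [t]surjective_pairing; exact: gM.
have gi' : leb3.-integrable setT ((EFin \o g) \_ (S `*` I)) by apply/(integrable_mkcond _ mSI).
rewrite /Rintegral integral_mkcond.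
have <- := @integral12_prod_meas1 _ _ (Rm * Rm)%type Rm R leb2 mu _ gi'.
congr fine; rewrite [RHS]integral_mkcond; apply: eq_integral => x _.
rewrite /fubini_F patchE; case: ifPn => [xS|xS]; last first.
  by apply: integral0_eq => y _; rewrite patchE in_setX (negbTE xS).
rewrite fineK; last first.
  rewrite (_ : (\int[mu]_(s in I) _)%E = \int[mu]_(s in I) (g (x, s))%:E)%E//.
  apply: integrable_fin_num => //; apply: (@measurable_bounded_integrable _ _ _ mu (fun s => g (x, s))) => //.
    apply: measurable_funTS; apply: (measurableT_comp mg); exact: pair1_measurable.
  exists M; split; first exact: num_real.
  by move=> y My s Is; apply: le_trans (ltW My); apply: gM => //; rewrite -inE.
rewrite [RHS]integral_mkcond; apply: eq_integral => y _.
by rewrite !patchE in_setX xS.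
Qed.

(** The permutation of coordinates that moves the axis [a] to the last place preserves volume. It is
    applied to the positive and the negative part, after which Fubini on [S] times [I] finishes. *)
Lemma Rintegral_axis_point (f : 'rV[R]_3 -> R) (Q : set 'rV[R]_3) (a : 'I_3)
    (S : set (Rm * Rm)) (I : set Rm) (M : R) :
  measurable_fun setT (fun t : T3 => f (rowt t) : Rm) ->
  measurable S -> measurable I -> (leb2 S < +oo)%E -> (mu I < +oo)%E ->
  (forall x s, Q (axis_point a x s) <-> S x /\ I s) ->
  measurable [set t : T3 | Q (rowt t)] ->
  (forall v, Q v -> `|f v| <= M) ->
  \int[leb3]_(t in [set t : T3 | Q (rowt t)]) f (rowt t) =
  \int[leb2]_(x in S) \int[mu]_(s in I) f (axis_point a x s).
Proof.
move=> mf mS mI Sfin Ifin QSI mQ fM.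
have mfa : measurable_fun setT (fun t : T3 => f (axis_point a t.1 t.2) : Rm).
  apply: (measurable_row_comp mf) => i; under eq_fun do rewrite axis_pointE -!surjective_pairing.
  apply: measurable_mulmx_coord => j; exact: measurable_rowt_coord.
rewrite -(@Rintegral_prod_bounded (fun t => f (axis_point a t.1 t.2)) S I M)//; last first.
  by move=> x s Sx Is; apply: fM; apply/QSI.
have key (g : 'rV[R]_3 -> R) : measurable_fun setT (fun t : T3 => g (rowt t) : Rm) ->
    (forall v, 0 <= g v) ->
    (\int[leb3]_(t in [set t : T3 | Q (rowt t)]) (g (rowt t))%:E =
     \int[leb3]_(t in S `*` I) (g (axis_point a t.1 t.2))%:E)%E.
  have QE (t : T3) : (rowt t \in Q) = (t \in [set t : T3 | Q (rowt t)]).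
    by apply/idP/idP; rewrite !inE.
  have SIE (t : T3) : (axis_point a t.1 t.2 \in Q) = (t \in S `*` I).
    by apply/idP/idP; rewrite !inE => /QSI.
  move=> mg g0; pose h v : \bar R := if v \in Q then (g v)%:E else 0%E.
  have mh : measurable_fun setT (fun t : T3 => h (rowt t)).
    rewrite (_ : (fun t : T3 => h (rowt t)) = (fun t : T3 => (g (rowt t))%:E) \_ [set t : T3 | Q (rowt t)]).
      apply/(measurable_restrictT _ mQ); apply: measurable_funTS; exact/measurable_EFinP.
    by apply/funext => t; rewrite patchE /h QE.
  have h0 v : (0 <= h v)%E by rewrite /h; case: ifP => _ //; rewrite lee_fin.
  rewrite [LHS]integral_mkcond [RHS]integral_mkcond.
  transitivity (\int[leb3]_t h (rowt t))%E.
    by apply: eq_integral => t _; rewrite patchE /h QE.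
  rewrite -(ge0_integral_axis_point a mh h0); apply: eq_integral => t _.
  by rewrite patchE /h SIE.
rewrite /Rintegral; congr fine; rewrite integralE [in RHS]integralE.
have fp (h : T3 -> 'rV[R]_3) : (fun t => (f (h t))%:E)^\+%E = (fun t => (Num.max (f (h t)) 0)%:E).
  by apply/funext => t; rewrite funeposE EFin_max.
have fn (h : T3 -> 'rV[R]_3) : (fun t => (f (h t))%:E)^\-%E = (fun t => (Num.max (- f (h t)) 0)%:E).
  by apply/funext => t; rewrite funenegE EFin_max.
rewrite !fp !fn; congr (_ - _)%E.
- apply: (key (fun v => Num.max (f v) 0)); first exact: measurable_maxr.
  by move=> v; rewrite le_max lexx orbT.
- apply: (key (fun v => Num.max (- f v) 0)).
    by apply: measurable_maxr => //; exact: measurable_funN.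
  by move=> v; rewrite le_max lexx orbT.
Qed.

End TorusIntegral.

Section RowContinuity.
Context {R : realType}.

Lemma cvg_row3 {T : Type} (F : set_system T) (FF : Filter F) (h : T -> 'rV[R]_3) (l : 'rV[R]_3) :
  (forall i, (fun y => h y 0 i) @ F --> l 0 i) -> h @ F --> l.
Proof.
move=> hl; apply/cvgrPdist_lt => e e0.
have H i : \forall t \near F, `|l 0 i - h t 0 i| < e by move/cvgrPdist_lt: (hl i); apply.
near=> t; rewrite mx_norm_lt//; apply/forallP; apply: ord3P; rewrite !mxE.
- by near: t; exact: H.
- by near: t; exact: H.
- by near: t; exact: H.
Unshelve. all: by end_near. Qed.

Lemma continuous_coord i : continuous (fun v : 'rV[R]_3 => v 0 i).
Proof. by move=> v; exact: coord_continuous. Qed.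

Lemma continuous_rowt : continuous (@rowt R).
Proof.
move=> t; apply: cvg_row3; apply: ord3P; rewrite rowtE; under eq_fun do rewrite rowtE.
- by apply: (@cvg_comp _ _ _ fst fst _ (nbhs t.1)); [exact: cvg_fst|exact: cvg_fst].
- by apply: (@cvg_comp _ _ _ fst snd _ (nbhs t.1)); [exact: cvg_fst|exact: cvg_snd].
- exact: cvg_snd.
Qed.

Lemma continuous_mulmx (C : 'M[R]_3) : continuous (fun v : 'rV[R]_3 => v *m C).
Proof.
move=> v; apply: (cvg_row3 (nbhs_filter v)) => i; rewrite mxE sum3E; under eq_fun do rewrite mxE sum3E.
by apply: cvgD; [apply: cvgD|]; apply: cvgMl; exact: continuous_coord.
Qed.

Lemma continuous_addr (u : 'rV[R]_3) : continuous (fun v : 'rV[R]_3 => v + u).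
Proof.
move=> v; apply: (cvg_row3 (nbhs_filter v)) => i; rewrite mxE; under eq_fun do rewrite mxE.
by apply: cvgD; [exact: continuous_coord|exact: cvg_cst].
Qed.

Lemma measurable_rowt_continuous (f : 'rV[R]_3 -> R) : continuous f ->
  measurable_fun [set: measurableTypeR R * measurableTypeR R * measurableTypeR R]
    (fun t => f (rowt t) : measurableTypeR R).
Proof.
move=> cf; apply: continuous_measurable3 => t.
by apply: continuous_comp; [exact: continuous_rowt|exact: cf].
Qed.

End RowContinuity.

Section Cell.
Context {R : realType}.
Variable B : 'M[R]_3.
Hypothesis uB : B \in unitmx.

Definition closed_cell : set 'rV[R]_3 :=
  (fun v => v *m B) @` [set v : 'rV[R]_3 | forall i, v 0 i \in `[0, 1]].

Lemma compact_closed_cell : compact closed_cell.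
Proof.
apply: continuous_compact; first by apply: continuous_subspaceT; exact: continuous_mulmx.
have := @rV_compact R 3 (fun=> `[0, 1]%classic) (fun=> @segment_compact _ _ _).
by congr compact; apply/seteqP; split => v /=.
Qed.

Lemma closed_cellP k : exists2 l, lattice B l & closed_cell (k - l).
Proof.
exists (map_mx intr (\row_i Num.floor ((k *m invmx B) 0 i)) *m B); first by eexists.
exists (k *m invmx B - map_mx intr (\row_i Num.floor ((k *m invmx B) 0 i))).
  move=> i; rewrite in_itv/= [X in X <= _ <= _]/(0) !mxE.
  set x := (\sum_(_ < _) _); rewrite subr_ge0 floor_le_tmp/= lerBlDl ltW//.
  by rewrite -[X in (_ + X)%R]/(1%:~R)%R -intrD floorD1_gt.
by rewrite mulmxBl mulmxKV.
Qed.

Lemma periodic_bounded (f : 'rV[R]_3 -> R) :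
  continuous f -> lattice_periodic B f -> exists M, forall k, `|f k| <= M.
Proof.
move=> cf pf.
have cn : continuous (fun k => `|f k|) 
  by move=> k; apply: (continuous_comp (cf k)); exact: norm_continuous.
have K0 : closed_cell !=set0 by have [l _ h] := closed_cellP 0; exists (0 - l).
have [c _ cM] := @compact_EVT_max _ _ (fun k => `|f k|) _ K0 compact_closed_cell (continuous_subspaceT cn).
exists `|f c| => k; have [l ll kl] := closed_cellP k.
by rewrite -(lattice_periodicB k pf ll); apply: cM; rewrite inE.
Qed.

End Cell.

Section BoundedConvergence.
Context d (T : measurableType d) (R : realType) (m : {measure set T -> \bar R}).

(** Integrability of the limit is part of the conclusion: this is how the integrand over a graph
    patch is known to be integrable. *)
Lemma bounded_Rintegral_cvg (D : set T) (f_ : nat -> T -> R) (f : T -> R) (M : R) :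
  measurable D -> (m D < +oo)%E ->
  (forall n, measurable_fun D (f_ n)) -> (forall n x, D x -> `|f_ n x| <= M) ->
  (forall x, D x -> f_ n x @[n --> \oo] --> f x) ->
  m.-integrable D (EFin \o f) /\
  \int[m]_(x in D) f_ n x @[n --> \oo] --> \int[m]_(x in D) f x.
Proof.
move=> mD fD mf fM ff.
have mlim : measurable_fun D f by apply: (measurable_fun_cvg (h := f_)).
have bf x : D x -> `|f x| <= M.
  move=> Dx; have h : `|f_ n x| @[n --> \oo] --> `|f x| by apply: cvg_norm; exact: ff.
  rewrite -(cvg_lim (@Rhausdorff R) h); apply: limr_le; last by near=> n; exact: fM.
  by apply/cvg_ex; exists `|f x|.
have fi : m.-integrable D (EFin \o f).
  apply: measurable_bounded_integrable => //; exists M; split; first exact: num_real.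
  by move=> x Mx t Dt; apply: le_trans (ltW Mx); exact: bf.
split => //; apply: fine_cvg.
rewrite fineK; last by apply: integrable_fin_num.
apply: (@dominated_cvg _ _ _ m D mD (fun n x => (f_ n x)%:E) _ (fun=> M%:E)).
- by move=> n; exact/measurable_EFinP.
- by move=> t Dt; apply: cvg_EFin; [near=> n|exact: ff].
- by [].
- apply: (@measurable_bounded_integrable _ _ _ m (fun=> M)); [exact: mD|exact: fD|exact: measurable_cst|].
  by exists `|M|; split; [exact: num_real|move=> x Mx t _; exact: ltW].
- by move=> n t Dt; rewrite lee_fin; exact: fM.
Unshelve. all: by end_near. Qed.

End BoundedConvergence.

Section TorusInt.
Context {R : realType}.
Variable B : 'M[R]_3.
Hypothesis uB : B \in unitmx.
Local Notation Rm := (measurableTypeR R).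
Local Notation T3 := (Rm * Rm * Rm)%type.
Local Notation D := (unit_cube : set T3).
Implicit Types f g : 'rV[R]_3 -> R.

(** A class that contains the continuous periodic functions and the discontinuous step [f0], and is
    stable under the sums and products that occur below. *)
Definition bounded_measurable f :=
  measurable_fun setT (fun t : T3 => f (rowt t) : Rm) /\ exists M, forall k, `|f k| <= M.

Lemma bounded_measurable_continuous f :
  continuous f -> lattice_periodic B f -> bounded_measurable f.
Proof.
by move=> cf pf; split; [exact: measurable_rowt_continuous|exact: periodic_bounded pf].
Qed.

Lemma bounded_measurable_cst c : bounded_measurable (fun=> c).
Proof. by split; [exact: measurable_cst|exists `|c|]. Qed.

Lemma bounded_measurableD f g :
  bounded_measurable f -> bounded_measurable g -> bounded_measurable (fun k => f k + g k).
Proof.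
move=> [mf [M fM]] [mg [N gN]]; split; first exact: measurable_funD.
by exists (M + N) => k; apply: le_trans (ler_normD _ _) _; exact: lerD.
Qed.

Lemma bounded_measurableM f g :
  bounded_measurable f -> bounded_measurable g -> bounded_measurable (fun k => f k * g k).
Proof.
move=> [mf [M fM]] [mg [N gN]]; split; first exact: measurable_funM.
by exists (M * N) => k; rewrite normrM; exact: ler_pM.
Qed.

Lemma bounded_measurable_sum (I : Type) (r : seq I) (F : I -> 'rV[R]_3 -> R) :
  (forall i, bounded_measurable (F i)) -> bounded_measurable (fun k => \sum_(i <- r) F i k).
Proof.
move=> bF; elim: r => [|i r IH].
  by under eq_fun do rewrite big_nil; exact: bounded_measurable_cst.
by under eq_fun do rewrite big_cons; exact: bounded_measurableD.
Qed.

Lemma cube_lty : (leb3 D < +oo)%E.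
Proof. by rewrite lebesgue_measure_cube ltry. Qed.

Lemma bounded_measurable_integrable f : bounded_measurable f -> torus_integrable B f.
Proof.
move=> [mf [M fM]]; apply: measurable_bounded_integrable.
- exact: measurable_unit_cube.
- exact: cube_lty.
- by apply: measurable_funTS; exact: measurable_rowt_mulmx.
- exists M; split; first exact: num_real.
  by move=> x Mx t _; apply: le_trans (ltW Mx); exact: fM.
Qed.

Lemma torus_intD f g : torus_integrable B f -> torus_integrable B g ->
  torus_int B (fun k => f k + g k) = torus_int B f + torus_int B g.
Proof.
by move=> fi gi; rewrite /torus_int RintegralD// ?mulrDr//; exact: measurable_unit_cube.
Qed.

Lemma torus_intZ c f : torus_integrable B f ->
  torus_int B (fun k => c * f k) = c * torus_int B f.
Proof.
move=> fi; rewrite /torus_int RintegralZl//; last exact: measurable_unit_cube.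
by rewrite mulrCA.
Qed.

Lemma torus_integrableD f g : torus_integrable B f -> torus_integrable B g ->
  torus_integrable B (fun k => f k + g k).
Proof.
move=> fi gi; rewrite /torus_integrable; under eq_fun do rewrite EFinD.
by apply: integrableD => //; exact: measurable_unit_cube.
Qed.

Lemma torus_integrableZ c f : torus_integrable B f -> torus_integrable B (fun k => c * f k).
Proof.
move=> fi; rewrite /torus_integrable; under eq_fun do rewrite EFinM.
by apply: integrableZl => //; exact: measurable_unit_cube.
Qed.

Lemma torus_int0 : torus_int B (fun=> 0) = 0.
Proof. by rewrite /torus_int Rintegral_cst ?mul0r ?mulr0//; exact: measurable_unit_cube. Qed.

Lemma torus_integrable_sum (I : Type) (r : seq I) (F : I -> 'rV[R]_3 -> R) :
  (forall i, torus_integrable B (F i)) ->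
  torus_integrable B (fun k => \sum_(i <- r) F i k).
Proof.
move=> Fi; elim: r => [|i s IH]; last by under eq_fun do rewrite big_cons; exact: torus_integrableD.
under eq_fun do rewrite big_nil.
by apply: bounded_measurable_integrable; exact: bounded_measurable_cst.
Qed.

Lemma torus_int_sum (I : Type) (r : seq I) (F : I -> 'rV[R]_3 -> R) :
  (forall i, torus_integrable B (F i)) ->
  torus_int B (fun k => \sum_(i <- r) F i k) = \sum_(i <- r) torus_int B (F i).
Proof.
move=> Fi.
have sI s := torus_integrable_sum s Fi.
elim: r => [|i r IH].
  by rewrite big_nil; under eq_fun do rewrite big_nil; exact: torus_int0.
by under eq_fun do rewrite big_cons; rewrite torus_intD// IH big_cons.
Qed.

Lemma torus_int_cvg (f_ : nat -> 'rV[R]_3 -> R) f (M : R) :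
  (forall n, measurable_fun setT (fun t : T3 => f_ n (rowt t) : Rm)) ->
  (forall n k, `|f_ n k| <= M) -> (forall k, f_ n k @[n --> \oo] --> f k) ->
  torus_int B (f_ n) @[n --> \oo] --> torus_int B f.
Proof.
move=> mf fM ff; apply: cvgMr.
exact: (bounded_Rintegral_cvg measurable_unit_cube cube_lty
  (fun n => measurable_funTS (@measurable_rowt_mulmx _ _ _ (f_ n) B (mf n)))
  (fun n t _ => fM n (rowt t *m B)) (fun t _ => ff (rowt t *m B))).2.
Qed.

Lemma torus_int_shift f (u : 'rV[R]_3) :
  torus_integrable B f -> lattice_periodic B f ->
  torus_int B (fun k => f (k + u)) = torus_int B f.
Proof.
move=> /measurable_int/measurable_EFinP mf pf; rewrite /torus_int /Rintegral; congr (_ * fine _).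
rewrite -[RHS](@cube_integral_shift_real _ (fun v => f (v *m B)) mf (lattice_periodic_int pf) (u *m invmx B)).
by apply: eq_integral => t _; rewrite mulmxDl mulmxKV.
Qed.

(** The rows of [B] are lattice vectors, so their images are integer combinations of the rows. In
    lattice coordinates a point operation is thus an integer matrix, under which integrals over the
    cube of periodic functions are invariant. *)
Lemma lattice_preserving_int (g : 'M[R]_3) : lattice_preserving B g ->
  exists M : 'M[int]_3, B *m g = map_mx intr M *m B.
Proof.
move=> gB.
have rB i : exists n : 'rV[int]_3, row i B *m g = map_mx intr n *m B.
  apply/(gB (row i B)); exists (delta_mx 0 i); rewrite (_ : map_mx intr _ = delta_mx 0 i) ?rowE//.
  by apply/matrixP => a b; rewrite !mxE; case: (_ && _).
have [n nE] := choice rB.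
exists (\matrix_i n i); apply/row_matrixP => i; rewrite !row_mul nE; congr (_ *m _).
by apply/rowP => j; rewrite !mxE.
Qed.

Lemma torus_int_mulmx f (g : 'M[R]_3) :
  torus_integrable B f -> lattice_periodic B f -> g \in unitmx -> lattice_preserving B g ->
  torus_int B (fun k => f (k *m g)) = torus_int B f.
Proof.
move=> /measurable_int/measurable_EFinP mf pf ug /lattice_preserving_int[M MB].
rewrite /torus_int /Rintegral; congr (_ * fine _).
have uM : map_mx intr M \in @unitmx R 3.
  have /(congr1 (fun A => A *m invmx B)) := MB; rewrite mulmxK// => <-.
  by rewrite !unitmx_mul uB ug unitmx_inv uB.
rewrite -[RHS](@cube_integral_mulmx _ (fun v => f (v *m B)) mf (lattice_periodic_int pf) M uM).
by apply: eq_integral => t _; rewrite -!mulmxA -MB mulmxA.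
Qed.

Lemma bounded_measurable_shift f u : bounded_measurable f -> bounded_measurable (fun k => f (k + u)).
Proof.
move=> [mf [M fM]]; split; last by exists M.
apply: (measurable_row_comp mf) => i; apply: measurable_addmx_coord => j.
  exact: measurable_rowt_coord.
exact: measurable_cst.
Qed.

End TorusInt.

(** * Calculus and integration by parts *)

Section Calculus.
Context {R : realType}.
Implicit Types (f g : 'rV[R]_3 -> R) (k v : 'rV[R]_3).

Lemma is_derive_line {V W : normedModType R} (f : V -> W) (k v : V) (t : R) :
  derivable f (k + t *: v) v ->
  is_derive t (1 : R) (fun s : R => f (k + s *: v)) ('D_v f (k + t *: v)).
Proof.
move=> df.
have E : (fun h : R => h^-1 *: (((fun s : R => f (k + s *: v)) \o shift t) (h *: (1 : R)) - f (k + t *: v)))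
   = (fun h : R => h^-1 *: ((f \o shift (k + t *: v)) (h *: v) - f (k + t *: v))).
  apply/funext => h /=; congr (_ *: (f _ - _)).
  by rewrite -[h%:A]/(h * 1) mulr1 scalerDl addrCA.
apply: DeriveDef.
  by rewrite /derivable E.
by rewrite /derive E.
Qed.

Lemma MVT_line (f : 'rV[R]_3 -> R) k v (h : R) : 0 < h ->
  (forall t, 0 <= t <= h -> derivable f (k + t *: v) v) ->
  exists2 c, 0 < c < h & f (k + h *: v) - f k = 'D_v f (k + c *: v) * h.
Proof.
move=> h0 df.
have [] := @MVT R (fun s => f (k + s *: v)) (fun s => 'D_v f (k + s *: v)) 0 h h0.
- by move=> x; rewrite in_itv/= => /andP[x0 xh]; apply: is_derive_line; apply: df; rewrite !ltW.
- apply: derivable_within_continuous => x; rewrite in_itv/= => xh.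
  by apply: (@ex_derive _ _ _ _ _ _ _ (is_derive_line (df x xh))).
by move=> c; rewrite in_itv/= scale0r addr0 subr0 => ch ->; exists c.
Qed.

Lemma C1_continuous f : C1 f -> continuous f.
Proof. by move=> [df _] k; exact: differentiable_continuous. Qed.

(** The difference quotients at [k + l] and at [k] are the same function, so their limits agree,
    default values included. *)
Lemma pd_periodic (B : 'M[R]_3) i f : lattice_periodic B f -> lattice_periodic B (pd i f).
Proof.
move=> pf k l ll; rewrite /pd /derive.
have -> // : (fun h : R => h^-1 *: ((f \o shift (k + l)) (h *: 'e_i) - f (k + l))) =
  (fun h : R => h^-1 *: ((f \o shift k) (h *: 'e_i) - f k)).
by apply/funext => h /=; rewrite pf// addrA pf.
Qed.

Lemma component_periodic (B : 'M[R]_3) (F : 'rV[R]_3 -> 'rV[R]_3) i :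
  lattice_periodic B F -> lattice_periodic B (component F i).
Proof. by move=> pF k l ll; rewrite /component pF. Qed.

Lemma pdD i f g k : differentiable f k -> differentiable g k ->
  pd i (fun k => f k + g k) k = pd i f k + pd i g k.
Proof. by move=> df dg; rewrite /pd deriveD//; exact: diff_derivable. Qed.

Lemma pdM i f g k : differentiable f k -> differentiable g k ->
  pd i (fun k => f k * g k) k = pd i f k * g k + f k * pd i g k.
Proof.
move=> df dg; rewrite /pd deriveM; [|exact: diff_derivable..].
by rewrite -[f k *: _]/(f k * _) -[g k *: _]/(g k * _) addrC mulrC.
Qed.

Lemma pd_cst i c k : pd i (fun=> c) k = 0.
Proof. exact: derive_cst. Qed.

Lemma pdZ i c f k : differentiable f k -> pd i (fun k => c * f k) k = c * pd i f k.
Proof. by move=> df; rewrite /pd (@deriveZ _ _ _ f c)//; exact: diff_derivable. Qed.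

Lemma deriveE_pd f k v : differentiable f k -> 'D_v f k = \sum_(i < 3) v 0 i * pd i f k.
Proof.
move=> df; rewrite deriveE// {1}[v]row_sum_delta linear_sum; apply: eq_bigr => i _.
by rewrite linearZ /pd deriveE.
Qed.

(* The second difference along u and v is symmetric and, by two applications of the mean
   value theorem, equals h^2 times either mixed derivative at a point near k. *)
Lemma derive_commute f (u v : 'rV[R]_3) k :
  (forall x, derivable f x u) -> (forall x, derivable f x v) ->
  (forall x, derivable ('D_u f) x v) -> (forall x, derivable ('D_v f) x u) ->
  {for k, continuous ('D_v ('D_u f))} -> {for k, continuous ('D_u ('D_v f))} ->
  'D_v ('D_u f) k = 'D_u ('D_v f) k.
Proof.
move=> dfu dfv dfuv dfvu cuv cvu.
have key (a b : 'rV[R]_3) (h : R) : 0 < h ->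
    (forall x, derivable f x a) -> (forall x, derivable ('D_a f) x b) ->
    exists c d, [/\ 0 < c < h, 0 < d < h &
      f (k + h *: a + h *: b) - f (k + h *: a) - f (k + h *: b) + f k =
      'D_b ('D_a f) (k + c *: a + d *: b) * h * h].
  move=> h0 dfa dfab.
  pose F x := f (x + h *: b) - f x.
  have dF x : is_derive x a F ('D_a f (x + h *: b) - 'D_a f x).
    suff d1 : is_derive x a (fun x => f (x + h *: b)) ('D_a f (x + h *: b)).
      exact: (is_deriveB d1 (derivableP (dfa x))).
    have E : (fun s : R => s^-1 *: (((fun x => f (x + h *: b)) \o shift x) (s *: a) - f (x + h *: b)))
      = (fun s : R => s^-1 *: ((f \o shift (x + h *: b)) (s *: a) - f (x + h *: b))).
      by apply/funext => s /=; congr (_ *: (f _ - _)); rewrite addrA.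
    by apply: DeriveDef; [rewrite /derivable E; exact: dfa|rewrite /derive E].
  have [|c ch Fc] := @MVT_line F k a h h0; first by move=> t _; apply: ex_derive.
  have [|d dh Fd] := @MVT_line ('D_a f) (k + c *: a) b h h0; first by move=> t _; exact: dfab.
  exists c, d; split => //; rewrite -Fd.
  have := @derive_val _ _ _ _ _ _ _ (dF (k + c *: a)) => <-.
  by rewrite -Fc /F; ring.
have tri (a b x z : R) : `|a - x| < z -> `|b - x| < z -> `|a - b| < z + z.
  by move=> ax bx; rewrite -(subrKA x); apply: le_lt_trans (ler_normD _ _) _;
    rewrite ltrD// distrC.
apply/eqP/negPn/negP => ne.
(* Half of the supposed gap: two points where the mixed derivatives agree with each other, and each
   is within [e] of its value at [k], give a contradiction. *)
pose e := `|'D_v ('D_u f) k - 'D_u ('D_v f) k| / 2.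
have e0 : 0 < e by rewrite divr_gt0// normr_gt0 subr_eq0.
have /nbhs_ballP[r1 /= r10 H1] : nbhs k [set x | `|'D_v ('D_u f) k - 'D_v ('D_u f) x| < e].
  by move/cvgrPdist_lt: cuv; apply.
have /nbhs_ballP[r2 /= r20 H2] : nbhs k [set x | `|'D_u ('D_v f) k - 'D_u ('D_v f) x| < e].
  by move/cvgrPdist_lt: cvu; apply.
pose r := Num.min r1 r2.
have r0 : 0 < r by rewrite lt_min r10.
pose N := `|u| + `|v| + 1.
have N0 : 0 < N by rewrite ltr_wpDl// addr_ge0.
(* Both intermediate points lie within [h * N], that is [r / 2], of [k]. *)
pose h := r / (2 * N).
have h0 : 0 < h by rewrite divr_gt0// mulr_gt0.
have near_k (a b : 'rV[R]_3) c d : `|a| + `|b| <= N -> 0 < c < h -> 0 < d < h ->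
    ball k r (k + c *: a + d *: b).
  move=> abN /andP[c0 ch] /andP[d0 dh].
  rewrite -ball_normE /ball_/= -addrA opprD addrA subrr sub0r normrN.
  apply: le_lt_trans (ler_normD _ _) _; rewrite !normrZ !gtr0_norm//.
  have le1 : c * `|a| + d * `|b| <= h * N.
    apply: le_trans (ler_wpM2l (ltW h0) abN); rewrite mulrDr.
    by apply: lerD; apply: ler_wpM2r => //; exact: ltW.
  apply: le_lt_trans le1 _; rewrite /h invfM mulrA -mulrA mulVf ?gt_eqF// mulr1.
  by rewrite ltr_pdivrMr// ltr_pMr// ltr1n.
have [c1 [d1 [c1h d1h E1]]] := key u v h h0 dfu dfuv.
have [c2 [d2 [c2h d2h E2]]] := key v u h h0 dfv dfvu.
have E : 'D_v ('D_u f) (k + c1 *: u + d1 *: v) = 'D_u ('D_v f) (k + c2 *: v + d2 *: u).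
  apply: (@mulIf _ h); first by rewrite gt_eqF.
  apply: (@mulIf _ h); first by rewrite gt_eqF.
  apply: (etrans (esym E1)); apply: etrans E2; rewrite [k + _ + _]addrAC.
  by congr (_ + _); rewrite [LHS]addrAC.
have uvN : `|u| + `|v| <= N by rewrite lerDl.
have B1 : ball k r1 (k + c1 *: u + d1 *: v).
  by apply: le_ball (near_k _ _ _ _ uvN c1h d1h); rewrite ge_min lexx.
have B2 : ball k r2 (k + c2 *: v + d2 *: u).
  apply: le_ball (near_k _ _ _ _ _ c2h d2h); first by rewrite ge_min lexx orbT.
  by rewrite addrC.
have := H1 _ B1; have := H2 _ B2; rewrite /= E => h2 h1.
have : `|'D_v ('D_u f) k - 'D_u ('D_v f) k| < e + e.
  exact: tri h1 h2.
by rewrite /e -splitr ltxx.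
Qed.

Lemma pd_commute f i j k : C1 f -> C1 (pd i f) -> C1 (pd j f) ->
  pd j (pd i f) k = pd i (pd j f) k.
Proof.
move=> [df _] [di ci] [dj cj].
exact: (derive_commute (fun x => diff_derivable (df x)) (fun x => diff_derivable (df x))
  (fun x => diff_derivable (di x)) (fun x => diff_derivable (dj x)) (ci j k) (cj i k)).
Qed.

Lemma eps_antisym (l i j : 'I_3) : eps l j i = - eps l i j :> R.
Proof. rewrite /eps; ring. Qed.

(** Exchanging the two summation indices turns the sum into its opposite. *)
Lemma sum_eps_sym (l : 'I_3) (M : 'I_3 -> 'I_3 -> R) :
  (forall i j, M i j = M j i) -> \sum_(i < 3) \sum_(j < 3) eps l i j * M i j = 0.
Proof.
move=> Ms; set S := LHS.
have : S = - S.
  rewrite {1}/S exchange_big /= -sumrN; apply: eq_bigr => i _; rewrite -sumrN.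
  by apply: eq_bigr => j _; rewrite eps_antisym Ms mulNr.
lra.
Qed.

Lemma pd_sum (I : Type) (r : seq I) (F : I -> 'rV[R]_3 -> R) i k :
  (forall a, differentiable (F a) k) ->
  differentiable (fun k => \sum_(a <- r) F a k) k /\
  pd i (fun k => \sum_(a <- r) F a k) k = \sum_(a <- r) pd i (F a) k.
Proof.
move=> dF; elim: r => [|a r [dr pr]].
  under eq_fun do rewrite big_nil; rewrite big_nil pd_cst; split=> //; exact: differentiable_cst.
under eq_fun do rewrite big_cons; rewrite big_cons pdD// pr; split => //; exact: differentiableD.
Qed.

Lemma curl_gradient phi k : C1 phi -> C1_field (gradient phi) -> curl (gradient phi) k = 0.
Proof.
move=> cphi cg.
have gE j : component (gradient phi) j = pd j phi.
  by apply/funext => x; rewrite /component mxE.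
have cp j : C1 (pd j phi) by rewrite -gE; exact: cg.
apply/rowP => l; rewrite !mxE; under eq_bigr do under eq_bigr do rewrite gE.
by apply: (sum_eps_sym l (M := fun i j => pd i (pd j phi) k)) => i j; exact: pd_commute.
Qed.

Lemma curlD (F G : 'rV[R]_3 -> 'rV[R]_3) k :
  (forall i, differentiable (component F i) k) -> (forall i, differentiable (component G i) k) ->
  curl (fun x => F x + G x) k = curl F k + curl G k.
Proof.
move=> dF dG; apply/rowP => l; rewrite !mxE -big_split; apply: eq_bigr => i _.
rewrite -big_split; apply: eq_bigr => j _ /=.
have -> : component (fun x => F x + G x) j = (fun x => component F j x + component G j x).
  by apply/funext => x; rewrite /component mxE.
by rewrite pdD// mulrDr.
Qed.

Lemma curl_cst c k : curl (fun=> c) k = 0.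
Proof.
apply/rowP => l; rewrite !mxE big1// => i _; rewrite big1// => j _.
by rewrite /component pd_cst mulr0.
Qed.

Lemma smooth_pd f i : smooth f -> smooth (pd i f).
Proof. by move=> sf s k; have := sf (rcons s i) k; rewrite /pds -cats1 foldr_cat. Qed.

Lemma smooth_C1 f : smooth f -> C1 f.
Proof.
move=> sf; split=> [k|i k]; first exact: (sf [::]).
by apply: differentiable_continuous; exact: (sf [:: i]).
Qed.

Section PeriodicIBP.
Variable B : 'M[R]_3.
Hypothesis uB : B \in unitmx.

(* The integral of the difference quotients vanishes by translation invariance. *)
Lemma torus_int_pd f i : C1 f -> lattice_periodic B f -> torus_int B (pd i f) = 0.
Proof.
move=> [df cf] pf.
have fcont : continuous f by move=> k; exact: differentiable_continuous.
have bf := bounded_measurable_continuous uB fcont pf.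
have [M fM] := periodic_bounded uB (cf i) (pd_periodic i pf).
pose h n : R := n.+1%:R^-1.
have h0 n : 0 < h n by rewrite invr_gt0.
pose q n k := (h n)^-1 * f (k + h n *: 'e_i) + (- (h n)^-1) * f k.
have bs n := bounded_measurable_shift (h n *: 'e_i) bf.
have q0 n : torus_int B (q n) = 0.
  rewrite torus_intD; try by apply: torus_integrableZ; exact: bounded_measurable_integrable.
  rewrite !torus_intZ; try exact: bounded_measurable_integrable.
  by rewrite torus_int_shift// ?mulNr ?subrr//; exact: bounded_measurable_integrable.
have : torus_int B (q n) @[n --> \oo] --> torus_int B (pd i f).
  apply: (@torus_int_cvg _ B _ _ M).
  - by move=> n; apply: measurable_funD; apply: measurable_funM => //;
      [exact: (bs n).1|exact: bf.1].
  - move=> n k; rewrite /q mulNr -mulrBr normrM.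
    (* The mean value theorem bounds all difference quotients by the supremum of the derivative,
       uniformly in [n], which is the domination needed to pass to the limit. *)
    have [|c _ ->] := @MVT_line f k 'e_i (h n) (h0 n); first by move=> t _; exact: diff_derivable.
    rewrite normrM normfV mulrCA mulVf ?mulr1; first exact: fM.
    by rewrite normr_eq0 gt_eqF.
  - move=> k; have /cvg_ex[/= l fl] : derivable f k 'e_i by exact: diff_derivable.
    rewrite /pd /derive (cvg_lim (@norm_hausdorff _ _) fl).
    have hn0 : h n @[n --> \oo] --> 0^'.
      move=> A /nbhs_ballP[e /= e0 eA].
      have [m _ hm] := near_infty_natSinv_lt (PosNum e0); exists m => // n mn.
      apply: eA; last by rewrite gt_eqF.
      by rewrite /ball/= sub0r normrN gtr0_norm//; exact: hm.
    have := cvg_comp _ _ hn0 fl; apply: cvg_trans; apply: near_eq_cvg; near=> n.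
    rewrite /q /= mulNr -mulrBr; congr (_ * (f _ - _)); rewrite addrC //.
have -> : (fun n => torus_int B (q n)) = (fun=> 0) by apply/funext.
by move=> /(cvg_lim (@Rhausdorff R)) <-; rewrite lim_cst.
Unshelve. all: by end_near. Qed.

End PeriodicIBP.

End Calculus.

(** * The exact sector and the dipole *)

Section ExactSector.
Context {R : realType}.
Variable B : 'M[R]_3.
Hypothesis uB : B \in unitmx.
Implicit Types (Om Oh Oe Oc : 'rV[R]_3 -> 'rV[R]_3) (g : 'rV[R]_3 -> R).

Lemma curl_functional0 F g : (forall k, curl F k = 0) -> curl_functional B g F = 0.
Proof.
move=> F0; apply/rowP => l; rewrite !mxE.
by under eq_fun do rewrite F0 mxE mulr0; exact: torus_int0.
Qed.

Lemma exact_sector_regular Om Oh Oe Oc : helmholtz B Om Oh Oe Oc ->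
  [/\ forall k, curl Oh k = 0, forall k, curl Oc k = 0 &
      forall g, [/\ curl_functional B g Om = curl_functional B g Oe,
                    curl_functional B g Oh = 0 & curl_functional B g Oc = 0]].
Proof.
move=> [OmE OhE [ceOe _ _ _] [ccOc _ [phi [cphi _ OcE]]]].
have Oh0 k : curl Oh k = 0 by rewrite (funext OhE) curl_cst.
have Oc0 k : curl Oc k = 0.
  by move: ccOc; rewrite (funext OcE) => cg; exact: curl_gradient.
have dOh i x : differentiable (component Oh i) x by rewrite (funext OhE); exact: differentiable_cst.
have dOe i x : differentiable (component Oe i) x by have [] := ceOe i.
have dOc i x : differentiable (component Oc i) x by have [] := ccOc i.
have dOhe i x : differentiable (component (fun k => Oh k + Oe k) i) x.
  rewrite (_ : component _ i = component Oh i \+ component Oe i); first exact: differentiableD.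
  by apply/funext => y; rewrite /component mxE.
have E : curl Om = curl Oe.
  apply/funext => k; rewrite (funext OmE) (curlD (fun i => dOhe i k) (fun i => dOc i k)).
  by rewrite (curlD (fun i => dOh i k) (fun i => dOe i k)) Oh0 Oc0 add0r addr0.
split; [exact: Oh0|exact: Oc0|move=> g].
split; [|exact: (curl_functional0 g Oh0)|exact: (curl_functional0 g Oc0)].
by rewrite /curl_functional E.
Qed.

Lemma test_fun_pd i g : test_fun B g -> test_fun B (pd i g).
Proof. by move=> [sg pg]; split; [exact: smooth_pd|exact: pd_periodic]. Qed.

(** The harmonic part is integration against a constant, and a derivative of a test function has
    integral 0. For the co-exact part, [phi] is applied to second derivatives of [g], symmetric in
    the two indices that [eps] antisymmetrizes. *)
Lemma exact_sector_distr Om (Th Te Tc : 'I_3 -> functional) (g : 'rV[R]_3 -> R) (l : 'I_3) :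
  distr_helmholtz B Om Th Te Tc -> test_fun B g ->
  [/\ distr_curl (distr_field B Om) l g = distr_curl Te l g,
      distr_curl Th l g = 0 & distr_curl Tc l g = 0].
Proof.
move=> [_ OmE ThE _ [phi [_ TcE]]] tg.
have tpd i : test_fun B (pd i g) by exact: test_fun_pd.
have Th0 : distr_curl Th l g = 0.
  rewrite /distr_curl big1// => i _; rewrite big1// => j _.
  rewrite /distr_pd ThE// /distr_field /distr_of /component torus_intZ.
    by rewrite torus_int_pd ?mulr0 ?oppr0 ?mulr0//; [exact: smooth_C1 tg.1|exact: tg.2].
  apply: bounded_measurable_integrable; apply: (@bounded_measurable_continuous _ B) => //.
    exact: (smooth_C1 tg.1).2.
  exact: (tpd i).2.
have Tc0 : distr_curl Tc l g = 0.
  rewrite /distr_curl -[RHS](@sum_eps_sym _ l (fun i j => phi (pd j (pd i g)))).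
    apply: eq_bigr => i _; apply: eq_bigr => j _; rewrite /distr_pd TcE//.
    by rewrite /distr_pd opprK.
  move=> i j; have -> // : pd j (pd i g) = pd i (pd j g).
  apply/funext => k; exact: (pd_commute k (smooth_C1 tg.1) (smooth_C1 (tpd i).1) (smooth_C1 (tpd j).1)).
split => //; transitivity (distr_curl Th l g + distr_curl Te l g + distr_curl Tc l g).
  rewrite /distr_curl -!big_split; apply: eq_bigr => i _ /=.
  rewrite -!big_split; apply: eq_bigr => j _ /=.
  by rewrite /distr_pd OmE// -!mulrDr !opprD.
by rewrite Th0 Tc0 add0r addr0.
Qed.

End ExactSector.

(** * Chain rule and stability of C^1 functions *)

Section Chain.
Context {R : realType}.

Lemma differentiable_comp_real {V : normedModType R} (u : V -> R) (h : R -> R) k :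
  differentiable u k -> derivable h (u k) 1 -> differentiable (fun x => h (u x)) k.
Proof. by move=> du /derivable1_diffP dh; exact: (differentiable_comp du dh). Qed.

Lemma derive_comp_real {V : normedModType R} (u : V -> R) (h : R -> R) k v :
  differentiable u k -> derivable h (u k) 1 ->
  'D_v (fun x => h (u x)) k = 'D_1 h (u k) * 'D_v u k.
Proof.
move=> du dh; have dh' : differentiable h (u k) by exact/derivable1_diffP.
rewrite deriveE; last exact: differentiable_comp_real.
have /(congr1 (@^~ v)) /= := diff_comp du dh'; rewrite deriv1E// => ->.
by rewrite derive1E (deriveE v du) -[_ *: _]/(_ * _) mulrC.
Qed.

Lemma C1_comp (u : 'rV[R]_3 -> R) (h : R -> R) : C1 u ->
  (forall x, derivable h x 1) -> continuous (fun x => 'D_1 h x) -> C1 (fun x => h (u x)).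
Proof.
move=> [du cu] dh ch; split=> [k|i k]; first exact: differentiable_comp_real.
have -> : pd i (fun x => h (u x)) = (fun x => 'D_1 h (u x) * pd i u x).
  by apply/funext => x; rewrite /pd (derive_comp_real _ (du x) (dh _)).
apply: (@continuousM _ _ (fun x => 'D_1 h (u x)) (pd i u)); last exact: cu.
apply: (@continuous_comp _ _ _ u (fun x => 'D_1 h x)); last exact: ch.
exact: differentiable_continuous.
Qed.

Lemma C1_cst (c : R) : C1 (fun _ : 'rV[R]_3 => c).
Proof.
split=> [k|i k]; first exact: differentiable_cst.
have -> : pd i (fun=> c) = (fun=> 0) by apply/funext => x; exact: pd_cst.
exact: cst_continuous.
Qed.

Lemma C1D (f g : 'rV[R]_3 -> R) : C1 f -> C1 g -> C1 (fun k => f k + g k).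
Proof.
move=> [df cf] [dg cg]; split=> [k|i k]; first exact: differentiableD.
have -> : pd i (fun k => f k + g k) = (fun k => pd i f k + pd i g k).
  by apply/funext => x; exact: pdD.
by apply: continuousD; [exact: cf|exact: cg].
Qed.

Lemma C1M (f g : 'rV[R]_3 -> R) : C1 f -> C1 g -> C1 (fun k => f k * g k).
Proof.
move=> [df cf] [dg cg]; split=> [k|i k]; first exact: differentiableM.
have -> : pd i (fun k => f k * g k) = (fun k => pd i f k * g k + f k * pd i g k).
  by apply/funext => x; exact: pdM.
apply: (@continuousD _ _ _ (fun k => pd i f k * g k) (fun k => f k * pd i g k)).
  by apply: continuousM; [exact: cf|exact: differentiable_continuous].
by apply: continuousM; [exact: differentiable_continuous|exact: cg].
Qed.

Lemma C1_sum (I : Type) (r : seq I) (F : I -> 'rV[R]_3 -> R) :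
  (forall a, C1 (F a)) -> C1 (fun k => \sum_(a <- r) F a k).
Proof.
move=> cF; elim: r => [|a r IH].
  by under eq_fun do rewrite big_nil; exact: C1_cst.
by under eq_fun do rewrite big_cons; exact: C1D.
Qed.

Lemma C1_coord i : C1 (fun k : 'rV[R]_3 => k 0 i).
Proof.
split=> [k|j k]; first exact: differentiable_coord.
have -> : pd j (fun k : 'rV[R]_3 => k 0 i) = (fun=> ('e_j : 'rV[R]_3) 0 i).
  apply/funext => x; rewrite /pd /derive.
  apply/cvg_lim => //; apply: (@cvg_near_cst _ _ _ _ _); near=> h.
  rewrite -[LHS]/(h^-1 * ((h *: ('e_j : 'rV[R]_3) + x) 0 i - x 0 i)).
  rewrite [X in X - _]mxE addrK [X in _ * X]mxE mulrA mulVf ?mul1r//.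
  by near: h; exact: nbhs_dnbhs_neq.
exact: cst_continuous.
Unshelve. all: by end_near. Qed.

Lemma C1_dot (v : 'rV[R]_3) : C1 (dot v).
Proof.
apply: C1_sum => i; apply: C1M; [exact: C1_cst|exact: C1_coord].
Qed.

Lemma C1_cos (u : 'rV[R]_3 -> R) : C1 u -> C1 (fun k => cos (u k)).
Proof.
move=> cu; apply: C1_comp => //.
have -> : (fun x : R => 'D_1 (@cos R) x) = (fun x => - sin x).
  by apply/funext => x; exact: derive_val.
by move=> x; apply: continuousN; exact: continuous_sin.
Qed.

Lemma C1_sin (u : 'rV[R]_3 -> R) : C1 u -> C1 (fun k => sin (u k)).
Proof.
move=> cu; apply: C1_comp => //.
have -> : (fun x : R => 'D_1 (@sin R) x) = (fun x => cos x).
  by apply/funext => x; exact: derive_val.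
exact: continuous_cos.
Qed.

End Chain.

(** * Fourier sums and regularity of the resolved curvature *)

Section Fourier.
Context {R : realType}.
Variable B : 'M[R]_3.
Hypothesis uB : B \in unitmx.

Lemma dotE (u v : 'rV[R]_3) : dot u v = (u *m v^T) 0 0.
Proof. by rewrite mxE; apply: eq_bigr => i _; rewrite mxE. Qed.

Lemma dotDr (u v w : 'rV[R]_3) : dot u (v + w) = dot u v + dot u w.
Proof. by rewrite !dotE linearD mulmxDr mxE. Qed.

Lemma dot_mulmx (u v : 'rV[R]_3) (g : 'M[R]_3) : dot u (v *m g) = dot (u *m g^T) v.
Proof. by rewrite !dotE trmx_mul mulmxA. Qed.

(** The inverse transpose of [B] in [wavevector] cancels the [B] of the lattice vector, leaving 2 pi
    times the product of two integer vectors. *)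
Lemma dot_wavevector_lattice (n : 'rV[int]_3) l : lattice B l ->
  exists z : int, dot (wavevector B n) l = pi *+ 2 * z%:~R.
Proof.
move=> [m ->]; exists ((n *m m^T) 0 0).
rewrite dot_mulmx /wavevector -scalemxAl -mulmxA -trmx_mul mulmxV// trmx1 mulmx1.
rewrite dotE -scalemxAl mxE map_trmx -map_mxM mxE; congr (_ * _).
by rewrite mulr_natl.
Qed.

Lemma cos_sinD2pi_int (x : R) (z : int) :
  cos (x + pi *+ 2 * z%:~R) = cos x /\ sin (x + pi *+ 2 * z%:~R) = sin x.
Proof.
have nat y n : cos (y + pi *+ 2 * n%:R) = cos y :> R /\ sin (y + pi *+ 2 * n%:R) = sin y :> R.
  by rewrite mulr_natr (periodicn (@cosD2pi R)) (periodicn (@sinD2pi R)).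
case: z => n; first exact: nat.
by rewrite NegzE mulrNz; have [<- <-] := nat (x + pi *+ 2 * - n.+1%:~R) n.+1; rewrite mulrN subrK.
Qed.

Lemma cos_wavevector_periodic n : lattice_periodic B (fun k => cos (dot (wavevector B n) k)).
Proof.
move=> k l /(dot_wavevector_lattice n)[z lz].
by rewrite dotDr lz (cos_sinD2pi_int _ z).1.
Qed.

Lemma sin_wavevector_periodic n : lattice_periodic B (fun k => sin (dot (wavevector B n) k)).
Proof.
move=> k l /(dot_wavevector_lattice n)[z lz].
by rewrite dotDr lz (cos_sinD2pi_int _ z).2.
Qed.

Lemma C1_fourier_sum Q Om : C1_field (fourier_sum B Q Om).
Proof.
move=> i; rewrite (_ : component _ i = fun k => \sum_(n <- Q) ((cell_volume B)^-1 *
    (cos (dot (wavevector B n) k) * cos_coef B Om n 0 i +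
     sin (dot (wavevector B n) k) * sin_coef B Om n 0 i))).
  apply: C1_sum => n; apply: C1M; first exact: C1_cst.
  by apply: C1D; (apply: C1M; last exact: C1_cst); [apply: C1_cos|apply: C1_sin]; exact: C1_dot.
apply/funext => k; rewrite /component /fourier_sum summxE; apply: eq_bigr => n _.
by rewrite !mxE.
Qed.

Lemma fourier_sum_periodic Q Om : lattice_periodic B (fourier_sum B Q Om).
Proof.
move=> k l ll; apply: eq_bigr => n _.
by rewrite (cos_wavevector_periodic n k ll) (sin_wavevector_periodic n k ll).
Qed.

(** A finite Fourier sum is a trigonometric polynomial, however singular the curvature. From here on
    both resolutions are treated alike, as a periodic C^1 field. *)
Lemma resolve_regular r Om : curvature B r Om ->
  C1_field (resolve B r Om) /\ lattice_periodic B (resolve B r Om).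
Proof.
case: r => [|Q] [pOm]; first by [].
by move=> _; split; [exact: C1_fourier_sum|exact: fourier_sum_periodic].
Qed.

Lemma bounded_measurable_f0 E mu : continuous E -> bounded_measurable (f0 (R:=R) E mu).
Proof.
move=> cE; split; last by exists 1 => k; rewrite /f0; rewrite normr_nat lern1 leq_b1.
have -> : (fun t : measurableTypeR R * measurableTypeR R * measurableTypeR R => f0 E mu (rowt t)) =
    (fun t => if E (rowt t) <= mu then 1 else 0).
  by apply/funext => t; rewrite /f0; case: ifP.
apply: measurable_fun_ifT; [|exact: measurable_cst..].
by apply: measurable_fun_ler; [exact: measurable_rowt_continuous|exact: measurable_cst].
Qed.

Lemma P_obs_dipole W E mu l : C1_field W -> lattice_periodic B W -> continuous E ->
  P_obs B E mu W 0 l = \sum_(i < 3) \sum_(j < 3) eps l i j * dipole B E mu W i j.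
Proof.
move=> cW pW cE; rewrite !mxE.
have fi i j : torus_integrable B (fun k => f0 E mu k * pd i (component W j) k).
  apply: bounded_measurable_integrable; apply: bounded_measurableM; first exact: bounded_measurable_f0.
  apply: (bounded_measurable_continuous uB); first by have [_] := cW j; apply.
  by apply: pd_periodic; exact: component_periodic.
have -> : (fun k => f0 E mu k * curl W k 0 l) = (fun k => \sum_(i < 3) \sum_(j < 3)
    eps l i j * (f0 E mu k * pd i (component W j) k)).
  apply/funext => k; rewrite mxE mulr_sumr; apply: eq_bigr => i _.
  by rewrite mulr_sumr; apply: eq_bigr => j _; rewrite mulrCA.
have fij i j : torus_integrable B (fun k => eps l i j * (f0 E mu k * pd i (component W j) k)).
  exact: torus_integrableZ.
rewrite torus_int_sum; last first.
  move=> i; rewrite (_ : (fun k => _) = fun k => \sum_(j <- index_enum 'I_3)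
     eps l i j * (f0 E mu k * pd i (component W j) k))//.
  exact: torus_integrable_sum.
apply: eq_bigr => i _; rewrite torus_int_sum//; apply: eq_bigr => j _.
by rewrite torus_intZ// mxE.
Qed.

End Fourier.

(** * Point operations *)

Section Orthogonal.
Context {R : realType}.
Implicit Types g : 'M[R]_3.

Lemma det3 g : \det g = g 0 0 * (g 1 1 * g 2 2 - g 1 2 * g 2 1)
  - g 0 1 * (g 1 0 * g 2 2 - g 1 2 * g 2 0) + g 0 2 * (g 1 0 * g 2 1 - g 1 1 * g 2 0).
Proof.
(* Entries are read through natural numbers so that the ordinals produced by the cofactor expansion
   can be identified by computation. *)
pose F (a b : nat) : R := g (inord a) (inord b).
have gF i j : g i j = F i j by rewrite /F !inord_val.
rewrite (expand_det_row _ ord0) !big_ord_recl big_ord0 /cofactor.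
rewrite !(expand_det_row _ ord0) !big_ord_recl !big_ord0 /cofactor !det_mx11 !mxE !gF /=.
rewrite /bump /=; ring.
Qed.

Lemma O3_unit g : O3 g -> g \in unitmx.
Proof. by move=> gg; have [] := mulmx1_unit gg. Qed.

Lemma O3_inv g : O3 g -> invmx g = g^T.
Proof. by move=> gg; rewrite -[RHS]mul1mx -(mulVmx (O3_unit gg)) -mulmxA gg mulmx1. Qed.

Lemma O3_trmul g : O3 g -> g^T *m g = 1%:M.
Proof. by move=> gg; exact: mulmx1C. Qed.

Lemma O3_det2 g : O3 g -> \det g * \det g = 1.
Proof. by move=> gg; rewrite -[X in _ * X]det_tr -det_mulmx gg det1. Qed.

Lemma triple_product_rows g (c a b : 'I_3) :
  \sum_(l < 3) g c l * (\sum_(i < 3) \sum_(j < 3) eps l i j * (g a i * g b j)) = \det g * eps c a b.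
Proof.
rewrite det3 !sum3E /eps.
by move: c a b; apply: ord3P; apply: ord3P; apply: ord3P => /=; field.
Qed.

(** The rows of an orthogonal matrix form an orthonormal basis. In it the cross product of rows [a]
    and [b] has as coordinates the triple products of rows [c], [a], [b], which are
    [\det g * eps c a b]. *)
Lemma cross_rows_O3 g (l a b : 'I_3) : O3 g ->
  \sum_(i < 3) \sum_(j < 3) eps l i j * (g a i * g b j) =
  \det g * \sum_(c < 3) eps c a b * g c l.
Proof.
move=> Og; set X := fun l => \sum_(i < 3) \sum_(j < 3) eps l i j * (g a i * g b j).
have -> : \sum_(i < 3) \sum_(j < 3) eps l i j * (g a i * g b j) = \sum_(l' < 3) (g^T *m g) l l' * X l'.
  rewrite O3_trmul// [RHS](bigD1 l)//= [X in _ = _ + X]big1 ?addr0.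
    by rewrite mxE eqxx mul1r.
  by move=> i il; rewrite mxE eq_sym (negbTE il) mul0r.
transitivity (\sum_(c < 3) g c l * (\sum_(l' < 3) g c l' * X l')).
  under eq_bigr do rewrite mxE mulr_suml.
  rewrite exchange_big; apply: eq_bigr => c _; rewrite mulr_sumr; apply: eq_bigr => l' _.
  by rewrite mxE mulrA.
rewrite mulr_sumr; apply: eq_bigr => c _; rewrite triple_product_rows; ring.
Qed.

Lemma derive_mulmx (f : 'rV[R]_3 -> R) (C : 'M[R]_3) k v :
  'D_v (fun x => f (x *m C)) k = 'D_(v *m C) f (k *m C).
Proof.
rewrite /derive; congr (lim (_ @ _)) || idtac.
have -> // : (fun h : R => h^-1 *: (((fun x => f (x *m C)) \o shift k) (h *: v) - f (k *m C))) =
  (fun h : R => h^-1 *: ((f \o shift (k *m C)) (h *: (v *m C)) - f (k *m C))).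
by apply/funext => h /=; rewrite mulmxDl -scalemxAl.
Qed.

Lemma differentiable_mulmx (f : 'rV[R]_3 -> R) (C : 'M[R]_3) k :
  differentiable f (k *m C) -> differentiable (fun x => f (x *m C)) k.
Proof.
move=> df; apply: (@differentiable_comp _ _ _ _ (fun x : 'rV[R]_3 => x *m C) f) => //.
by apply: (@linear_differentiable _ _ _ (mulmxr C)) || idtac; exact: continuous_mulmx.
Qed.

Let exchange_pairs (e M G H : 'I_3 -> 'I_3 -> R) (d : R) :
  \sum_(i < 3) \sum_(j < 3) e i j * (\sum_(a < 3) \sum_(b < 3) d * (G a i * H b j) * M a b) =
  \sum_(a < 3) \sum_(b < 3) d * M a b * (\sum_(i < 3) \sum_(j < 3) e i j * (G a i * H b j)).
Proof.
rewrite [LHS]pair_bigA [RHS]pair_bigA /=.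
under eq_bigr do rewrite pair_bigA mulr_sumr.
rewrite exchange_big; apply: eq_bigr => q _ /=; rewrite pair_bigA mulr_sumr.
by apply: eq_bigr => p _ /=; ring.
Qed.

Let exchange_row (e : 'I_3 -> 'I_3 -> 'I_3 -> R) (M : 'I_3 -> 'I_3 -> R) (v : 'I_3 -> R) :
  \sum_(a < 3) \sum_(b < 3) M a b * (\sum_(c < 3) e c a b * v c) =
  \sum_(c < 3) (\sum_(a < 3) \sum_(b < 3) e c a b * M a b) * v c.
Proof.
rewrite [LHS]pair_bigA; under eq_bigr do rewrite mulr_sumr.
rewrite exchange_big; apply: eq_bigr => c _ /=; rewrite pair_bigA mulr_suml.
by apply: eq_bigr => p _ /=; ring.
Qed.

(** The derivative and the field contribute one factor [g] each; antisymmetrized by [eps], the pair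
    becomes [\det g] times a single [g]. This determinant and the one in the action on pseudovectors
    multiply to 1. *)
Lemma curl_act_pseudovector g (W : 'rV[R]_3 -> 'rV[R]_3) k : O3 g -> C1_field W ->
  curl (act_pseudovector g W) k = curl W (k *m invmx g) *m g.
Proof.
move=> Og cW; rewrite O3_inv//.
have dW b x : differentiable (component W b) x by have [] := cW b.
have cE j : component (act_pseudovector g W) j =
    (fun x => \sum_(b < 3) (\det g * g b j) * component W b (x *m g^T)).
  apply/funext => x; rewrite /component /act_pseudovector O3_inv// mxE mxE mulr_sumr.
  by apply: eq_bigr => b _; ring.
have pE i j : pd i (component (act_pseudovector g W) j) k =
    \sum_(a < 3) \sum_(b < 3) \det g * (g a i * g b j) * pd a (component W b) (k *m g^T).
  have dWg b : differentiable (fun x => component W b (x *m g^T)) k.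
    by apply: differentiable_mulmx; exact: dW.
  rewrite cE (pd_sum _ _ _).2; last first.
    by move=> b; apply: differentiableM => //; exact: differentiable_cst.
  rewrite exchange_big; apply: eq_bigr => b _ /=; rewrite pdZ// /pd derive_mulmx.
  rewrite deriveE_pd// mulr_sumr; apply: eq_bigr => a _.
  have -> : (('e_i : 'rV[R]_3) *m g^T) 0 a = g a i by rewrite -rowE !mxE.
  by rewrite /pd; ring.
apply/rowP => l; rewrite !mxE.
under eq_bigr do under eq_bigr do rewrite pE.
rewrite (exchange_pairs (eps l) (fun a b => pd a (component W b) (k *m g^T)) g g).
under eq_bigr do under eq_bigr do rewrite cross_rows_O3// mulrACA O3_det2// mul1r.
rewrite exchange_row; apply: eq_bigr => c _; by rewrite mxE.
Qed.

End Orthogonal.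

Section ContinuousCurl.
Context {R : realType}.

Lemma continuous_sum (T : topologicalType) (I : Type) (r : seq I) (F : I -> T -> R) :
  (forall i, continuous (F i)) -> continuous (fun k => \sum_(i <- r) F i k).
Proof.
move=> cF; elim: r => [|i r IH].
  by under eq_fun do rewrite big_nil; exact: cst_continuous.
under eq_fun do rewrite big_cons.
by move=> x; apply: (@continuousD _ _ _ (F i)); [exact: cF|exact: IH].
Qed.

Lemma continuous_curl (W : 'rV[R]_3 -> 'rV[R]_3) c : C1_field W -> continuous (fun k => curl W k 0 c).
Proof.
move=> cW; under eq_fun do rewrite mxE.
apply: continuous_sum => i; apply: continuous_sum => j k.
apply: (@continuousM _ _ (fun=> eps c i j)); first exact: cst_continuous.
by have [_] := cW j; apply.
Qed.

Lemma curl_periodic (B : 'M[R]_3) (W : 'rV[R]_3 -> 'rV[R]_3) :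
  lattice_periodic B W -> lattice_periodic B (curl W).
Proof.
move=> pW k l ll; apply/rowP => i; rewrite !mxE; apply: eq_bigr => a _; apply: eq_bigr => b _.
by rewrite (pd_periodic a (component_periodic b pW) k ll).
Qed.

End ContinuousCurl.

(** * Transformation law of the observable *)

Section Transformation.
Context {R : realType}.
Variable B : 'M[R]_3.
Hypothesis uB : B \in unitmx.

Lemma lattice_preserving_inv g : g \in unitmx -> lattice_preserving B g -> lattice_preserving B (invmx g).
Proof.
move=> ug gB k; split => [h|h].
  by rewrite -(mulmxKV ug k); apply/gB.
by apply/(gB (k *m invmx g)); rewrite mulmxKV.
Qed.

Lemma P_obs_act (W : 'rV[R]_3 -> 'rV[R]_3) (E : 'rV[R]_3 -> R) mu g :
  C1_field W -> lattice_periodic B W -> band B E -> O3 g -> lattice_preserving B g ->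
  P_obs B (act_scalar g E) mu (act_pseudovector g W) = P_obs B E mu W *m g.
Proof.
move=> cW pW [cE pE] Og gB; have ug := O3_unit Og.
have bf := bounded_measurable_f0 mu cE.
have pf : lattice_periodic B (f0 E mu) by move=> k l ll; rewrite /f0 pE.
have pcurl := curl_periodic pW.
have ccurl c : continuous (fun k => curl W k 0 c).
  by exact: continuous_curl.
have bc c : bounded_measurable (fun k => curl W k 0 c).
  by apply: (bounded_measurable_continuous uB) => // k l ll; rewrite pcurl.
have bfc c : bounded_measurable (fun k => f0 E mu k * curl W k 0 c) by exact: bounded_measurableM.
apply/rowP => l; rewrite mxE mxE.
pose H k := \sum_(c < 3) g c l * (f0 E mu k * curl W k 0 c).
transitivity (torus_int B (fun k => H (k *m invmx g))).
  congr torus_int; apply/funext => k; rewrite curl_act_pseudovector// mxE mulr_sumr.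
  by apply: eq_bigr => c _; rewrite mulrA mulrC.
have bH : bounded_measurable H.
  by apply: bounded_measurable_sum => c; apply: bounded_measurableM => //; exact: bounded_measurable_cst.
rewrite torus_int_mulmx//.
- rewrite torus_int_sum; last by move=> c; apply: torus_integrableZ; exact: bounded_measurable_integrable.
  apply: eq_bigr => c _; rewrite torus_intZ; last exact: bounded_measurable_integrable.
  by rewrite mxE mulrC.
- exact: bounded_measurable_integrable.
- by move=> k l' ll; apply: eq_bigr => c _; rewrite pf// pcurl.
- by rewrite unitmx_inv.
- exact: lattice_preserving_inv.
Qed.

Lemma wavevector_inj : injective (wavevector B : 'rV[int]_3 -> 'rV[R]_3).
Proof.
move=> n m; rewrite /wavevector => /(@scalerI _ _ (2 * pi)).
move=> /(_ (mulf_neq0 _ _)) nm.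
have {}nm : map_mx intr n *m (invmx B)^T = map_mx intr m *m (invmx B)^T :> 'rV[R]_3.
  by apply: nm; rewrite ?pnatr_eq0// gt_eqF// pi_gt0.
have uBT : (invmx B)^T \in unitmx by rewrite unitmx_tr unitmx_inv.
have := congr1 (fun A => A *m invmx (invmx B)^T) nm; rewrite /= !mulmxK//.
by move=> /rowP h; apply/rowP => i; have := h i; rewrite !mxE => /intr_inj.
Qed.

Section FourierAct.
Variables (Q : seq 'rV[int]_3) (Om : 'rV[R]_3 -> 'rV[R]_3) (g : 'M[R]_3).
Hypotheses (uQ : uniq Q) (iOm : forall i, torus_integrable B (component Om i))
  (pOm : lattice_periodic B Om) (Og : O3 g) (gB : lattice_preserving B g)
  (gQ : resolution_invariant B (Modes Q) g).

(** The Fourier coefficient at the rotated mode is the rotated coefficient: substitute [k *m g] for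
    [k] and move [g] across the scalar product. It is stated for a general bounded periodic wave [h]
    so as to serve for cosine and sine. *)
Let coef_act (h : R -> R) (n m : 'rV[int]_3) :
  (forall x, `|h x| <= 1) -> continuous h ->
  (forall n, lattice_periodic B (fun k => h (dot (wavevector B n) k))) ->
  wavevector B m = wavevector B n *m g ->
  (\row_i torus_int B (fun k => act_pseudovector g Om k 0 i * h (dot (wavevector B m) k))) =
  \det g *: ((\row_i torus_int B (fun k => Om k 0 i * h (dot (wavevector B n) k))) *m g).
Proof.
move=> h1 ch ph mn; have ug := O3_unit Og.
have bh : bounded_measurable (fun k => h (dot (wavevector B n) k)).
  apply: (bounded_measurable_continuous uB) => // k.
  apply: (@continuous_comp _ _ _ (dot (wavevector B n)) h); last exact: ch.
  exact: (C1_continuous (C1_dot _)).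
have iOmh b : torus_integrable B (fun k => Om k 0 b * h (dot (wavevector B n) k)).
  have [mh [M hM]] := bh.
  rewrite /torus_integrable; under eq_fun do rewrite EFinM.
  apply: integrableMl => //; first exact: measurable_unit_cube.
  - exact: iOm.
  - by apply: measurable_funTS; exact: (@measurable_rowt_mulmx _ _ _ (fun k => h (dot (wavevector B n) k)) B mh).
  - by exists M; split; [exact: num_real|move=> x Mx t _; apply: le_trans (ltW Mx); exact: hM].
pose H i k := \sum_(b < 3) (\det g * g b i) * (Om k 0 b * h (dot (wavevector B n) k)).
apply/rowP => i; rewrite !mxE.
transitivity (torus_int B (fun k => H i (k *m invmx g))).
  congr torus_int; apply/funext => k; rewrite mxE mxE mulr_sumr mulr_suml; apply: eq_bigr => b _.
  rewrite (_ : dot (wavevector B m) k = dot (wavevector B n) (k *m invmx g)); first ring.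
  by rewrite mn O3_inv// dot_mulmx trmxK.
rewrite torus_int_mulmx//.
- rewrite torus_int_sum; last by move=> b; exact: torus_integrableZ.
  rewrite mulr_sumr; apply: eq_bigr => b _; rewrite torus_intZ// mxE; ring.
- by apply: torus_integrable_sum => b; exact: torus_integrableZ.
- by move=> k l ll; apply: eq_bigr => b _; rewrite pOm// ph.
- by rewrite unitmx_inv.
- exact: lattice_preserving_inv.
Qed.

(** Choosing for each mode its image under [g] gives an injective map of the finite list [Q] into
    itself, hence a permutation, by which the sum is reindexed. *)
Lemma fourier_sum_act : fourier_sum B Q (act_pseudovector g Om) =
  act_pseudovector g (fourier_sum B Q Om).
Proof.
have ug := O3_unit Og.
have cos1 (x : R) : `|cos x| <= 1 by rewrite ler_norml cos_le1 cos_geN1.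
have sin1 (x : R) : `|sin x| <= 1 by rewrite ler_norml sin_le1 sin_geN1.
pose s n := xget 0 [set m | m \in Q /\ wavevector B m = wavevector B n *m g].
have sP n : n \in Q -> s n \in Q /\ wavevector B (s n) = wavevector B n *m g.
  by move=> /gQ[m mQ mn]; rewrite /s; case: xgetP => [x -> //|/(_ m)]; case.
have sinj : {in Q &, injective s}.
  move=> n m /sP[_ sn] /sP[_ sm] nm; apply: wavevector_inj.
  by rewrite -(mulmxK ug (wavevector B n)) -sn nm sm mulmxK.
have pQ : perm_eq (map s Q) Q.
  have us : uniq (map s Q) by rewrite map_inj_in_uniq.
  have sub : {subset map s Q <= Q} by move=> _ /mapP[n /sP[sn _] ->].
  have [_ E] := uniq_min_size us sub (eq_leq (esym (size_map s Q))).
  by apply: uniq_perm => // x; rewrite E.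
apply/funext => k; rewrite /fourier_sum -(perm_big _ pQ) /= big_map /act_pseudovector.
rewrite mulmx_suml scaler_sumr big_seq [RHS]big_seq; apply: eq_bigr => n /sP[_ sn].
have -> : cos_coef B (act_pseudovector g Om) (s n) = \det g *: (cos_coef B Om n *m g).
  exact: (coef_act cos1 (@continuous_cos R) (cos_wavevector_periodic uB) sn).
have -> : sin_coef B (act_pseudovector g Om) (s n) = \det g *: (sin_coef B Om n *m g).
  exact: (coef_act sin1 (@continuous_sin R) (sin_wavevector_periodic uB) sn).
rewrite (_ : dot (wavevector B (s n)) k = dot (wavevector B n) (k *m invmx g)); last first.
  by rewrite sn O3_inv// dot_mulmx trmxK.
rewrite -scalemxAl mulmxDl -!scalemxAl !scalerDr !scalerA.
by congr (_ *: _ + _ *: _); ring.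
Qed.

End FourierAct.

Lemma resolve_act r Om g : curvature B r Om -> O3 g -> lattice_preserving B g ->
  resolution_invariant B r g ->
  resolve B r (act_pseudovector g Om) = act_pseudovector g (resolve B r Om).
Proof.
case: r => [|Q] [pOm] // [uQ iOm] Og gB gQ.
exact: fourier_sum_act.
Qed.

Lemma P_obs_transform r (Om : 'rV[R]_3 -> 'rV[R]_3) (E : 'rV[R]_3 -> R) mu g :
  curvature B r Om -> band B E -> O3 g -> lattice_preserving B g -> resolution_invariant B r g ->
  P_obs B (act_scalar g E) mu (resolve B r (act_pseudovector g Om)) =
  P_obs B E mu (resolve B r Om) *m g.
Proof.
move=> cOm bE Og gB rg; rewrite resolve_act//.
have [cW pW] := resolve_regular uB cOm.
exact: P_obs_act.
Qed.

End Transformation.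

(** * Smoothing of the occupation step *)

Section Cutoff.
Context {R : realType}.

Definition ramp (s : R) : R := Num.max 0 s.

Lemma ramp_ge0 s : 0 <= ramp s. Proof. by rewrite /ramp le_max lexx. Qed.

Lemma ramp0 s : s <= 0 -> ramp s = 0. Proof. by move=> s0; rewrite /ramp; apply/max_idPl. Qed.

Lemma ramp_gt0 s : 0 < s -> 0 < ramp s. Proof. by move=> s0; rewrite /ramp lt_max s0 orbT. Qed.

Lemma continuous_ramp : continuous ramp.
Proof. by move=> s; apply: continuous_max; [exact: cst_continuous|]. Qed.

(** The quadratic remainder is uniform in [x], so the squared ramp is differentiable also at the
    kink 0. *)
Lemma ramp_sqr_taylor (x h : R) : `|ramp (x + h) ^+ 2 - ramp x ^+ 2 - 2 * ramp x * h| <= h ^+ 2.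
Proof.
rewrite /ramp ler_norml.
have [x0|x0] := leP x 0; have [xh|xh] := leP (x + h) 0; apply/andP; split; nra.
Qed.

Lemma is_derive_ramp_sqr (x : R) : is_derive x 1 (fun s => ramp s ^+ 2) (2 * ramp x).
Proof.
have D : (h^-1 *: (((fun s => ramp s ^+ 2) \o shift x) (h *: (1:R)) - ramp x ^+ 2)) @[h --> 0^'] --> 2 * ramp x.
  apply/cvgrPdist_le => e e0; near=> h.
  have h0 : h != 0 by near: h; exact: nbhs_dnbhs_neq.
  have he : `|h| <= e by near: h; apply: dnbhs0_le.
  rewrite /= -[h%:A]/(h * 1) mulr1 (addrC h) -[_ *: _]/(_ * _).
  have := ramp_sqr_taylor x h.
  rewrite -(normrN (2 * ramp x - _)) opprB => H.
  rewrite -(ler_pM2r (x := `|h|)) ?normr_gt0// -normrM mulrBl mulrC mulrA divff// mul1r.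
  by apply: le_trans H _; rewrite -real_normK ?num_real// expr2 ler_wpM2r.
by apply: DeriveDef; [apply/cvg_ex; exists (2 * ramp x)|exact: cvg_lim].
Unshelve. all: by end_near. Qed.

(** Squaring makes the ramps C^1. The denominator is positive because [s] and [1 - s] are never both
    nonpositive, so the quotient is C^1, equal to 1 for [s <= 0] and to 0 for [s >= 1]. *)
Definition cutoff (s : R) : R := ramp (1 - s) ^+ 2 / (ramp s ^+ 2 + ramp (1 - s) ^+ 2).

(** Minus the derivative of [cutoff], after cancellation in the quotient rule; written in this form
    it is visibly nonnegative and vanishes outside []0, 1[]. *)
Definition cutoff_slope (s : R) : R :=
  2 * ramp s * ramp (1 - s) * (ramp s + ramp (1 - s)) / (ramp s ^+ 2 + ramp (1 - s) ^+ 2) ^+ 2.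

Lemma cutoff_den_gt0 s : 0 < ramp s ^+ 2 + ramp (1 - s) ^+ 2.
Proof.
have [s0|s0] := ltP 0 s.
  by rewrite ltr_wpDr ?exprn_ge0 ?ramp_ge0// exprn_gt0// ramp_gt0.
rewrite ltr_wpDl ?exprn_ge0 ?ramp_ge0// exprn_gt0// ramp_gt0//; lra.
Qed.

Lemma is_derive_cutoff (s : R) : is_derive s (1 : R) cutoff (- cutoff_slope s).
Proof.
have dn0 := lt0r_neq0 (cutoff_den_gt0 s).
have d1 := is_derive_ramp_sqr s.
have d2 : is_derive s 1 (fun s => ramp (1 - s) ^+ 2) (- (2 * ramp (1 - s))).
  have dr : derivable (fun s => ramp s ^+ 2) (1 - s) 1 by apply: ex_derive; exact: is_derive_ramp_sqr.
  have ds : is_derive s (1:R) (fun s : R => 1 - s) (-1).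
    by have := is_deriveB (is_derive_cst (1:R) s (1:R)) (is_derive_id s (1:R)); rewrite sub0r.
  have du : differentiable (fun s : R => 1 - s) s by apply/derivable1_diffP; exact: ex_derive.
  apply: DeriveDef; first by apply/derivable1_diffP; exact: (differentiable_comp_real du dr).
  rewrite (derive_comp_real (1:R) du dr).
  have -> : 'D_(1:R) (fun s => ramp s ^+ 2) (1 - s) = 2 * ramp (1 - s).
    by have := is_derive_ramp_sqr (1 - s) => ?; exact: derive_val.
  by rewrite (@derive_val _ _ _ _ _ _ _ ds) mulrN1.
have d3 := is_deriveD d1 d2.
have d4 : is_derive s 1 (fun s : R => (ramp s ^+ 2 + ramp (1 - s) ^+ 2)^-1)
    (- (ramp s ^+ 2 + ramp (1 - s) ^+ 2) ^- 2 *: (2 * ramp s - 2 * ramp (1 - s))).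
  by apply: is_deriveV.
have := is_deriveM d2 d4; rewrite /cutoff => /is_derive_eq; apply.
rewrite /cutoff_slope /GRing.scale /=; field.
exact: dn0.
Qed.

Lemma cutoff_slope_ge0 s : 0 <= cutoff_slope s.
Proof. by rewrite /cutoff_slope divr_ge0 ?exprn_ge0 ?addr_ge0 ?mulr_ge0 ?addr_ge0 ?exprn_ge0 ?ramp_ge0. Qed.

Lemma cutoff_slope_supp s : cutoff_slope s != 0 -> 0 < s < 1.
Proof.
apply: contra_neqT; rewrite negb_and -!leNgt => /orP[s0|s1].
  by rewrite /cutoff_slope (ramp0 s0) !(mul0r, mulr0).
by rewrite /cutoff_slope (@ramp0 (1 - s)) ?subr_le0// !(mul0r, mulr0).
Qed.

Lemma continuous_cutoff_slope : continuous cutoff_slope.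
Proof.
have cr := continuous_ramp.
have cr1 : continuous (fun s : R => ramp (1 - s)).
  move=> s; apply: (@continuous_comp _ _ _ (fun s : R => 1 - s) ramp); last exact: cr.
  by apply: continuousB; [exact: cst_continuous|].
move=> s; rewrite /continuous_at /cutoff_slope; apply: cvgM.
  apply: cvgM; last by apply: cvgD; [exact: cr|exact: cr1].
  apply: cvgM; last exact: cr1.
  by apply: cvgM; [exact: cvg_cst|exact: cr].
apply: cvgV; first by rewrite expf_neq0// lt0r_neq0// cutoff_den_gt0.
have cd : ramp s ^+ 2 + ramp (1 - s) ^+ 2 @[s --> s] --> ramp s ^+ 2 + ramp (1 - s) ^+ 2.
  by apply: cvgD; apply: cvgM; do ?[exact: cr|exact: cr1].
exact: cvgM.
Qed.

Lemma cutoff_left s : s <= 0 -> cutoff s = 1.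
Proof.
move=> s0; rewrite /cutoff (ramp0 s0) expr0n add0r divff// expf_neq0//.
by rewrite lt0r_neq0// ramp_gt0//; lra.
Qed.

Lemma cutoff_right s : 1 <= s -> cutoff s = 0.
Proof. by move=> s1; rewrite /cutoff (@ramp0 (1 - s)) ?expr0n ?mul0r//; lra. Qed.

Lemma cutoff_norm s : `|cutoff s| <= 1.
Proof.
rewrite /cutoff ger0_norm ?divr_ge0 ?addr_ge0 ?exprn_ge0 ?ramp_ge0//.
by rewrite ler_pdivrMr ?cutoff_den_gt0// mul1r lerDr exprn_ge0 ?ramp_ge0.
Qed.

Variable mu : R.

Definition level_cutoff (n : nat) (s : R) : R := cutoff ((s - mu) * n.+1%:R).
Definition level_bump (n : nat) (s : R) : R := n.+1%:R * cutoff_slope ((s - mu) * n.+1%:R).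

Lemma is_derive_level_cutoff n (s : R) : is_derive s (1 : R) (level_cutoff n) (- level_bump n s).
Proof.
have dr : derivable cutoff ((s - mu) * n.+1%:R) 1 by apply: ex_derive; exact: is_derive_cutoff.
have ds : is_derive s (1:R) (fun s : R => (s - mu) * n.+1%:R) n.+1%:R.
  have d1 := is_deriveB (is_derive_id s (1:R)) (is_derive_cst mu s (1:R)).
  have := is_deriveM d1 (is_derive_cst (n.+1%:R : R) s (1:R)) => /is_derive_eq; apply.
  by rewrite /GRing.scale/= mulr0 add0r subr0 mulr1.
have du : differentiable (fun s : R => (s - mu) * n.+1%:R) s by apply/derivable1_diffP; exact: ex_derive.
apply: DeriveDef; first by apply/derivable1_diffP; exact: (differentiable_comp_real du dr).
rewrite /level_cutoff (derive_comp_real (1:R) du dr) (@derive_val _ _ _ _ _ _ _ ds).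
have -> : 'D_(1:R) cutoff ((s - mu) * n.+1%:R) = - cutoff_slope ((s - mu) * n.+1%:R).
  by have := is_derive_cutoff ((s - mu) * n.+1%:R) => ?; exact: derive_val.
by rewrite /level_bump mulNr mulrC.
Qed.

Lemma level_bump_ge0 n s : 0 <= level_bump n s.
Proof. by rewrite mulr_ge0// cutoff_slope_ge0. Qed.

Lemma level_bump_supp n s : level_bump n s != 0 -> mu < s < mu + n.+1%:R^-1.
Proof.
rewrite mulf_eq0 negb_or => /andP[_ /cutoff_slope_supp/andP[h1 h2]].
rewrite pmulr_lgt0// subr_gt0 in h1; rewrite h1/= -ltrBlDl.
by rewrite -[X in _ < X]mul1r ltr_pdivlMr.
Qed.

Lemma continuous_level_bump n : continuous (level_bump n).
Proof.
move=> s; rewrite /continuous_at /level_bump; apply: cvgM; first exact: cvg_cst.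
apply: (@continuous_comp _ _ _ (fun s : R => (s - mu) * n.+1%:R) cutoff_slope); last exact: continuous_cutoff_slope.
by apply: cvgM; [apply: cvgB; [exact: cvg_id|exact: cvg_cst]|exact: cvg_cst].
Qed.

Lemma level_cutoff_left n s : s <= mu -> level_cutoff n s = 1.
Proof. by move=> smu; rewrite /level_cutoff cutoff_left// mulr_le0_ge0// subr_le0. Qed.

Lemma level_cutoff_right n s : mu + n.+1%:R^-1 <= s -> level_cutoff n s = 0.
Proof.
by move=> smu; rewrite /level_cutoff cutoff_right// -ler_pdivrMr// div1r lerBrDl.
Qed.

Lemma level_cutoff_norm n s : `|level_cutoff n s| <= 1. Proof. exact: cutoff_norm. Qed.

(** The transition takes place above [mu] only, so that the limit is the step at every [s],
    including [s = mu], where [f0] counts the state as occupied. *)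
Lemma level_cutoff_cvg s : level_cutoff n s @[n --> \oo] --> ((s <= mu)%R%:R : R).
Proof.
have [smu|smu] := leP s mu.
  by under eq_fun do rewrite level_cutoff_left//; exact: cvg_cst.
apply: cvg_near_cst; have s0 : 0 < s - mu by rewrite subr_gt0.
have [m _ hm] := near_infty_natSinv_lt (PosNum s0); exists m => // n mn.
by rewrite /= level_cutoff_right// -lerBrDl; apply: ltW; exact: hm.
Qed.

End Cutoff.

Section DiffCriterion.
Context {R : realType} {V : normedModType R}.

Lemma differentiable_littleo (f : V -> R) (df : {linear V -> R}) x : continuous df ->
  (forall eps, 0 < eps -> \forall h \near 0, `|f (h + x) - f x - df h| <= eps * `|h|) ->
  differentiable f x /\ 'd f x = df :> (V -> R).
Proof.
move=> cdf hdf.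
have E : f \o shift x = cst (f x) + df +o_ 0 id.
  apply/eqaddoP => eps eps0; apply: filterS (hdf _ eps0) => h.
  by rewrite !fctE /= opprD addrA.
have D := diff_unique cdf E; split => //.
by apply/diff_locallyP; rewrite D.
Qed.

Lemma near_cst_differentiable (f : V -> R) (c : R) x :
  (\forall y \near x, f y = c) -> differentiable f x.
Proof.
move=> fc; have [] // := @differentiable_littleo f (\0 : {linear V -> R}) x.
  exact: cst_continuous.
move=> eps eps0; have fx := nbhs_singleton fc.
move: fc; rewrite (near_shift 0 x) subr0 => fc.
by apply: filterS fc => h /= ->; rewrite fx !subrr normr0 mulr_ge0// ltW.
Qed.

End DiffCriterion.

Section ContinuousPointwise.
Context {R : realType}.
Implicit Types (f g : 'rV[R]_3 -> R) (k : 'rV[R]_3).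

Lemma continuous_forM f g k : {for k, continuous f} -> {for k, continuous g} ->
  {for k, continuous (fun x => f x * g x)}.
Proof. exact: (@continuousM _ _ f g). Qed.

Lemma continuous_forD f g k : {for k, continuous f} -> {for k, continuous g} ->
  {for k, continuous (fun x => f x + g x)}.
Proof. exact: (@continuousD _ _ _ f g). Qed.

Lemma continuous_forB f g k : {for k, continuous f} -> {for k, continuous g} ->
  {for k, continuous (fun x => f x - g x)}.
Proof. exact: (@continuousB _ _ _ f g). Qed.

Lemma continuous_forN f k : {for k, continuous f} -> {for k, continuous (fun x => - f x)}.
Proof. exact: (@continuousN _ _ _ f). Qed.

Lemma continuous_forV f k : f k != 0 -> {for k, continuous f} ->
  {for k, continuous (fun x => (f x)^-1)}.
Proof. exact: (@continuousV _ _ f). Qed.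

Lemma continuous_fornorm f k : {for k, continuous f} -> {for k, continuous (fun x => `|f x|)}.
Proof. by move=> cf; apply: (@continuous_comp _ _ _ f Num.norm) => //; exact: norm_continuous. Qed.

Lemma continuous_forcst (c : R) k : {for k, continuous (fun=> c)}.
Proof. exact: cst_continuous. Qed.

Lemma continuous_for_lt f k a : {for k, continuous f} -> f k < a -> \forall x \near k, f x < a.
Proof. by move=> cf fa; exact: (cf _ (lt_nbhsl fa)). Qed.

Lemma continuous_for_gt f k a : {for k, continuous f} -> a < f k -> \forall x \near k, a < f x.
Proof. by move=> cf fa; exact: (cf _ (lt_nbhsr fa)). Qed.

Lemma continuous_for_sum (f_ : 'I_3 -> 'rV[R]_3 -> R) k : (forall i : 'I_3, {for k, continuous (f_ i : 'rV[R]_3 -> R)}) ->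
  {for k, continuous (fun x => \sum_(i < 3) f_ i x)}.
Proof.
move=> cf; have -> : (fun x => \sum_(i < 3) f_ i x) =
    (fun x => f_ ord0 x + f_ (lift ord0 ord0) x + f_ (lift ord0 (lift ord0 ord0)) x).
  by apply/funext => x; rewrite !big_ord_recl big_ord0 addr0 addrA.
by apply: continuous_forD => //; exact: continuous_forD.
Qed.

End ContinuousPointwise.

(** * A neighbourhood of the level set, and integration by parts *)

Section LevelSet.
Context {R : realType}.
Variable B : 'M[R]_3.
Hypothesis uB : B \in unitmx.
Variables (E : 'rV[R]_3 -> R) (mu : R).
Hypotheses (cE : continuous E) (pE : lattice_periodic B E).

(** The closed cell without the interior of [P] is compact and does not meet the level set, so
    [|E - mu|] has a positive minimum on it; periodicity carries the conclusion to all points. *)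
Lemma near_level_set (P : set 'rV[R]_3) :
  (forall k l, lattice B l -> P (k - l) -> P k) ->
  (forall k, E k = mu -> \forall x \near k, P x) ->
  exists2 d, 0 < d & forall k, `|E k - mu| < d -> P k.
Proof.
move=> pP SP.
pose A := closed_cell B `&` ~` (P^°).
have cA : compact A.
  by apply: compact_closedI; [exact: compact_closed_cell|apply: open_closedC; exact: open_interior].
have cdist : continuous (fun k => `|E k - mu|).
  by move=> k; apply: continuous_fornorm; apply: continuous_forB; [exact: cE|exact: continuous_forcst].
have [A0|/set0P nA0] := eqVneq A set0.
  exists 1 => // k _; have [l ll kl] := closed_cellP uB k; apply: (pP k l ll).
  apply: nbhs_singleton; apply: contrapT => nP.
  by have : A (k - l) by []; rewrite A0.
have [c /[1!inE] -[_ nPc] cmin] := compact_EVT_min nA0 cA (continuous_subspaceT cdist).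
exists `|E c - mu|.
  by rewrite normr_gt0 subr_eq0; apply/eqP => Ec; apply: nPc; exact: SP.
move=> k kc; have [l ll kl] := closed_cellP uB k; apply: (pP k l ll).
apply: nbhs_singleton; apply: contrapT => nP.
have := cmin (k - l); rewrite inE (lattice_periodicB _ pE ll) => /(_ (conj kl nP)).
by rewrite leNgt kc.
Qed.

Definition regular_point k := differentiable E k /\ forall i, {for k, continuous (pd i E)}.

Lemma differentiable_shift (f : 'rV[R]_3 -> R) k l :
  differentiable f (k + l) -> differentiable (fun x => f (x + l)) k.
Proof.
move=> df; apply: (@differentiable_comp _ _ _ _ (fun x : 'rV[R]_3 => x + l) f) => //.
Qed.

Lemma regular_point_periodic k l : lattice B l -> regular_point (k - l) -> regular_point k.
Proof.
move=> ll [dE cpE].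
have EE : (fun x => E (x - l)) = E by apply/funext => x; rewrite (lattice_periodicB _ pE ll).
split; first by rewrite -EE; exact: differentiable_shift.
move=> i; have pp := pd_periodic i pE.
have -> : pd i E = (fun x => pd i E (x - l)) by apply/funext => x; rewrite (lattice_periodicB _ pp ll).
by apply: (@continuous_comp _ _ _ (fun x : 'rV[R]_3 => x - l) (pd i E)); [exact: continuous_addr|exact: cpE].
Qed.

Lemma regular_near : regular_fermi_surface E mu ->
  exists2 d, 0 < d & forall k, `|E k - mu| < d -> regular_point k.
Proof.
move=> [[U [oU SU hU]] _]; apply: near_level_set; first exact: regular_point_periodic.
move=> k Ek; have Uk : nbhs k U by apply: open_nbhs_nbhs; split => //; exact: SU.
by apply: filterS Uk => x Ux; have [? ?] := hU _ Ux.
Qed.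

Variable d : R.
Hypotheses (d0 : 0 < d) (regd : forall k, `|E k - mu| < d -> regular_point k).

Variable n : nat.
Hypothesis nd : n.+1%:R^-1 < d.

(** Outside the shell where [E] is known to be regular, the cut-off of [E] is locally constant. This
    makes the composite C^1 on the whole torus although [E] need not be. *)
Lemma off_level_near k : d <= `|E k - mu| ->
  (exists2 c, c = 0 \/ c = 1 & \forall x \near k, level_cutoff mu n (E x) = c) /\
  \forall x \near k, level_bump mu n (E x) = 0.
Proof.
move=> dk.
have [Ek|Ek] := ltP (E k) mu.
  have nE : \forall x \near k, E x < mu := continuous_for_lt (@cE k) Ek.
  split.
    by exists 1; [right|apply: filterS nE => x Ex; rewrite level_cutoff_left// ltW].
  apply: filterS nE => x Ex; apply/eqP/negPn/negP => /level_bump_supp/andP[].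
  by rewrite ltNge (ltW Ex).
have Ek' : mu + n.+1%:R^-1 < E k.
  rewrite -ltrBrDl; apply: lt_le_trans nd _; move: dk; rewrite ger0_norm ?subr_ge0//.
have nE : \forall x \near k, mu + n.+1%:R^-1 < E x := continuous_for_gt (@cE k) Ek'.
split.
  by exists 0; [left|apply: filterS nE => x Ex; rewrite level_cutoff_right// ltW].
apply: filterS nE => x Ex; apply/eqP/negPn/negP => /level_bump_supp/andP[_].
by rewrite ltNge (ltW Ex).
Qed.

Lemma differentiable_level k : differentiable (fun x => level_cutoff mu n (E x)) k.
Proof.
have [kd|dk] := ltP `|E k - mu| d.
  have [dE _] := regd kd; apply: (differentiable_comp_real dE).
  by apply: ex_derive; exact: is_derive_level_cutoff.
by have [[c _ /near_cst_differentiable]] := off_level_near dk.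
Qed.

Lemma pd_level i : pd i (fun x => level_cutoff mu n (E x)) =
  (fun x => - (level_bump mu n (E x) * pd i E x)).
Proof.
apply/funext => k; have [kd|dk] := ltP `|E k - mu| d.
  have [dE _] := regd kd.
  rewrite /pd (derive_comp_real _ dE); last by apply: ex_derive; exact: is_derive_level_cutoff.
  by have := is_derive_level_cutoff mu n (E k) => ?; rewrite derive_val mulNr.
have [[c _ kc] /nbhs_singleton ->] := off_level_near dk.
by rewrite /pd (near_eq_derive _ kc) derive_cst mul0r oppr0.
Qed.

(* G may be junk where E is not regular: the bump vanishes there. *)
Lemma continuous_bump (G : 'rV[R]_3 -> R) :
  (forall k, `|E k - mu| < d -> {for k, continuous G}) ->
  continuous (fun x => level_bump mu n (E x) * G x).
Proof.
move=> cG k; have [kd|dk] := ltP `|E k - mu| d.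
  apply: continuous_forM; last exact: cG.
  by apply: (@continuous_comp _ _ _ E (level_bump mu n)); [exact: cE|exact: continuous_level_bump].
have [_ kc] := off_level_near dk.
apply: differentiable_continuous; apply: (@near_cst_differentiable _ _ _ 0).
by apply: filterS kc => x ->; rewrite mul0r.
Qed.

Lemma C1_level : C1 (fun x => level_cutoff mu n (E x)).
Proof.
split=> [k|i]; first exact: differentiable_level.
rewrite pd_level => k; apply: continuous_forN; apply: continuous_bump => x xd.
by have [_] := regd xd; apply.
Qed.

Lemma level_periodic : lattice_periodic B (fun x => level_cutoff mu n (E x)).
Proof. by move=> k l ll; rewrite pE. Qed.

Definition flux (W : 'rV[R]_3 -> 'rV[R]_3) l k := cross (gradient E k) (W k) 0 l.

Lemma fluxE W l k : flux W l k = \sum_(i < 3) \sum_(j < 3) eps l i j * pd i E k * W k 0 j.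
Proof. by rewrite /flux mxE; apply: eq_bigr => i _; apply: eq_bigr => j _; rewrite mxE. Qed.

Lemma flux_periodic W l : lattice_periodic B W -> lattice_periodic B (flux W l).
Proof.
move=> pW k q lq; rewrite !fluxE; apply: eq_bigr => i _; apply: eq_bigr => j _.
by rewrite pW// (pd_periodic i pE k lq).
Qed.

Lemma continuous_flux W l k : C1_field W -> regular_point k -> {for k, continuous (flux W l)}.
Proof.
move=> cW [_ cpE].
have -> : flux W l = (fun x => \sum_(i < 3) \sum_(j < 3) eps l i j * pd i E x * W x 0 j).
  by apply/funext => x; exact: fluxE.
apply: continuous_for_sum => i; apply: continuous_for_sum => j.
apply: continuous_forM; last exact: (differentiable_continuous ((cW j).1 k)).
by apply: continuous_forM; [exact: continuous_forcst|exact: cpE].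
Qed.

Lemma torus_int_level_curl W l : C1_field W -> lattice_periodic B W ->
  torus_int B (fun k => level_cutoff mu n (E k) * curl W k 0 l) =
  torus_int B (fun k => level_bump mu n (E k) * flux W l k).
Proof.
move=> cW pW.
have cl := C1_level; have pl := level_periodic.
have cb j i : continuous (fun k => level_bump mu n (E k) * (pd i E k * W k 0 j)).
  apply: continuous_bump => k kd; apply: continuous_forM; first by have [_] := regd kd; apply.
  exact: (differentiable_continuous ((cW j).1 k)).
have pb j i : lattice_periodic B (fun k => level_bump mu n (E k) * (pd i E k * W k 0 j)).
  by move=> k q lq; rewrite pE// pW// (pd_periodic i pE k lq).
have bb j i := bounded_measurable_integrable B (bounded_measurable_continuous uB (cb j i) (pb j i)).
have cc j i : continuous (fun k => level_cutoff mu n (E k) * pd i (component W j) k).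
  by move=> k; apply: continuous_forM; [exact: (C1_continuous cl)|exact: (cW j).2].
have pc j i : lattice_periodic B (fun k => level_cutoff mu n (E k) * pd i (component W j) k).
  by move=> k q lq; rewrite pE// (pd_periodic i (component_periodic j pW) k lq).
have bc j i := bounded_measurable_integrable B (bounded_measurable_continuous uB (cc j i) (pc j i)).
have ibp i j : torus_int B (fun k => level_cutoff mu n (E k) * pd i (component W j) k) =
    torus_int B (fun k => level_bump mu n (E k) * (pd i E k * W k 0 j)).
  apply/eqP; rewrite -subr_eq0 -mulN1r -torus_intZ//.
  rewrite -torus_intD//; last exact: torus_integrableZ.
  (* The difference of the two integrands is the derivative along [i] of a periodic C^1 function, so
     its integral vanishes. *)
  have -> : (fun k => level_cutoff mu n (E k) * pd i (component W j) k
      + -1 * (level_bump mu n (E k) * (pd i E k * W k 0 j))) =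
      pd i (fun k => level_cutoff mu n (E k) * component W j k).
    apply/funext => k; rewrite pdM; [|exact: differentiable_level|exact: (cW j).1].
    by rewrite pd_level /component; ring.
  rewrite torus_int_pd//; first exact: C1M.
  by move=> k q lq; rewrite pE// (component_periodic j pW k lq).
have -> : (fun k => level_cutoff mu n (E k) * curl W k 0 l) = (fun k => \sum_(i < 3) \sum_(j < 3)
    eps l i j * (level_cutoff mu n (E k) * pd i (component W j) k)).
  apply/funext => k; rewrite mxE mulr_sumr; apply: eq_bigr => i _.
  by rewrite mulr_sumr; apply: eq_bigr => j _; rewrite mulrCA.
have -> : (fun k => level_bump mu n (E k) * flux W l k) = (fun k => \sum_(i < 3) \sum_(j < 3)
    eps l i j * (level_bump mu n (E k) * (pd i E k * W k 0 j))).
  apply/funext => k; rewrite fluxE mulr_sumr; apply: eq_bigr => i _.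
  by rewrite mulr_sumr; apply: eq_bigr => j _; ring.
rewrite !torus_int_sum; last 2 first.
- by move=> i; apply: torus_integrable_sum => j; exact: torus_integrableZ.
- by move=> i; apply: torus_integrable_sum => j; exact: torus_integrableZ.
apply: eq_bigr => i _; rewrite !torus_int_sum; last 2 first.
- by move=> j; exact: torus_integrableZ.
- by move=> j; exact: torus_integrableZ.
by apply: eq_bigr => j _; rewrite !torus_intZ// ibp.
Qed.

End LevelSet.

Section PLimit.
Context {R : realType}.
Variable B : 'M[R]_3.
Hypothesis uB : B \in unitmx.
Variables (E : 'rV[R]_3 -> R) (mu : R).
Hypotheses (bE : band B E) (rE : regular_fermi_surface E mu).

(** The cut-offs converge pointwise to [f0] and the curl is bounded, so the volume integrals
    converge. Integration by parts applies once 1/(n+1) is below the width of the regular shell. *)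
Lemma P_obs_flux_limit W l : C1_field W -> lattice_periodic B W ->
  torus_int B (fun k => level_bump mu n (E k) * flux E W l k) @[n --> \oo] --> P_obs B E mu W 0 l.
Proof.
move=> cW pW; have [cE pE] := bE.
have [d d0 regd] := regular_near uB cE pE rE.
rewrite mxE.
have [M cM] := periodic_bounded uB (continuous_curl (c:=l) cW)
  (fun k q lq => congr1 (fun v : 'rV[R]_3 => v 0 l) (curl_periodic pW k lq)).
have M0 : 0 <= M by apply: le_trans (cM 0).
have : torus_int B (fun k => level_cutoff mu n (E k) * curl W k 0 l) @[n --> \oo] -->
    torus_int B (fun k => f0 E mu k * curl W k 0 l).
  apply: (@torus_int_cvg _ B (fun n k => level_cutoff mu n (E k) * curl W k 0 l) _ M).
  - move=> n; apply: measurable_funM; last exact: (measurable_rowt_continuous (continuous_curl (c:=l) cW)).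
    apply: (@measurable_rowt_continuous _ (fun k => level_cutoff mu n (E k))) => k.
    apply: (@continuous_comp _ _ _ E (level_cutoff mu n)); first exact: cE.
    apply: differentiable_continuous; apply/derivable1_diffP.
    by apply: ex_derive; exact: is_derive_level_cutoff.
  - move=> n k; rewrite normrM -[M]mul1r; apply: ler_pM => //; exact: level_cutoff_norm.
  - by move=> k; apply: cvgM; [exact: level_cutoff_cvg|exact: cvg_cst].
apply: cvg_trans; apply: near_eq_cvg.
have [m _ hm] := near_infty_natSinv_lt (PosNum d0); exists m => // n mn.
exact: (torus_int_level_curl uB cE pE regd (hm n mn)).
Qed.

End PLimit.

(** * The Dirac limit in one variable *)

Section OneDim.
Context {R : realType}.
Local Notation leb := (@lebesgue_measure R).

(** Fundamental theorem of calculus: the integrand is the derivative of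
    [- sg * level_cutoff mu n (e t)]. *)
Lemma level_bump_mass (e de : R -> R) (a b mu sg : R) n : a < b ->
  (forall t, a <= t <= b -> is_derive t 1 e (de t)) ->
  (forall t, a <= t <= b -> {for t, continuous de}) ->
  \int[leb]_(t in `[a, b]) (level_bump mu n (e t) * (sg * de t)) =
  sg * (level_cutoff mu n (e a) - level_cutoff mu n (e b)).
Proof.
move=> ab de_e cde.
pose D t := level_bump mu n (e t) * (sg * de t).
have wcD : {within `[a, b], continuous D}.
  apply: continuous_in_subspaceT => t; rewrite inE/= in_itv/= => tab.
  apply: cvgM.
    apply: (@continuous_comp _ _ _ e (level_bump mu n)); last exact: continuous_level_bump.
    by apply: differentiable_continuous; apply/derivable1_diffP; have := de_e _ tab => ?; exact: ex_derive.
  by apply: cvgM; [exact: cvg_cst|exact: cde].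
pose F t := - sg * level_cutoff mu n (e t).
have dF t : a <= t <= b -> is_derive t 1 F (D t).
  move=> tab; have det := de_e _ tab.
  have dcut := is_derive_level_cutoff mu n (e t).
  have du : differentiable e t by apply/derivable1_diffP; exact: ex_derive.
  have dh : derivable (level_cutoff mu n) (e t) 1 by exact: ex_derive.
  have dc : is_derive t (1:R) (fun t => level_cutoff mu n (e t)) (- level_bump mu n (e t) * de t).
    apply: DeriveDef; first by apply/derivable1_diffP; exact: differentiable_comp_real.
    rewrite (derive_comp_real (1:R) du dh).
    by rewrite (@derive_val _ _ _ _ _ _ _ dcut) (@derive_val _ _ _ _ _ _ _ det).
  have := is_deriveZ (- sg) dc => /is_derive_eq; apply.
  by rewrite /D /GRing.scale/=; ring.
have cF t : a <= t <= b -> {for t, continuous F}.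
  by move=> tab; apply: differentiable_continuous; apply/derivable1_diffP; have := dF _ tab => ?; exact: ex_derive.
rewrite /Rintegral (@continuous_FTC2 _ D F a b ab); last 3 first.
- exact: wcD.
- split.
  + move=> t; rewrite in_itv/= => /andP[ta tb]; have tab : a <= t <= b by rewrite (ltW ta) (ltW tb).
    exact: (@ex_derive _ _ _ _ _ _ _ (dF t tab)).
  + by apply: cvg_at_right_filter; apply: cF; rewrite lexx ltW.
  + by apply: cvg_at_left_filter; apply: cF; rewrite lexx ltW.
- move=> t; rewrite in_itv/= => /andP[ta tb]; have := dF t; rewrite !ltW// => /(_ isT) ?.
  by rewrite derive1E derive_val.
by rewrite /= /F; ring.
Qed.

(** From [|G| <= M <= M / c * (sg * de)] the integral is at most [M / c] times the mass of the bump,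
    a difference of two cut-off values of modulus at most 1, whence the factor 2. The bound is
    uniform in [n] and dominates the integrals over lines parallel to the axis. *)
Lemma level_bump_bound (e de G : R -> R) (a b c M mu sg : R) n : a < b -> 0 < c ->
  sg = 1 \/ sg = -1 ->
  (forall t, a <= t <= b -> is_derive t 1 e (de t)) ->
  (forall t, a <= t <= b -> {for t, continuous de}) ->
  (forall t, a <= t <= b -> {for t, continuous G}) ->
  (forall t, a <= t <= b -> c <= sg * de t) ->
  (forall t, a <= t <= b -> `|G t| <= M) ->
  `|\int[leb]_(t in `[a, b]) (level_bump mu n (e t) * G t)| <= M / c * 2.
Proof.
move=> ab c0 sg1 de_e cde cG cde0 GM.
have M0 : 0 <= M by apply: le_trans (GM a _) => //; rewrite lexx ltW.
have fi (f : R -> R) : (forall t, a <= t <= b -> {for t, continuous f}) ->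
    leb.-integrable `[a, b] (EFin \o f).
  move=> cf; apply: continuous_compact_integrable; first exact: segment_compact.
  by apply: continuous_in_subspaceT => t; rewrite inE/= in_itv/=; exact: cf.
have mab : measurable (`[a, b]%classic : set (measurableTypeR R)) by [].
have cb t : a <= t <= b -> {for t, continuous (fun t => level_bump mu n (e t))}.
  move=> tab; apply: (@continuous_comp _ _ _ e (level_bump mu n)); last exact: continuous_level_bump.
  by apply: differentiable_continuous; apply/derivable1_diffP; have := de_e _ tab => ?; exact: ex_derive.
have cbG t : a <= t <= b -> {for t, continuous (fun t => level_bump mu n (e t) * G t)}.
  by move=> tab; apply: cvgM; [exact: cb|exact: cG].
have cbD t : a <= t <= b -> {for t, continuous (fun t => level_bump mu n (e t) * (sg * de t))}.
  by move=> tab; apply: cvgM; [exact: cb|apply: cvgM; [exact: cvg_cst|exact: cde]].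
apply: le_trans (le_normr_Rintegral mab (fi _ cbG)) _.
have le1 : \int[leb]_(t in `[a, b]) `|level_bump mu n (e t) * G t| <=
    \int[leb]_(t in `[a, b]) (M / c * (level_bump mu n (e t) * (sg * de t))).
  apply: le_Rintegral => //.
  - by apply: (fi (fun t => `|level_bump mu n (e t) * G t|)) => t tab; apply: cvg_norm; exact: cbG.
  - apply: (fi (fun t => M / c * (level_bump mu n (e t) * (sg * de t)))) => t tab.
    by apply: cvgM; [exact: cvg_cst|exact: cbD].
  - move=> t; rewrite /= in_itv/= => tab; rewrite normrM ger0_norm ?level_bump_ge0//.
    rewrite mulrCA ler_wpM2l ?level_bump_ge0//; apply: le_trans (GM t tab) _.
    by rewrite -mulrA ler_peMr// mulrC ler_pdivlMr// mul1r cde0.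
apply: le_trans le1 _; rewrite RintegralZl//; last exact: (fi _ cbD).
rewrite (level_bump_mass mu sg n ab de_e cde) ler_wpM2l ?divr_ge0 ?(ltW c0)//.
have := level_cutoff_norm mu n (e a); have := level_cutoff_norm mu n (e b).
by rewrite !ler_norml => /andP[? ?] /andP[? ?]; case: sg1 => ->; lra.
Qed.

(* The bump of width 1/(n+1) around the root h of e - mu integrates, after the substitution
   s = e t, to a unit mass at h. *)
Lemma level_bump_cvg (e de G : R -> R) (a b c mu sg h : R) : a < b -> 0 < c ->
  sg = 1 \/ sg = -1 ->
  (forall t, a <= t <= b -> is_derive t 1 e (de t)) ->
  (forall t, a <= t <= b -> {for t, continuous de}) ->
  (forall t, a <= t <= b -> {for t, continuous G}) ->
  (forall t, a <= t <= b -> c <= sg * de t) ->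
  sg * (e a - mu) < 0 -> 0 < sg * (e b - mu) -> a <= h <= b -> e h = mu ->
  \int[leb]_(t in `[a, b]) (level_bump mu n (e t) * G t) @[n --> \oo] --> G h / (sg * de h).
Proof.
move=> ab c0 sg1 de_e cde cG cde0 ea eb hab eh.
have ce t : a <= t <= b -> {for t, continuous e}.
  by move=> tab; apply: differentiable_continuous; apply/derivable1_diffP; have := de_e _ tab => ?; exact: ex_derive.
(* The integrand becomes [D n t * w t], where [D n] is nonnegative, of total mass 1 for large [n],
   and concentrates at [h]. *)
pose w t := G t / (sg * de t).
have den0 t : a <= t <= b -> sg * de t != 0.
  by move=> tab; rewrite gt_eqF// (lt_le_trans c0)// cde0.
have csg t : a <= t <= b -> {for t, continuous (fun t => sg * de t)}.
  by move=> tab; apply: cvgM; [exact: cvg_cst|exact: cde].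
have cw t : a <= t <= b -> {for t, continuous w}.
  by move=> tab; apply: cvgM; [exact: cG|apply: cvgV; [exact: den0|exact: csg]].
pose D n t := level_bump mu n (e t) * (sg * de t).
have cD n t : a <= t <= b -> {for t, continuous (D n)}.
  move=> tab; apply: cvgM; last exact: csg.
  by apply: (@continuous_comp _ _ _ e (level_bump mu n)); [exact: ce|exact: continuous_level_bump].
have D0 n t : a <= t <= b -> 0 <= D n t.
  by move=> tab; rewrite mulr_ge0 ?level_bump_ge0// (le_trans (ltW c0))// cde0.
have wi (f : R -> R) : (forall t, a <= t <= b -> {for t, continuous f}) ->
    {within `[a, b], continuous f}.
  by move=> cf; apply: continuous_in_subspaceT => t; rewrite inE/= in_itv/=; exact: cf.
have fi (f : R -> R) : (forall t, a <= t <= b -> {for t, continuous f}) ->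
    leb.-integrable `[a, b] (EFin \o f).
  by move=> cf; apply: continuous_compact_integrable; [exact: segment_compact|exact: wi].
have mab : measurable (`[a, b]%classic : set (measurableTypeR R)) by [].
have sgsg : sg * sg = 1 by case: sg1 => ->; rewrite ?mulr1// mulrNN mulr1.
(* Once both ends lie outside the transition zone, the cut-off is 1 at one end and 0 at the other;
   [sg] tells which. *)
have mass n : n.+1%:R^-1 < `|e a - mu| -> n.+1%:R^-1 < `|e b - mu| ->
    \int[leb]_(t in `[a, b]) D n t = 1.
  move=> na nb.
  have -> : \int[leb]_(t in `[a, b]) D n t = sg * (level_cutoff mu n (e a) - level_cutoff mu n (e b)).
    exact: level_bump_mass.
  case: sg1 ea eb na nb => -> ea eb na nb.
    rewrite mul1r subr_lt0 in ea; rewrite mul1r subr_gt0 in eb.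
    rewrite (level_cutoff_left _ (ltW ea)) level_cutoff_right; first ring.
    by rewrite -lerBrDl ltW//; move: nb; rewrite gtr0_norm// subr_gt0.
  rewrite mulN1r oppr_lt0 subr_gt0 in ea; rewrite mulN1r oppr_gt0 subr_lt0 in eb.
  rewrite (level_cutoff_left _ (ltW eb)) level_cutoff_right; first ring.
  by rewrite -lerBrDl ltW//; move: na; rewrite gtr0_norm// subr_gt0.
apply/cvgrPdist_le => eta eta0.
have /cvgrPdist_le/(_ _ eta0) := cw _ hab => /nbhs_ballP[r /= r0 hr].
have ea0 : 0 < `|e a - mu|.
  by rewrite normr_gt0; apply: contraTneq ea => ->; rewrite mulr0 ltxx.
have eb0 : 0 < `|e b - mu|.
  by rewrite normr_gt0; apply: contraTneq eb => ->; rewrite mulr0 ltxx.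
have wiS x y : a <= x -> y <= b -> {within `[x, y], continuous e}.
  move=> ax yb; apply: continuous_in_subspaceT => t; rewrite inE/= in_itv/= => /andP[xt ty].
  by apply: ce; rewrite (le_trans ax xt) (le_trans ty yb).
(* The lower bound on the slope turns closeness of [e t] to [mu] into closeness of [t] to [h]: the
   bump is supported where [|t - h| < r] as soon as 1/(n+1) is below [c * r]. *)
have lip t : a <= t <= b -> c * `|t - h| <= `|e t - mu|.
  move=> /andP[ta tb]; rewrite -eh.
  have key x y : a <= x -> x < y -> y <= b -> c * (y - x) <= `|e y - e x|.
    move=> ax xy yb.
    have inab z : z \in `]x, y[ -> a <= z <= b.
      by rewrite in_itv/= => /andP[xz zy]; rewrite (le_trans ax (ltW xz)) (le_trans (ltW zy) yb).
    have [z zxy ->] := @MVT R e de x y xy (fun z zz => de_e z (inab z zz))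
      (wiS x y ax yb).
    rewrite normrM [`|y - x|]gtr0_norm ?subr_gt0// ler_wpM2r ?subr_ge0 ?(ltW xy)//.
    apply: le_trans (cde0 _ (inab _ zxy)) _.
    by apply: le_trans (ler_norm _) _; rewrite normrM; case: sg1 => ->; rewrite ?normrN normr1 mul1r.
  move: hab => /andP[ha hb]; have [th|th|->] := ltgtP t h.
  - by rewrite ltr0_norm ?subr_lt0// opprB distrC; exact: key.
  - by rewrite gtr0_norm ?subr_gt0//; exact: key.
  - by rewrite !subrr !normr0 mulr0.
have cr0 : 0 < c * r by rewrite mulr_gt0.
near=> n.
have na : n.+1%:R^-1 < `|e a - mu| by near: n; exact: (near_infty_natSinv_lt (PosNum ea0)).
have nb : n.+1%:R^-1 < `|e b - mu| by near: n; exact: (near_infty_natSinv_lt (PosNum eb0)).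
have nr : n.+1%:R^-1 < c * r by near: n; exact: (near_infty_natSinv_lt (PosNum cr0)).
have pt t : a <= t <= b -> `|D n t * (w h - w t)| <= eta * D n t.
  move=> tab; have [D00|Dn0] := eqVneq (D n t) 0; first by rewrite D00 mul0r normr0 mulr0.
  rewrite normrM ger0_norm ?D0// mulrC ler_wpM2r ?D0//.
  apply: hr; rewrite /ball/= distrC -(ltr_pM2l c0).
  apply: le_lt_trans (lip _ tab) _; apply: lt_trans nr.
  have /level_bump_supp/andP[h1 h2] : level_bump mu n (e t) != 0.
    by apply: contraNneq Dn0; rewrite /D => ->; rewrite mul0r.
  by rewrite gtr0_norm ?subr_gt0// ltrBlDl.
have -> : \int[leb]_(t in `[a, b]) (level_bump mu n (e t) * G t) = \int[leb]_(t in `[a, b]) (D n t * w t).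
  apply: eq_Rintegral => t; rewrite inE/= in_itv/= => tab; rewrite /D /w.
  by rewrite -mulrA [_ * (G t / _)]mulrC mulfVK// den0.
have cDw t : a <= t <= b -> {for t, continuous (fun t => D n t * w t)}.
  by move=> tab; apply: cvgM; [exact: cD|exact: cw].
have cDd t : a <= t <= b -> {for t, continuous (fun t => D n t * (w h - w t))}.
  by move=> tab; apply: cvgM; [exact: cD|apply: cvgB; [exact: cvg_cst|exact: cw]].
have -> : G h / (sg * de h) = \int[leb]_(t in `[a, b]) (D n t * w h).
  by rewrite RintegralZr ?mass ?mul1r//; exact: (fi _ (cD n)).
have cDh t : a <= t <= b -> {for t, continuous (fun t => D n t * w h)}.
  by move=> tab; apply: cvgM; [exact: cD|exact: cvg_cst].
rewrite -RintegralB//; [|exact: (fi _ cDh)|exact: (fi _ cDw)].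
under eq_Rintegral do rewrite -mulrBr.
apply: le_trans (le_normr_Rintegral mab (fi _ cDd)) _.
have -> : eta = \int[leb]_(t in `[a, b]) (eta * D n t).
  by rewrite RintegralZl ?mass ?mulr1//; exact: (fi _ (cD n)).
apply: le_Rintegral => //.
- by apply: (fi (fun t => `|D n t * (w h - w t)|)) => t tab; apply: cvg_norm; exact: cDd.
- by apply: (fi (fun t => eta * D n t)) => t tab; apply: cvgM; [exact: cvg_cst|exact: cD].
Unshelve. all: by end_near. Qed.

End OneDim.

(** * Localization on the torus *)

Section LatticeDistance.
Context {R : realType}.
Variable B : 'M[R]_3.
Hypothesis uB : B \in unitmx.

(* A continuous periodic substitute for the distance to the lattice. *)
Definition ldist (v : 'rV[R]_3) : R :=
  \sum_(i < 3) (1 - cos ((v *m invmx B) 0 i * (pi *+ 2))).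

(** If the fractional part [y] were nonzero, [sin (y * pi)] would be positive and the double angle
    formula would make the cosine smaller than 1. *)
Lemma cos_eq1 (x : R) : cos (x * (pi *+ 2)) = 1 -> exists z : int, x = z%:~R.
Proof.
move=> cx; exists (Num.floor x); apply/eqP; rewrite -subr_eq0; apply/negPn/negP => y0.
set y := x - _ in y0.
have /andP[y_ge0 y_lt1] : 0 <= y < 1.
  by rewrite subr_ge0 ge_floor /= ltrBlDl -[X in _ + X]/(1%:~R) -intrD lt_succ_floor.
have cy : cos (y * (pi *+ 2)) = 1.
  have [<- _] := cos_sinD2pi_int (y * (pi *+ 2)) (Num.floor x); rewrite -[RHS]cx; congr cos.
  by rewrite /y; ring.
have sy : 0 < sin (y * pi).
  have pi0 := @pi_gt0 R.
  have y1 : 0 < y by rewrite lt_def y0.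
  by apply: sin_gt0_pi; rewrite mulr_gt0//= gtr_pMl.
have := cosD (y * pi) (y * pi); rewrite -mulrDr -mulr2n cy.
have := cos2Dsin2 (y * pi); nra.
Qed.

Lemma continuous_ldist : continuous ldist.
Proof.
move=> v; apply: (@continuous_for_sum _ (fun i v => 1 - cos ((v *m invmx B) 0 i * (pi *+ 2)))) => i.
apply: continuous_forB; first exact: continuous_forcst.
apply: (@continuous_comp _ _ _ (fun v : 'rV[R]_3 => (v *m invmx B) 0 i * (pi *+ 2)) cos); last exact: continuous_cos.
apply: continuous_forM; last exact: continuous_forcst.
apply: (@continuous_comp _ _ _ (fun v : 'rV[R]_3 => v *m invmx B) (fun v => v 0 i)).
  exact: continuous_mulmx.
exact: continuous_coord.
Qed.

Lemma ldist_periodic : lattice_periodic B ldist.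
Proof.
move=> k l [n ->]; apply: eq_bigr => i _; congr (1 - _).
have -> : ((k + map_mx intr n *m B) *m invmx B) 0 i = (k *m invmx B) 0 i + (n 0 i)%:~R.
  by rewrite mulmxDl mulmxK// mxE; congr (_ + _); rewrite mxE.
have [<- _] := cos_sinD2pi_int ((k *m invmx B) 0 i * (pi *+ 2)) (n 0 i).
by congr cos; ring.
Qed.

Lemma ldist_ge0 v : 0 <= ldist v.
Proof. by apply: sumr_ge0 => i _; rewrite subr_ge0 cos_le1. Qed.

Lemma ldist0 : ldist 0 = 0.
Proof. by rewrite /ldist big1// => i _; rewrite mul0mx mxE mul0r cos0 subrr. Qed.

Lemma ldist_eq0 v : ldist v = 0 -> lattice B v.
Proof.
move=> /eqP; rewrite psumr_eq0; last by move=> i _; rewrite subr_ge0 cos_le1.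
move=> /allP vi.
have /choice[n nE] : forall i, exists z : int, (v *m invmx B) 0 i = z%:~R.
  move=> i; apply: cos_eq1; apply/esym/eqP; rewrite -subr_eq0.
  by have := vi i (mem_index_enum i); rewrite implyTb.
exists (\row_i n i); rewrite -[LHS](mulmxKV uB); congr (_ *m _).
by apply/rowP => i; rewrite nE !mxE.
Qed.

(** The lattice is the level set of [ldist] at 0, so the compactness argument for level sets applies
    to [ldist] itself. *)
Lemma ldist_small r : 0 < r ->
  exists2 e, 0 < e & forall v, ldist v < e -> exists2 l, lattice B l & `|v - l| < r.
Proof.
move=> r0.
have [||e e0 he] := near_level_set uB (mu := 0) continuous_ldist ldist_periodic
  (P := [set v | exists2 l, lattice B l & `|v - l| < r]).
- move=> k l ll [q lq kq]; exists (l + q); first exact: latticeD.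
  by rewrite opprD addrA.
- move=> k /ldist_eq0 lk; apply: filterS (nbhsx_ballx k _ r0) => v kv; exists k => //.
  by move: kv; rewrite -ball_normE /= distrC.
exists e => // v ve; apply: he; rewrite subr0 ger0_norm//; exact: ldist_ge0.
Qed.

End LatticeDistance.

Section PartitionOfUnity.
Context {R : realType}.
Variable B : 'M[R]_3.
Hypothesis uB : B \in unitmx.
Variables (E : 'rV[R]_3 -> R) (mu : R).
Hypotheses (cE : continuous E) (pE : lattice_periodic B E).
Local Notation S := (fermi_surface E mu).

Definition near_lattice_point (s : 'rV[R]_3) (r : R) (v : 'rV[R]_3 -> R) : Prop :=
  [/\ continuous v, lattice_periodic B v, forall k, 0 <= v k &
      forall k, v k != 0 -> exists2 l, lattice B l & `|k - l - s| < r].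

Lemma partition_of_unity (r : 'rV[R]_3 -> R) : (forall s, S s -> 0 < r s) ->
  exists (q : seq 'rV[R]_3) (v : 'rV[R]_3 -> 'rV[R]_3 -> R) (d : R),
  [/\ 0 < d, forall s, continuous (v s) /\ lattice_periodic B (v s),
      forall s, s \in q -> S s /\ near_lattice_point s (r s) (v s) &
      forall k, `|E k - mu| < d -> \sum_(s <- q) v s k = 1].
Proof.
move=> r0.
have /choice[e he] : forall s, exists e, S s -> 0 < e /\
    forall v, ldist B v < e -> exists2 l, lattice B l & `|v - l| < r s.
  move=> s; have [Ss|nSs] := pselect (S s); last by exists 0.
  by have [e e0 he] := ldist_small uB (r0 s Ss); exists e.
have cd s : continuous (fun k : 'rV[R]_3 => ldist B (k - s)).
  move=> k; apply: (@continuous_comp _ _ _ (fun k : 'rV[R]_3 => k - s) (ldist B)).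
    exact: continuous_addr.
  exact: continuous_ldist.
have pd s : lattice_periodic B (fun k => ldist B (k - s)).
  by move=> k l ll; rewrite addrAC (ldist_periodic uB _ ll).
have cS : compact (closed_cell B `&` S).
  apply: compact_closedI; first exact: compact_closed_cell.
  by apply: (@closed_comp _ _ E [set mu]) => [x _|]; [exact: cE|exact: closed_eq].
move: (cS); rewrite compact_cover => cover_S.
have [|s Ss|D SD cover] := cover_S _ S (fun s => [set k | ldist B (k - s) < e s]).
- move=> s Ss.
  apply: (@open_comp _ _ (fun k : 'rV[R]_3 => ldist B (k - s)) [set x | x < e s]) => [x _|]; first exact: cd.
  exact: open_lt.
- by exists s; [exact: Ss.2|rewrite /= subrr ldist0; have [] := he _ Ss.2].
pose b (s k : 'rV[R]_3) := ramp (e s - ldist B (k - s)).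
have cb s : continuous (b s).
  move=> k; apply: (@continuous_comp _ _ _ (fun k : 'rV[R]_3 => e s - ldist B (k - s)) ramp); last exact: continuous_ramp.
  by apply: continuous_forB; [exact: continuous_forcst|exact: cd].
have pb s : lattice_periodic B (b s) by move=> k l ll; rewrite /b pd.
pose q : seq 'rV[R]_3 := finmap.enum_fset D.
have qS s : s \in q -> S s by move=> /SD; rewrite inE.
pose sb (k : 'rV[R]_3) := \sum_(s <- q) b s k.
have csb : continuous sb by apply: continuous_sum.
have psb : lattice_periodic B sb by move=> k l ll; apply: eq_bigr => s _; rewrite pb.
have b0 s k : 0 <= b s k by exact: ramp_ge0.
have sb0 k : 0 <= sb k by exact: sumr_ge0.
have [||d d0 hd] := near_level_set uB (mu := mu) cE pE (P := [set k | 0 < sb k]).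
- by move=> k l ll; rewrite /= (lattice_periodicB _ psb ll).
- move=> k Ek; apply: (continuous_for_gt (@csb k)).
  have [l ll kl] := closed_cellP uB k.
  have Skl : (closed_cell B `&` S) (k - l).
    by split => //; rewrite /fermi_surface/= (lattice_periodicB _ pE ll).
  have [s Ds hs] := cover _ Skl. rewrite -(lattice_periodicB _ psb ll) /sb (big_rem s)//=.
  rewrite ltr_wpDr//; first exact: sumr_ge0.
  by apply: ramp_gt0; rewrite subr_gt0.
(* Where all bumps vanish, [|E k - mu|] is at least [d] and the added ramp is positive; where
   [|E k - mu| <= d / 2] the ramp is 0 and the quotients sum to 1. *)
pose den (k : 'rV[R]_3) := sb k + ramp (`|E k - mu| - d / 2).
have den_gt0 k : 0 < den k.
  have [kd|dk] := ltP `|E k - mu| d.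
    by rewrite ltr_wpDr ?ramp_ge0//; exact: hd.
  rewrite ltr_wpDl//; apply: ramp_gt0; rewrite subr_gt0; apply: lt_le_trans dk.
  by rewrite gtr_pMr// invf_lt1// ltr1n.
have cden : continuous den.
  move=> k; apply: continuous_forD; first exact: csb.
  apply: (@continuous_comp _ _ _ (fun k : 'rV[R]_3 => `|E k - mu| - d / 2) ramp); last exact: continuous_ramp.
  apply: continuous_forB; last exact: continuous_forcst.
  by apply: continuous_fornorm; apply: continuous_forB; [exact: cE|exact: continuous_forcst].
have cv s : continuous (fun k => b s k / den k).
  move=> k; apply: continuous_forM; first exact: cb.
  by apply: continuous_forV; [rewrite gt_eqF|exact: cden].
have pv s : lattice_periodic B (fun k => b s k / den k).
  by move=> k l ll; rewrite /den pb// psb// pE.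
exists q, (fun s k => b s k / den k), (d / 2); split; first by rewrite divr_gt0.
- by move=> s; split; [exact: cv|exact: pv].
- move=> s sq; split; first exact: qS.
  split; [exact: cv|exact: pv| |].
  + by move=> k; rewrite divr_ge0// ltW.
  + move=> k; rewrite mulf_eq0 negb_or => /andP[bk _].
    have kd : ldist B (k - s) < e s.
      rewrite ltNge; apply: contraNN bk => dk.
      by rewrite /b ramp0// subr_le0.
    have [_ /(_ _ kd)[l ll kl]] := he s (qS s sq); exists l => //.
    by rewrite addrAC.
- move=> k kd; rewrite -mulr_suml -/(sb k) /den ramp0 ?addr0 ?divff//.
    have : 0 < sb k by apply: hd; rewrite (lt_trans kd)// gtr_pMr// invf_lt1// ltr1n.
    by move=> /lt0r_neq0.
  by rewrite subr_le0 ltW.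
Qed.

End PartitionOfUnity.

Section AxisPoint.
Context {R : realType}.
Implicit Types (a j : 'I_3) (x : R * R) (v s : 'rV[R]_3) (t : R).

Definition base a v : R * R := (v 0 (lift a 0), v 0 (lift a 1)).

Lemma axis_point_axis a x t : axis_point a x t 0 a = t.
Proof. by rewrite mxE unlift_none. Qed.

Lemma axis_point_lift a x t (j : 'I_2) :
  axis_point a x t 0 (lift a j) = if j == 0 then x.1 else x.2.
Proof. by rewrite mxE liftK. Qed.

Lemma base_axis_point a x t : base a (axis_point a x t) = x.
Proof. by rewrite /base !axis_point_lift; case: x. Qed.

Lemma ord2P (P : 'I_2 -> Prop) : P 0 -> P 1 -> forall i, P i.
Proof.
by move=> P0 P1; case=> [[|[|//]] h]; [have -> : Ordinal h = 0 by exact: val_inj|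
  have -> : Ordinal h = 1 by exact: val_inj].
Qed.

Lemma liftP a (P : 'I_3 -> Prop) : P a -> P (lift a 0) -> P (lift a 1) -> forall j, P j.
Proof.
move=> Pa P0 P1 j; case: (unliftP a j) => [i ->|->//].
by move: i; apply: ord2P.
Qed.

Lemma axis_pointK a v : axis_point a (base a v) (v 0 a) = v.
Proof.
by apply/rowP; apply: (liftP (a := a)); rewrite ?axis_point_axis ?axis_point_lift.
Qed.

Lemma axis_point_line a x t u : axis_point a x (t + u) = axis_point a x t + u *: 'e_a.
Proof.
apply/rowP; apply: (liftP (a := a)).
- by rewrite [RHS]mxE !axis_point_axis !mxE !eqxx mulr1.
- by rewrite [RHS]mxE !axis_point_lift !mxE !eqxx [_ == a]eq_sym (negbTE (neq_lift _ _)) mulr0 addr0.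
- by rewrite [RHS]mxE !axis_point_lift !mxE !eqxx [_ == a]eq_sym (negbTE (neq_lift _ _)) mulr0 addr0.
Qed.

Lemma sum_lift a (V : nmodType) (F : 'I_3 -> V) :
  \sum_(j < 3) F j = F a + F (lift a 0) + F (lift a 1).
Proof.
rewrite (bigD1 a)//= -addrA; congr (_ + _).
rewrite (reindex_onto (lift a) (odflt 0 \o unlift a)) /=; last first.
  by move=> j ja; case: (unliftP a j) ja => [i ->|->]; rewrite ?eqxx//= liftK.
rewrite (eq_bigl xpredT) => [|j]; last by rewrite liftK/= eqxx eq_sym neq_lift.
by rewrite !big_ord_recl big_ord0 addr0; congr (_ + F (lift a _)); exact: val_inj.
Qed.

Lemma near_ord3 (T : Type) (F : set_system T) (FF : Filter F) (P : 'I_3 -> T -> Prop) :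
  (forall i, \forall v \near F, P i v) -> \forall v \near F, forall i, P i v.
Proof.
move=> hP; apply: filterS (filterI (filterI (hP 0) (hP 1)) (hP 2)) => v [[P0 P1] P2].
exact: ord3P.
Qed.

End AxisPoint.

(** * Boxes transverse to the surface *)

Section GoodBox.
Context {R : realType}.
Variable B : 'M[R]_3.
Hypothesis uB : B \in unitmx.
Variables (E : 'rV[R]_3 -> R) (mu : R).
Hypotheses (cE : continuous E) (pE : lattice_periodic B E).

Definition square (a : 'I_3) (s : 'rV[R]_3) (r : R) : set (R * R) :=
  [set x | `|x.1 - s 0 (lift a 0)| <= r /\ `|x.2 - s 0 (lift a 1)| <= r].

Definition box a s r r0 : set 'rV[R]_3 :=
  [set v | square a s r (base a v) /\ `|v 0 a - s 0 a| <= r0].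

(** On each segment of the box parallel to the axis [a], [E - mu] is strictly monotone in the
    direction [sg] and changes sign between the two ends, so the surface meets the segment exactly
    once. [gb_cell] keeps the lattice translates of the box disjoint, and [gb_bound] makes the root
    Lipschitz. *)
Record good_box a s r r0 c M sg : Prop := GoodBox {
  gb_r : 0 < r;
  gb_r0 : 0 < r0;
  gb_c : 0 < c;
  gb_sg : sg = 1 \/ sg = -1;
  gb_cell : forall v i, box a s r r0 v -> `|((v - s) *m invmx B) 0 i| < 4^-1;
  gb_reg : forall v, box a s r r0 v -> regular_point E v;
  gb_slope : forall v, box a s r r0 v -> c <= sg * pd a E v;
  gb_bound : forall v j, box a s r r0 v -> `|pd j E v| <= M;
  gb_lo : forall x, square a s r x -> sg * (E (axis_point a x (s 0 a - r0)) - mu) < 0;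
  gb_hi : forall x, square a s r x -> 0 < sg * (E (axis_point a x (s 0 a + r0)) - mu) }.

Lemma square_le a s r r' : r' <= r -> square a s r' `<=` square a s r.
Proof. by move=> rr x [h1 h2]; split; exact: le_trans rr. Qed.

Lemma good_box_le a s r r0 c M sg r' : good_box a s r r0 c M sg -> 0 < r' -> r' <= r ->
  good_box a s r' r0 c M sg.
Proof.
move=> [] ? ? ? ? h1 h2 h3 h4 h5 h6 r'0 rr; split => //.
- by move=> v i [/(square_le rr) ? ?]; exact: h1.
- by move=> v [/(square_le rr) ? ?]; exact: h2.
- by move=> v [/(square_le rr) ? ?]; exact: h3.
- by move=> v j [/(square_le rr) ? ?]; exact: h4.
- by move=> x /(square_le rr); exact: h5.
- by move=> x /(square_le rr); exact: h6.
Qed.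

Lemma box_dist a s r r0 e v : r < e -> r0 < e -> box a s r r0 v -> `|v - s| < e.
Proof.
move=> re r0e [[h1 h2] h3].
have e0 : 0 < e by apply: le_lt_trans re; apply: le_trans h1.
rewrite mx_norm_lt//; apply/forallP; apply: (liftP (a := a)); rewrite !mxE.
- exact: le_lt_trans h3 r0e.
- exact: le_lt_trans h1 re.
- exact: le_lt_trans h2 re.
Qed.

Lemma near_box (s : 'rV[R]_3) (P : set 'rV[R]_3) : (\forall v \near s, P v) ->
  exists2 e, 0 < e & forall v, `|v - s| < e -> P v.
Proof.
move=> /nbhs_ballP[e /= e0 he]; exists e => // v vs; apply: he.
by rewrite -ball_normE /= distrC.
Qed.

(** The length [r0] along the axis is chosen before the width [r]: the mean value theorem gives the
    signs of [E - mu] at the two points above and below [s], and continuity of [E] then extends them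
    to the top and bottom faces for small [r]. *)
Lemma exists_good_box a s e : regular_point E s -> (\forall k \near s, regular_point E k) ->
  E s = mu -> pd a E s != 0 -> 0 < e ->
  exists r r0 c M sg, [/\ r <= r0, r0 <= e & good_box a s r r0 c M sg].
Proof.
move=> rs nrs Es pds e0.
pose sg : R := if 0 < pd a E s then 1 else -1.
have sg1 : sg = 1 \/ sg = -1 by rewrite /sg; case: ifP; [left|right].
have sgp : 0 < sg * pd a E s.
  rewrite /sg; case: ifPn => [|]; first by rewrite mul1r.
  by rewrite -leNgt mulN1r oppr_gt0 lt_neqAle pds.
(* Half of the slope at [s], so that it remains a lower bound nearby. *)
pose c := sg * pd a E s / 2.
have c0 : 0 < c by rewrite divr_gt0.
have [M hM] : exists M, forall j, `|pd j E s| < M.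
  exists (\sum_(j < 3) `|pd j E s| + 1) => j; rewrite (bigD1 j)//= -addrA ltrDl.
  by rewrite ltr_wpDl// sumr_ge0.
have cpd j : {for s, continuous (pd j E)} by exact: rs.2.
have nslope : \forall v \near s, c < sg * pd a E v.
  apply: (@continuous_for_gt _ (fun v => sg * pd a E v)).
    by apply: continuous_forM; [exact: continuous_forcst|exact: cpd].
  by rewrite /c gtr_pMr// invf_lt1// ltr1n.
have nbound j : \forall v \near s, `|pd j E v| < M.
  by apply: (@continuous_for_lt _ (fun v => `|pd j E v|)); [exact/continuous_fornorm/cpd|].
have ncell i : \forall v \near s, `|((v - s) *m invmx B) 0 i| < 4^-1.
  apply: (@continuous_for_lt _ (fun v => `|((v - s) *m invmx B) 0 i|)).
    apply: continuous_fornorm.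
    apply: (@continuous_comp _ _ _ (fun v : 'rV[R]_3 => (v - s) *m invmx B) (fun v => v 0 i)).
      apply: (@continuous_comp _ _ _ (fun v : 'rV[R]_3 => v - s) (fun v => v *m invmx B)).
        exact: continuous_addr.
      exact: continuous_mulmx.
    exact: continuous_coord.
  by rewrite subrr mul0mx mxE normr0 invr_gt0.
have [p p0 hp] : exists2 p, 0 < p & forall v, `|v - s| < p ->
    [/\ regular_point E v, c < sg * pd a E v, forall j, `|pd j E v| < M &
        forall i, `|((v - s) *m invmx B) 0 i| < 4^-1].
  apply: near_box.
  apply: filterS (filterI (filterI nrs nslope) (filterI (near_ord3 _ nbound) (near_ord3 _ ncell))).
  by move=> v [[? ?] [? ?]].
pose r0 := Num.min (p / 2) e.
have r00 : 0 < r0 by rewrite lt_min e0 divr_gt0.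
have r0p : r0 < p by rewrite gt_min gtr_pMr// invf_lt1// ltr1n.
have ne : `|'e_a : 'rV[R]_3| <= 1.
  rewrite /Num.norm /= mx_normrE; apply: bigmax_le => //= -[i j] _ /=; rewrite mxE.
  by case: (_ && _); rewrite ?normr1 ?normr0.
have line t : `|t| <= r0 -> `|s + t *: 'e_a - s| < p.
  move=> tr; rewrite addrAC subrr add0r normrZ; apply: le_lt_trans r0p.
  by rewrite -[leRHS]mulr1; apply: ler_pM.
have hi : 0 < sg * (E (s + r0 *: 'e_a) - mu).
  have [t /andP[t0 tr]|t /andP[t0 tr] tE] := @MVT_line _ E s 'e_a r0 r00.
    have tn : `|t| <= r0 by rewrite ger0_norm.
    by apply: diff_derivable; have [[]] := hp _ (line t tn).
  have tn : `|t| <= r0 by rewrite gtr0_norm// ltW.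
  rewrite -Es tE mulrA mulr_gt0//; apply: lt_trans c0 _.
  by have [] := hp _ (line t tn).
have lo : sg * (E (s - r0 *: 'e_a) - mu) < 0.
  have shift t : s - r0 *: 'e_a + t *: 'e_a = s + (t - r0) *: 'e_a.
    by rewrite scalerBl -addrA; congr (s + _); rewrite addrC.
  have [t /andP[t0 tr]|t /andP[t0 tr]] := @MVT_line _ E (s - r0 *: 'e_a) 'e_a r0 r00.
    have tn : `|t - r0| <= r0 by rewrite ler0_norm ?subr_le0// opprB gerBl.
    by rewrite shift; apply: diff_derivable; have [[]] := hp _ (line (t - r0) tn).
  have tn : `|t - r0| <= r0 by rewrite ltr0_norm ?subr_lt0// opprB gerBl ltW.
  rewrite !shift subrr scale0r addr0 Es => tE; rewrite -opprB mulrN oppr_lt0 tE mulrA mulr_gt0//.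
  by apply: lt_trans c0 _; have [] := hp _ (line (t - r0) tn).
have cs t : continuous (fun v : 'rV[R]_3 => sg * (E (v + t *: 'e_a) - mu)).
  move=> v; apply: continuous_forM; first exact: continuous_forcst.
  apply: continuous_forB; last exact: continuous_forcst.
  apply: (@continuous_comp _ _ _ (fun v : 'rV[R]_3 => v + t *: 'e_a) E); first exact: continuous_addr.
  exact: cE.
have [q q0 hq] : exists2 q, 0 < q & forall v, `|v - s| < q ->
    0 < sg * (E (v + r0 *: 'e_a) - mu) /\ sg * (E (v + (- r0) *: 'e_a) - mu) < 0.
  rewrite -scaleNr in lo.
  exact: near_box (filterI (continuous_for_gt (@cs r0 s) hi) (continuous_for_lt (@cs (- r0) s) lo)).
pose r := Num.min (q / 2) r0.
have r_gt0 : 0 < r by rewrite lt_min r00 divr_gt0.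
have rq : r < q by rewrite gt_min gtr_pMr// invf_lt1// ltr1n.
have rr0 : r <= r0 by rewrite ge_min lexx orbT.
have rp : r < p by exact: le_lt_trans rr0 r0p.
have sq x : square a s r x -> `|axis_point a x (s 0 a) - s| < q.
  move=> sx; apply: (@box_dist a s r 0) => //; split; first by rewrite base_axis_point.
  by rewrite axis_point_axis subrr normr0.
exists r, r0, c, M, sg; split => //; first by rewrite ge_min lexx orbT.
split => //.
- by move=> v i /(box_dist rp r0p)/hp[].
- by move=> v /(box_dist rp r0p)/hp[].
- by move=> v /(box_dist rp r0p)/hp[_ /ltW].
- by move=> v j /(box_dist rp r0p)/hp[_ _ /(_ j)/ltW].
- by move=> x /sq/hq[_]; rewrite -axis_point_line.
- by move=> x /sq/hq[]; rewrite -axis_point_line.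
Qed.

Section InBox.
Variables (a : 'I_3) (s : 'rV[R]_3) (r r0 c M sg : R).
Hypothesis gb : good_box a s r r0 c M sg.

Lemma box_axis_point x t : box a s r r0 (axis_point a x t) <-> square a s r x /\ `|t - s 0 a| <= r0.
Proof. by rewrite /box /= base_axis_point axis_point_axis. Qed.

Lemma is_derive_axis_point x t : square a s r x -> `|t - s 0 a| <= r0 ->
  is_derive t 1 (fun t => E (axis_point a x t)) (pd a E (axis_point a x t)).
Proof.
move=> sx tr.
have line u : axis_point a x u = axis_point a x 0 + u *: 'e_a by rewrite -axis_point_line add0r.
have -> : (fun t => E (axis_point a x t)) = (fun t => E (axis_point a x 0 + t *: 'e_a)).
  by apply/funext => u; rewrite line.
have := @is_derive_line _ _ _ E (axis_point a x 0) 'e_a t; rewrite -line; apply; apply: diff_derivable.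
by have [] := gb_reg gb ((box_axis_point x t).2 (conj sx tr)).
Qed.

Lemma box_slope x t u : square a s r x -> `|t - s 0 a| <= r0 -> `|u - s 0 a| <= r0 ->
  c * `|u - t| <= `|E (axis_point a x u) - E (axis_point a x t)|.
Proof.
move=> sx; wlog tu : t u / t < u.
  move=> hw ht hu; have [tu|ut|->] := ltgtP t u; first exact: hw.
    by rewrite distrC [leRHS]distrC; exact: hw.
  by rewrite !subrr !normr0 mulr0.
move=> ht hu; have h0 : 0 < u - t by rewrite subr_gt0.
have inI w : 0 <= w <= u - t -> `|t + w - s 0 a| <= r0.
  by move=> /andP[w0 w1]; move: ht hu; rewrite !ler_norml => /andP[h1 h2] /andP[h3 h4]; apply/andP; split; lra.
have [w hw|w /andP[w0 w1]] := @MVT_line _ E (axis_point a x t) 'e_a (u - t) h0.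
  apply: diff_derivable; rewrite -axis_point_line.
  by have [] := gb_reg gb ((box_axis_point x (t + w)).2 (conj sx (inI _ hw))).
rewrite -!axis_point_line subrKC => ->.
rewrite normrM [`|u - t|]gtr0_norm// ler_wpM2r ?(ltW h0)//.
have hw : 0 <= w <= u - t by rewrite !ltW.
apply: le_trans (gb_slope gb ((box_axis_point x (t + w)).2 (conj sx (inI _ hw)))) _.
by apply: le_trans (ler_norm _) _; rewrite normrM; case: (gb_sg gb) => ->; rewrite ?normrN normr1 mul1r.
Qed.

Lemma root_unique x t u : square a s r x -> `|t - s 0 a| <= r0 -> `|u - s 0 a| <= r0 ->
  E (axis_point a x t) = mu -> E (axis_point a x u) = mu -> t = u.
Proof.
move=> sx ht hu Et Eu; have := box_slope sx ht hu.
rewrite Et Eu subrr normr0 pmulr_rle0 ?(gb_c gb)// normr_le0 subr_eq0 => /eqP; exact: esym.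
Qed.

Lemma root_exists x : square a s r x ->
  exists2 t, `|t - s 0 a| <= r0 & E (axis_point a x t) = mu.
Proof.
move=> sx; have r00 := gb_r0 gb.
have lr : s 0 a - r0 <= s 0 a + r0 by lra.
have ct : {within `[s 0 a - r0, s 0 a + r0], continuous (fun t => E (axis_point a x t))}.
  apply: continuous_in_subspaceT => t; rewrite inE/= in_itv/= => tI.
  have tr : `|t - s 0 a| <= r0 by rewrite ler_distl.
  have dt := is_derive_axis_point sx tr.
  by apply: differentiable_continuous; apply/derivable1_diffP; exact: ex_derive.
have [|t] := IVT lr ct (v := mu).
  have := gb_lo gb sx; have := gb_hi gb sx.
  rewrite ge_min le_max; case: (gb_sg gb) => ->; rewrite ?mul1r ?mulN1r => h1 h2.
    by apply/andP; split; apply/orP; [left|right]; lra.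
  by apply/andP; split; apply/orP; [right|left]; lra.
by rewrite in_itv/= => tI Et; exists t => //; rewrite ler_distl.
Qed.

End InBox.

End GoodBox.

Section AxisPointContinuity.
Context {R : realType}.

Lemma cvg_axis_point {T : Type} (F : set_system T) (FF : Filter F) a (x : T -> R * R) (t : T -> R) y u :
  x @ F --> y -> t @ F --> u -> (fun z => axis_point a (x z) (t z)) @ F --> axis_point a y u.
Proof.
move=> xy tu; apply: cvg_row3; apply: (liftP (a := a)).
- by under eq_fun do rewrite axis_point_axis; rewrite axis_point_axis.
- under eq_fun do rewrite axis_point_lift; rewrite axis_point_lift /=.
  by apply: (cvg_comp _ _ xy); exact: cvg_fst.
- under eq_fun do rewrite axis_point_lift; rewrite axis_point_lift /=.
  by apply: (cvg_comp _ _ xy); exact: cvg_snd.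
Qed.

Lemma continuous_axis_point_line a x : continuous (axis_point a x : R -> 'rV[R]_3).
Proof. by move=> t; apply: cvg_axis_point; [exact: cvg_cst|exact: cvg_id]. Qed.

End AxisPointContinuity.

Section LocalLimit.
Context {R : realType}.
Local Notation Rm := (measurableTypeR R).
Local Notation leb := (@lebesgue_measure R).
Variable B : 'M[R]_3.
Hypothesis uB : B \in unitmx.
Variables (E : 'rV[R]_3 -> R) (mu d : R).
Hypotheses (cE : continuous E) (pE : lattice_periodic B E).
Hypotheses (d0 : 0 < d) (regd : forall k, `|E k - mu| < d -> regular_point E k).

(** Both infinities are sent to 0, so the preimage of [Y] contains them exactly when [Y] contains
    0. *)
Lemma measurable_fine : measurable_fun setT (fine : \bar R -> Rm).
Proof.
move=> _ Y mY; rewrite setTI.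
have mE : measurable (EFin @` Y) by exact: measurable_image_EFin.
have [Y0|nY0] := pselect (Y 0).
  have -> : fine @^-1` Y = EFin @` Y `|` [set +oo%E] `|` [set -oo%E].
    apply/seteqP; split => [[x||]|x] /=; [by left; left; exists x|by left; right|by right|].
    by case=> [[[y ? <-]|->]|->].
  by apply: measurableU => //; exact: measurableU.
have -> : fine @^-1` Y = EFin @` Y.
  by apply/seteqP; split => [[x||]|x] //=; [by exists x|case=> y ? <-].
exact: mE.
Qed.

Lemma measurable_integral_fst (g : (Rm * Rm * Rm) -> R) (I : set Rm) :
  measurable_fun setT (g : _ -> Rm) -> measurable I ->
  measurable_fun setT (fun x : Rm * Rm => \int[leb]_(s in I) g (x, s) : Rm).
Proof.
move=> mg mI.
have mp : measurable_fun setT (fun t => (Num.max (g t) 0)%:E).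
  by apply/measurable_EFinP; apply: measurable_maxr.
have mn : measurable_fun setT (fun t => (Num.max (- g t) 0)%:E).
  by apply/measurable_EFinP; apply: measurable_maxr => //; exact: measurable_funN.
have p0 t : (0 <= (Num.max (g t) 0)%:E)%E by rewrite lee_fin le_max lexx orbT.
have n0 t : (0 <= (Num.max (- g t) 0)%:E)%E by rewrite lee_fin le_max lexx orbT.
have Ip := @measurable_integralX1 _ _ (Rm * Rm)%type Rm R leb I mI _ mp p0.
have In := @measurable_integralX1 _ _ (Rm * Rm)%type Rm R leb I mI _ mn n0.
have -> : (fun x : Rm * Rm => \int[leb]_(s in I) g (x, s)) =
    (fun x => fine (\int[leb]_(s in I) (Num.max (g (x, s)) 0)%:E -
                    \int[leb]_(s in I) (Num.max (- g (x, s)) 0)%:E)%E).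
  apply/funext => x; rewrite /Rintegral integralE; congr (fine (_ - _)%E).
    by apply: eq_integral => s _; rewrite funeposE EFin_max.
  by apply: eq_integral => s _; rewrite funenegE EFin_max.
by apply: (measurableT_comp measurable_fine); exact: emeasurable_funB.
Qed.

Lemma measurable_square a (s : 'rV[R]_3) r : measurable (square a s r : set (Rm * Rm)).
Proof.
have -> : square a s r = `[s 0 (lift a 0) - r, s 0 (lift a 0) + r] `*`
    `[s 0 (lift a 1) - r, s 0 (lift a 1) + r].
  by apply/seteqP; split => x /=; rewrite !in_itv/= -!ler_distl.
exact: measurableX.
Qed.

Lemma leb2_square_lty a (s : 'rV[R]_3) r : (leb2 (square a s r) < +oo)%E.
Proof.
have -> : square a s r = `[s 0 (lift a 0) - r, s 0 (lift a 0) + r] `*`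
    `[s 0 (lift a 1) - r, s 0 (lift a 1) + r].
  by apply/seteqP; split => x /=; rewrite !in_itv/= -!ler_distl.
have fI (u v : R) : (leb `[u, v]%classic < +oo)%E.
  by rewrite lebesgue_measure_itv/=; case: ifP => _; rewrite ?ltry// ltey.
rewrite /leb2 product_measure1E//; apply: lte_mul_pinfty; [exact: measure_ge0| |exact: fI].
by rewrite ge0_fin_numE; [exact: fI|exact: measure_ge0].
Qed.

Lemma compact_box a (s : 'rV[R]_3) r r0 : compact (box a s r r0).
Proof.
pose rj j := if j == a then r0 else r.
have := @rV_compact R 3 (fun j => `[s 0 j - rj j, s 0 j + rj j]%classic) (fun=> @segment_compact _ _ _).
congr compact; apply/seteqP; split => v.
  move=> h; have {}h j : `|v 0 j - s 0 j| <= rj j by have := h j; rewrite /= in_itv/= ler_distl.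
  have := h a; have := h (lift a 0); have := h (lift a 1).
  by rewrite /rj eqxx ![_ == a]eq_sym !(negbTE (neq_lift _ _)).
move=> [[h1 h2] h3]; apply: (liftP (a := a)); rewrite /= in_itv/= -ler_distl /rj ?eqxx//.
  by rewrite [_ == a]eq_sym (negbTE (neq_lift _ _)).
by rewrite [_ == a]eq_sym (negbTE (neq_lift _ _)).
Qed.

Lemma measurable_box a (s : 'rV[R]_3) r r0 :
  measurable [set t : Rm * Rm * Rm | box a s r r0 (rowt t)].
Proof.
have mj j e : measurable [set t : Rm * Rm * Rm | `|rowt t 0 j - s 0 j| <= e].
  have := @measurable_rowt_coord R j measurableT `[s 0 j - e, s 0 j + e]%classic (measurable_itv _).
  rewrite setTI; congr measurable; apply/seteqP; split => t /=; by rewrite in_itv/= ler_distl.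
have := measurableI _ _ (measurableI _ _ (mj (lift a 0) r) (mj (lift a 1) r)) (mj a r0).
by congr measurable; apply/seteqP; split => t.
Qed.

(* Continuous wherever the band is regular; may be junk elsewhere. *)
Definition tame (G : 'rV[R]_3 -> R) :=
  lattice_periodic B G /\ forall k, regular_point E k -> {for k, continuous G}.

Lemma tame_bump G n : n.+1%:R^-1 < d -> tame G ->
  continuous (fun k => level_bump mu n (E k) * G k) /\
  lattice_periodic B (fun k => level_bump mu n (E k) * G k).
Proof.
move=> nd [pG cG]; split; last by move=> k l ll; rewrite pE// pG.
by apply: (continuous_bump cE nd) => k /regd; exact: cG.
Qed.

Variables (a : 'I_3) (s : 'rV[R]_3) (r r0 c M sg : R).
Hypothesis gb : good_box B E mu a s r r0 c M sg.
Variable h : R * R -> R.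
Hypothesis hh : forall x, square a s r x ->
  `|h x - s 0 a| <= r0 /\ E (axis_point a x (h x)) = mu.
Variable G : 'rV[R]_3 -> R.
Hypotheses (tG : tame G)
  (GQ : forall k, G k != 0 -> exists2 l, lattice B l & box a s r r0 (k - l)).

Let lim x := G (axis_point a x (h x)) / (sg * pd a E (axis_point a x (h x))).

(** The torus integral is unfolded onto the box and integrated along the axis first. On each line
    the inner integrals converge to the value at the root over the slope, and a bound uniform in [n]
    lets the limit pass under the integral over the square. *)
Lemma local_limit :
  leb2.-integrable (square a s r : set (Rm * Rm)) (EFin \o lim) /\
  torus_int B (fun k => level_bump mu n (E k) * G k) @[n --> \oo] -->
  \int[leb2]_(x in square a s r) lim x.
Proof.
have r00 := gb_r0 gb; have c0 := gb_c gb.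
have [pG cG] := tG.
have regb k : box a s r r0 k -> regular_point E k by exact: gb_reg gb k.
(* [G] is controlled only where [E] is regular; the box is compact and consists of such points. *)
have [M' hM] : exists M', forall k, box a s r r0 k -> `|G k| <= M'.
  have sb : box a s r r0 s by rewrite /box /square/= !subrr normr0 !ltW// (gb_r gb).
  have cn : {within box a s r r0, continuous (fun k => `|G k|)}.
    apply: continuous_in_subspaceT => k; rewrite inE => kb.
    by apply: continuous_fornorm; apply: cG; exact: regb.
  have [k _ hk] := compact_EVT_max (ex_intro _ s sb) (@compact_box a s r r0) cn.
  by exists `|G k| => x xb; apply: hk; rewrite inE.
pose I : set Rm := `[s 0 a - r0, s 0 a + r0]%classic.
have mI : measurable I by exact: measurable_itv.
have Ifin : (leb I < +oo)%E.
  by rewrite /I lebesgue_measure_itv/=; case: ifP => _; rewrite ?ltry// ltey.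
have ab : s 0 a - r0 < s 0 a + r0 by lra.
have inI t : (s 0 a - r0 <= t <= s 0 a + r0) = (`|t - s 0 a| <= r0) by rewrite ler_distl.
pose J n x := \int[leb]_(t in I) (level_bump mu n (E (axis_point a x t)) * G (axis_point a x t)).
have apb x t : square a s r x -> s 0 a - r0 <= t <= s 0 a + r0 -> box a s r r0 (axis_point a x t).
  by move=> sx; rewrite inI => tI; exact/box_axis_point.
have dE x t : square a s r x -> s 0 a - r0 <= t <= s 0 a + r0 ->
    is_derive t 1 (fun t => E (axis_point a x t)) (pd a E (axis_point a x t)).
  by move=> sx; rewrite inI; exact: (is_derive_axis_point gb).
have cdE x t : square a s r x -> s 0 a - r0 <= t <= s 0 a + r0 ->
    {for t, continuous (fun t => pd a E (axis_point a x t))}.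
  move=> sx tI; apply: (@continuous_comp _ _ _ (axis_point a x) (pd a E)).
    exact: continuous_axis_point_line.
  by have [_] := regb _ (apb x t sx tI); apply.
have cGt x t : square a s r x -> s 0 a - r0 <= t <= s 0 a + r0 ->
    {for t, continuous (fun t => G (axis_point a x t))}.
  move=> sx tI; apply: (@continuous_comp _ _ _ (axis_point a x) G).
    exact: continuous_axis_point_line.
  exact: cG _ (regb _ (apb x t sx tI)).
have slope x t : square a s r x -> s 0 a - r0 <= t <= s 0 a + r0 ->
    c <= sg * pd a E (axis_point a x t).
  by move=> sx tI; exact: (gb_slope gb (apb x t sx tI)).
have Jcvg x : square a s r x -> J n x @[n --> \oo] --> lim x.
  move=> sx; have [hx Ehx] := hh sx.
  apply: (@level_bump_cvg _ (fun t => E (axis_point a x t)) (fun t => pd a E (axis_point a x t))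
    (fun t => G (axis_point a x t)) _ _ c mu sg (h x) ab c0 (gb_sg gb)) => //.
  - by move=> t; exact: dE.
  - by move=> t; exact: cdE.
  - by move=> t; exact: cGt.
  - by move=> t; exact: slope.
  - exact: (gb_lo gb).
  - exact: (gb_hi gb).
  - by rewrite inI.
have Jbound n x : square a s r x -> `|J n x| <= M' / c * 2.
  move=> sx; apply: (@level_bump_bound _ (fun t => E (axis_point a x t))
    (fun t => pd a E (axis_point a x t)) (fun t => G (axis_point a x t)) _ _ c M' mu sg n ab c0 (gb_sg gb)).
  - by move=> t; exact: dE.
  - by move=> t; exact: cdE.
  - by move=> t; exact: cGt.
  - by move=> t; exact: slope.
  - by move=> t tI; apply: hM; exact: apb.
(* The product of the bump and [G] is continuous once 1/(n+1) is below [d]; the sequence is shifted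
   by [N] to start there. *)
have [N _ hN] := near_infty_natSinv_lt (PosNum d0).
have nd n : (n + N).+1%:R^-1 < d by apply: hN; rewrite /= leq_addl.
have mJ n : measurable_fun (square a s r : set (Rm * Rm)) (J (n + N)%N : _ -> Rm).
  apply: measurable_funTS.
  apply: (@measurable_integral_fst (fun t => level_bump mu (n + N) (E (axis_point a t.1 t.2)) * G (axis_point a t.1 t.2))) => //.
  have [cb _] := tame_bump (nd n) tG.
  apply: (measurable_row_comp (measurable_rowt_continuous cb)) => i.
  under eq_fun do rewrite axis_pointE -!surjective_pairing.
  by apply: measurable_mulmx_coord => j; exact: measurable_rowt_coord.
have Jcvg' x : square a s r x -> J (n + N)%N x @[n --> \oo] --> lim x.
  by move=> sx; rewrite (cvg_shiftn N (fun n => J n x)); exact: Jcvg.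
have [li Jlim] := bounded_Rintegral_cvg (measurable_square a s r) (leb2_square_lty a s r) mJ
  (fun n x sx => Jbound (n + N)%N x sx) Jcvg'.
split; first exact: li.
rewrite -(cvg_shiftn N); apply: cvg_trans Jlim; apply: near_eq_cvg; near=> n.
have [cb pb] := tame_bump (nd n) tG.
have bb := bounded_measurable_integrable B (bounded_measurable_continuous uB cb pb).
have [Mb hMb] := periodic_bounded uB cb pb.
rewrite /= (@torus_integral_box _ B uB _ (box a s r r0) s _ pb (measurable_box a s r r0) (gb_cell gb))//.
- apply/esym; apply: (@Rintegral_axis_point _ (fun k => level_bump mu (n + N) (E k) * G k)
    (box a s r r0) a (square a s r) I Mb) => //.
  + exact: (measurable_rowt_continuous cb).
  + exact: measurable_square.
  + exact: leb2_square_lty.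
  + by move=> x t; rewrite box_axis_point /I /= in_itv/= ler_distl.
  + exact: measurable_box.
- exact: (measurable_rowt_continuous cb).
- by move=> k; rewrite mulf_eq0 negb_or => /andP[_ /GQ].
Unshelve. all: by end_near. Qed.

End LocalLimit.

(** * Graph patches of the Fermi surface *)

Section Curves.
Context {R : realType}.

Lemma is_derive_curve {V : normedModType R} (f : V -> R) (c : R -> V) (t : R) (w : V) :
  differentiable f (c t) -> is_derive t 1 c w ->
  is_derive t 1 (fun t => f (c t)) ('D_w f (c t)).
Proof.
move=> df dc.
have Dc : differentiable c t by apply/derivable1_diffP; exact: ex_derive.
apply: DeriveDef; first by apply/derivable1_diffP; exact: (differentiable_comp Dc df).
rewrite deriveE; last exact: (differentiable_comp Dc df).
have dcw : 'd c t (1 : R) = w by rewrite -deriveE//; exact: (@derive_val _ _ _ _ _ _ _ dc).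
rewrite [LHS](_ : _ = ('d f (c t) \o 'd c t) (1 : R)); last by rewrite -(diff_comp Dc df).
by rewrite /= dcw deriveE.
Qed.

Lemma is_derive_scale {V : normedModType R} (k : R -> R) (v : V) (t dk : R) :
  is_derive t 1 k dk -> is_derive t 1 (fun t => k t *: v) (dk *: v).
Proof.
move=> kt; have Dk : differentiable k t by apply/derivable1_diffP; exact: ex_derive.
apply: DeriveDef; first by apply/derivable1_diffP; exact: differentiableZl.
rewrite deriveE; last exact: differentiableZl.
by rewrite diffZl// -deriveE// (@derive_val _ _ _ _ _ _ _ kt).
Qed.

Lemma axis_point_sum a (x : R * R) t :
  axis_point a x t = x.1 *: 'e_(lift a 0) + x.2 *: 'e_(lift a 1) + t *: 'e_a.
Proof.
have E0 : (lift a 0 == lift a 1) = false by apply/negP => /eqP/lift_inj.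
apply/rowP; apply: (liftP (a := a)).
- by rewrite axis_point_axis !mxE !eqxx !(negbTE (neq_lift _ _)) !mulr0 !add0r mulr1.
- by rewrite axis_point_lift !mxE !eqxx E0 [_ == a]eq_sym (negbTE (neq_lift _ _)) !mulr0 !addr0 mulr1.
- by rewrite axis_point_lift !mxE !eqxx [lift a 1 == lift a 0]eq_sym E0 [_ == a]eq_sym (negbTE (neq_lift _ _)) !mulr0 !addr0 add0r mulr1.
Qed.

Lemma is_derive_graph a (h : R * R -> R) (x u : R * R) : differentiable h x ->
  is_derive (0 : R) 1 (fun t => axis_point a (x + t *: u) (h (x + t *: u)))
    (axis_point a u ('D_u h x)).
Proof.
move=> dh; have x0 : x + (0 : R) *: u = x by rewrite scale0r addr0.
have dl (f : R * R -> R) : differentiable f x ->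
    is_derive (0 : R) 1 (fun t => f (x + t *: u)) ('D_u f x).
  move=> df; have := @is_derive_line _ _ _ f x u 0; rewrite x0; apply; exact: diff_derivable.
have -> : (fun t => axis_point a (x + t *: u) (h (x + t *: u))) =
    (fun t : R => (x.1 + t * u.1) *: 'e_(lift a 0)) +
    (fun t : R => (x.2 + t * u.2) *: 'e_(lift a 1)) + (fun t => h (x + t *: u) *: 'e_a).
  by apply/funext => t; rewrite axis_point_sum.
have lin (y v : R) : is_derive (0 : R) 1 (fun t : R => y + t * v) v.
  have := is_deriveD (is_derive_cst y 0 (1 : R)) (is_deriveM (is_derive_id 0 (1:R)) (is_derive_cst v 0 (1:R))).
  by move=> /is_derive_eq; apply; rewrite /GRing.scale/= mulr0 mulr1 !add0r.
rewrite axis_point_sum.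
have d1 := is_derive_scale ('e_(lift a 0) : 'rV[R]_3) (lin x.1 u.1).
have d2 := is_derive_scale ('e_(lift a 1) : 'rV[R]_3) (lin x.2 u.2).
have d3 := is_derive_scale ('e_a : 'rV[R]_3) (dl h dh).
exact: (is_deriveD (is_deriveD d1 d2) d3).
Qed.

End Curves.

Section PatchGeometry.
Context {R : realType}.
Local Notation Rm := (measurableTypeR R).
Variable B : 'M[R]_3.
Variables (E : 'rV[R]_3 -> R) (mu : R).
Hypothesis regS : forall k, E k = mu -> regular_point E k.
Hypothesis gradS : forall k, E k = mu -> gradient E k != 0.
Local Notation S := (fermi_surface E mu).
Variable p : @graph_patch R.
Hypothesis pp : patch_of B S p.
Local Notation a := (axis p).

Lemma graph_pointE x : graph_point p x = axis_point a x (height p x). Proof. by []. Qed.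

Lemma open_patch_dom : open (patch_dom p).
Proof.
have -> : patch_dom p = fst @^-1` `](corner0 p).1, (corner1 p).1[ `&`
    snd @^-1` `](corner0 p).2, (corner1 p).2[ by apply/seteqP; split => x.
by apply: openI; apply: open_comp => [x _|]; [exact: cvg_fst|exact: interval_open|
  exact: cvg_snd|exact: interval_open].
Qed.

Lemma measurable_patch_dom : measurable (patch_dom p : set (Rm * Rm)).
Proof. exact: measurableX. Qed.

Lemma graph_on_surface x : patch_dom p x -> E (graph_point p x) = mu.
Proof. by have [_ h _ _ _] := pp; exact: h. Qed.

Lemma continuous_height x : patch_dom p x -> {for x, continuous (height p)}.
Proof. by have [h _ _ _ _] := pp; move=> /h[/differentiable_continuous]. Qed.

Lemma continuous_graph_point x : patch_dom p x -> {for x, continuous (graph_point p)}.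
Proof.
by move=> px; apply: cvg_axis_point; [exact: cvg_id|exact: continuous_height].
Qed.

(** [E] is constant along the curve on the graph above the segment [x + t *: u], so its derivative
    in the tangent direction is 0. *)
Lemma patch_tangent x u : patch_dom p x ->
  'D_u (height p) x * pd a E (graph_point p x) + u.1 * pd (lift a 0) E (graph_point p x)
  + u.2 * pd (lift a 1) E (graph_point p x) = 0.
Proof.
move=> px; have Ex := graph_on_surface px; have [dE _] := regS Ex.
have [/(_ x px)[dh _ _] _ _ _ _] := pp.
have dc := is_derive_graph a u dh.
pose c t := axis_point a (x + t *: u) (height p (x + t *: u)).
have c0 : c 0 = graph_point p x by rewrite /c scale0r addr0.
have := @is_derive_curve _ _ E c 0 _ _ dc; rewrite c0 => /(_ dE) dEc.
have near_mu : \forall t \near (0:R), E (c t) = mu.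
  have cl : {for (0:R), continuous (fun t : R => x + t *: u)}.
    by apply: cvgD; [exact: cvg_cst|apply: cvgZr_tmp; exact: cvg_id].
  have : nbhs (x + (0:R) *: u) (patch_dom p).
    by rewrite scale0r addr0; exact: (open_nbhs_nbhs (conj open_patch_dom px)).
  move=> hx; have hn : \forall t \near (0:R), patch_dom p (x + t *: u) by exact: (cl _ hx).
  by apply: filterS hn => t /graph_on_surface.
have : 'D_1 (fun t => E (c t)) (0:R) = 0.
  by rewrite (near_eq_derive (g := cst mu) _ near_mu) derive_cst.
rewrite (@derive_val _ _ _ _ _ _ _ dEc) deriveE_pd// (sum_lift a).
by rewrite axis_point_axis !axis_point_lift.
Qed.

Lemma patch_slope0 x : patch_dom p x ->
  pd (lift a 0) E (graph_point p x) = - (height1 p x * pd a E (graph_point p x)).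
Proof. by move=> px; have := patch_tangent (1, 0) px; rewrite mul1r mul0r addr0 addrC => /eqP; rewrite addr_eq0 => /eqP. Qed.

Lemma patch_slope1 x : patch_dom p x ->
  pd (lift a 1) E (graph_point p x) = - (height2 p x * pd a E (graph_point p x)).
Proof. by move=> px; have := patch_tangent (0, 1) px; rewrite mul1r mul0r addr0 addrC => /eqP; rewrite addr_eq0 => /eqP. Qed.

(** If the derivative along the axis vanished, tangency would make the other two vanish, against the
    regularity of the surface. A patch of any atlas is thus transverse to its own axis, which allows
    a good box along that axis. *)
Lemma patch_transverse x : patch_dom p x -> pd a E (graph_point p x) != 0.
Proof.
move=> px; apply: contraNN (gradS (graph_on_surface px)) => /eqP pa0.
apply/eqP/rowP; apply: (liftP (a := a)); rewrite !mxE//.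
  by rewrite patch_slope0// pa0 mulr0 oppr0.
by rewrite patch_slope1// pa0 mulr0 oppr0.
Qed.

Lemma flux_area W l x : patch_dom p x ->
  cross (fermi_normal E (graph_point p x)) (W (graph_point p x)) 0 l * area_element p x =
  flux E W l (graph_point p x) / `|pd a E (graph_point p x)|.
Proof.
move=> px; set k := graph_point p x.
have cs (c : R) (u v : 'rV[R]_3) : cross (c *: u) v 0 l = c * cross u v 0 l.
  rewrite !mxE mulr_sumr; apply: eq_bigr => i _; rewrite mulr_sumr; apply: eq_bigr => j _.
  by rewrite mxE; ring.
rewrite /fermi_normal cs -/(flux E W l k).
(* By tangency the gradient is [pd a E k] times the vector with entry 1 along the axis and entries
   [- height1] and [- height2] across it. *)
have -> : dot (gradient E k) (gradient E k) =
    pd a E k ^+ 2 * (1 + height1 p x ^+ 2 + height2 p x ^+ 2).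
  rewrite /dot (sum_lift a) !mxE patch_slope0// patch_slope1// -/k; ring.
rewrite sqrtrM ?sqr_ge0// sqrtr_sqr -/(area_element p x).
have A0 : area_element p x != 0.
  by rewrite sqrtr_eq0 -ltNge -addrA ltr_pwDl// addr_ge0// sqr_ge0.
have p0 : `|pd a E k| != 0 by rewrite normr_eq0; exact: patch_transverse.
by field; rewrite A0 p0.
Qed.

End PatchGeometry.

Section RealIntegral.
Context d (T : measurableType d) (R : realType) (m : {measure set T -> \bar R}).

Lemma Rintegral0 (D : set T) (f : T -> R) : (forall x, D x -> f x = 0) -> \int[m]_(x in D) f x = 0.
Proof. by move=> f0; rewrite /Rintegral integral0_eq// => x Dx; rewrite f0. Qed.

Lemma Rintegral_sum_seq (I : eqType) (q : seq I) (D : set T) (f : I -> T -> R) : measurable D ->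
  (forall i, i \in q -> m.-integrable D (EFin \o f i)) ->
  \int[m]_(x in D) (\sum_(i <- q) f i x) = \sum_(i <- q) \int[m]_(x in D) f i x.
Proof.
move=> mD; elim: q => [|i q IH] fi.
  by rewrite big_nil Rintegral0// => x _; rewrite big_nil.
have fq j : j \in q -> m.-integrable D (EFin \o f j) by move=> jq; apply: fi; rewrite in_cons jq orbT.
rewrite big_cons -IH//; under eq_Rintegral do rewrite big_cons.
apply: RintegralD => //; first by apply: fi; rewrite mem_head.
have -> : EFin \o (fun x => \sum_(j <- q) f j x) = (fun x => \sum_(j <- q) (f j x)%:E)%E.
  by apply/funext => x; rewrite /= sumEFin.
rewrite [X in m.-integrable D X](_ : _ = (fun x => \sum_(j <- q | j \in q) (f j x)%:E)%E).
  by apply: integrable_sum => // j jq; exact: fq.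
by apply/funext => x; rewrite big_seq.
Qed.

End RealIntegral.

(** * Atlas integrals as limits of volume integrals *)

Section SurfaceValue.
Context {R : realType}.
Local Notation Rm := (measurableTypeR R).
Variable B : 'M[R]_3.
Hypothesis uB : B \in unitmx.
Variables (E : 'rV[R]_3 -> R) (mu d : R).
Hypotheses (cE : continuous E) (pE : lattice_periodic B E).
Hypotheses (d0 : 0 < d) (regd : forall k, `|E k - mu| < d -> regular_point E k).
Hypothesis gradS : forall k, E k = mu -> gradient E k != 0.
Local Notation S := (fermi_surface E mu).
(** As [n] grows this approximates the integral of [G / |grad E|] over the surface, as in the coarea
    formula. *)
Definition level_int (G : 'rV[R]_3 -> R) (n : nat) : R :=
  torus_int B (fun k => level_bump mu n (E k) * G k).

Lemma regular_on_surface k : E k = mu -> regular_point E k.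
Proof. by move=> Ek; apply: regd; rewrite Ek subrr normr0. Qed.

Lemma regular_near_surface s : E s = mu -> \forall k \near s, regular_point E k.
Proof.
move=> Es; have cdist : {for s, continuous (fun k => `|E k - mu|)}.
  by apply: continuous_fornorm; apply: continuous_forB; [exact: cE|exact: continuous_forcst].
have : \forall k \near s, `|E k - mu| < d by apply: (continuous_for_lt cdist); rewrite Es subrr normr0.
by apply: filterS => k; exact: regd.
Qed.

Lemma exists_transverse_axis s : E s = mu -> exists a, pd a E s != 0.
Proof.
move=> Es; apply: contrapT => h; have := gradS Es => /negP; apply.
apply/eqP/rowP => i; rewrite !mxE; apply/eqP/negPn/negP => pi; apply: h; by exists i.
Qed.

Lemma tameM G v : tame B E G -> continuous v -> lattice_periodic B v ->
  tame B E (fun k => G k * v k).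
Proof.
move=> [pG cG] cv pv; split; first by move=> k l ll; rewrite pG// pv.
by move=> k rk; apply: continuous_forM; [exact: cG|exact: cv].
Qed.

Lemma tame_integrable G n : n.+1%:R^-1 < d -> tame B E G ->
  torus_integrable B (fun k => level_bump mu n (E k) * G k).
Proof.
move=> nd tG; have [cb pb] := tame_bump cE pE regd nd tG.
exact: bounded_measurable_integrable (bounded_measurable_continuous uB cb pb).
Qed.

Lemma near_small (e : R) : 0 < e -> \forall n \near \oo, n.+1%:R^-1 < e.
Proof. by move=> e0; exact: (near_infty_natSinv_lt (PosNum e0)). Qed.

(** The bump is supported in [mu < E < mu + 1/(n+1)], so for large [n] only the values of the
    density close to the surface count. *)
Lemma level_limit_eq (G G' : 'rV[R]_3 -> R) (L e : R) : 0 < e ->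
  (forall k, `|E k - mu| < e -> G k = G' k) -> level_int G @ \oo --> L -> level_int G' @ \oo --> L.
Proof.
move=> e0 GG; apply: cvg_trans; apply: near_eq_cvg; near=> n.
congr torus_int; apply/funext => k.
have [->|bn] := eqVneq (level_bump mu n (E k)) 0; first by rewrite !mul0r.
rewrite GG//; have /andP[h1 h2] := level_bump_supp bn.
rewrite gtr0_norm ?subr_gt0// ltrBlDl; apply: lt_trans h2 _; rewrite ltrD2l.
near: n; exact: near_small.
Unshelve. all: by end_near. Qed.

Lemma level_limit_sum (I : eqType) (q : seq I) (G : I -> 'rV[R]_3 -> R) (L : I -> R) :
  (forall i, tame B E (G i)) -> (forall i, i \in q -> level_int (G i) @ \oo --> L i) ->
  level_int (fun k => \sum_(i <- q) G i k) @ \oo --> \sum_(i <- q) L i.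
Proof.
move=> tG hL.
have sums : \sum_(i <- q) level_int (G i) n @[n --> \oo] --> \sum_(i <- q) L i.
  elim: q hL => [|i q IH] hL.
    by rewrite big_nil; under eq_fun do rewrite big_nil; exact: cvg_cst.
  rewrite big_cons; under eq_fun do rewrite big_cons; apply: cvgD.
    by apply: hL; rewrite mem_head.
  by apply: IH => j jq; apply: hL; rewrite in_cons jq orbT.
apply: cvg_trans sums; apply: near_eq_cvg; near=> n.
have nd : n.+1%:R^-1 < d by near: n; exact: near_small.
rewrite -torus_int_sum; last by move=> i; exact: tame_integrable.
by congr torus_int; apply/funext => k; rewrite mulr_sumr.
Unshelve. all: by end_near. Qed.

Lemma level_localize (G : 'rV[R]_3 -> R) (q : seq 'rV[R]_3) (v : 'rV[R]_3 -> 'rV[R]_3 -> R) (e : R) (L : 'rV[R]_3 -> R) : 0 < e ->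
  (forall s, continuous (v s) /\ lattice_periodic B (v s)) ->
  (forall k, `|E k - mu| < e -> \sum_(s <- q) v s k = 1) ->
  tame B E G -> (forall s, s \in q -> level_int (fun k => G k * v s k) @ \oo --> L s) ->
  level_int G @ \oo --> \sum_(s <- q) L s.
Proof.
move=> e0 hv v1 tG hL.
apply: (@level_limit_eq (fun k => \sum_(s <- q) G k * v s k) G _ e) => //.
  by move=> k ke; rewrite -mulr_sumr v1// mulr1.
by apply: level_limit_sum => // s; have [? ?] := hv s; exact: tameM.
Qed.

Lemma ball_box a (s : 'rV[R]_3) r r0 k : r <= r0 -> `|k - s| < r -> box a s r r0 k.
Proof.
move=> rr ks; have r_gt0 : 0 < r by apply: le_lt_trans ks.
move: ks; rewrite mx_norm_lt// => /forallP ks.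
have {}ks j : `|k 0 j - s 0 j| < r by have := ks j; rewrite !mxE.
by split; [split; exact/ltW/ks|apply: le_trans rr; exact/ltW/ks].
Qed.

(** The density is zero on the surface only, while the bumps sit beside it, so a limit has to be
    taken: in each good box it is an integral of values at the roots, all equal to 0. *)
Lemma level_limit_zero G : tame B E G -> (forall k, E k = mu -> G k = 0) -> level_int G @ \oo --> (0 : R).
Proof.
move=> tG G0.
have /choice[r hr] : forall s, exists r, S s -> 0 < r /\
    exists a r0 c M sg, r <= r0 /\ good_box B E mu a s r r0 c M sg.
  move=> s; have [Es|nS] := pselect (S s); last by exists 0.
  have [a pa] := exists_transverse_axis Es.
  have [r [r0 [c [M [sg [rr _ gb]]]]]] :=
    exists_good_box B cE (regular_on_surface Es) (regular_near_surface Es) Es pa ltr01.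
  by exists r => _; split; [exact: gb_r gb|exists a, r0, c, M, sg].
have [q [v [e [e0 hv hq v1]]]] := partition_of_unity uB cE pE (fun s Ss => (hr s Ss).1).
have -> : 0 = \sum_(s <- q) (0 : R) by rewrite big1.
apply: (level_localize e0 hv v1 tG) => s /hq[Ss [cv pv _ vs]].
have [_ [a [r0 [c [M [sg [rr gb]]]]]]] := hr s Ss.
have /choice[h hh] : forall x, exists t, square a s (r s) x ->
    `|t - s 0 a| <= r0 /\ E (axis_point a x t) = mu.
  move=> x; have [sx|] := pselect (square a s (r s) x); last by exists 0.
  by have [t ? ?] := root_exists gb sx; exists t.
have tGv := tameM tG cv pv.
have [|_] := local_limit uB cE pE d0 regd gb hh tGv.
  move=> k; rewrite mulf_eq0 negb_or => /andP[_ /vs[l ll kl]]; exists l => //.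
  exact: ball_box.
rewrite Rintegral0// => x sx; have [_ Ehx] := hh x sx.
by rewrite G0// !mul0r.
Qed.

Lemma near_pair (x0 : R * R) (P : set (R * R)) : nbhs x0 P ->
  exists2 e, 0 < e & forall x, `|x.1 - x0.1| < e -> `|x.2 - x0.2| < e -> P x.
Proof.
move=> [[A A'] [/= /nbhs_ballP[e1 /= e10 h1] /nbhs_ballP[e2 /= e20 h2]] AP].
exists (Num.min e1 e2); first by rewrite lt_min e10.
move=> x; rewrite !lt_min => /andP[x1 _] /andP[_ x2]; apply: AP; split.
  by apply: h1; rewrite -ball_normE /= distrC.
by apply: h2; rewrite -ball_normE /= distrC.
Qed.

Section OnePatch.
Variable p : @graph_patch R.
Hypothesis pp : patch_of B S p.
Local Notation a := (axis p).
Variables (W : 'rV[R]_3 -> 'rV[R]_3) (l : 'I_3).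
Hypotheses (cW : C1_field W) (pW : lattice_periodic B W).

(** The factor [v] stands for one piece of the auxiliary partition of unity that cuts the patch into
    boxes. *)
Definition patch_integrand (v : 'rV[R]_3 -> R) (x : R * R) : R :=
  weight p (graph_point p x) * v (graph_point p x) *
  cross (fermi_normal E (graph_point p x)) (W (graph_point p x)) 0 l * area_element p x.

Definition patch_density (v : 'rV[R]_3 -> R) (k : 'rV[R]_3) : R := flux E W l k * weight p k * v k.

Lemma tame_flux : tame B E (flux E W l).
Proof.
split; first exact: flux_periodic.
by move=> k rk; exact: continuous_flux.
Qed.

Lemma tame_patch_density v : continuous v -> lattice_periodic B v -> tame B E (patch_density v).
Proof.
have [_ _ _ [cw pw _] _] := pp.
by move=> cv pv; apply: tameM => //; apply: tameM => //; exact: tame_flux.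
Qed.

Lemma patch_integrandE v x : patch_dom p x -> patch_integrand v x =
  patch_density v (graph_point p x) / `|pd a E (graph_point p x)|.
Proof.
move=> px; have := flux_area regular_on_surface gradS pp W l px => FA.
by rewrite /patch_integrand -mulrA FA /patch_density; ring.
Qed.

(* Away from the compact support of the weight the density vanishes on the surface. *)
Lemma patch_limit_far s : E s = mu ->
  ~ (exists2 x, patch_dom p x & lattice B (s - graph_point p x)) ->
  exists2 r, 0 < r & forall v, near_lattice_point B s r v ->
    leb2.-integrable (patch_dom p : set (Rm * Rm)) (EFin \o patch_integrand v) /\
    level_int (patch_density v) @ \oo --> \int[leb2]_(x in patch_dom p) patch_integrand v x.
Proof.
move=> Es nx; have [_ Sp _ _ [K [cK Kp Kw]]] := pp.
have cld : {within K, continuous (fun x => ldist B (s - graph_point p x))}.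
  apply: continuous_in_subspaceT => x; rewrite inE => Kx.
  apply: (@continuous_comp _ _ _ (graph_point p) (fun k : 'rV[R]_3 => ldist B (s - k))).
    exact: (continuous_graph_point pp (Kp x Kx)).
  apply: (@continuous_comp _ _ _ (fun k : 'rV[R]_3 => s - k) (ldist B)); last exact: continuous_ldist.
  by apply: (@continuousB _ _ _ (fun=> s) id); [exact: cst_continuous|].
have [e e0 he] : exists2 e, 0 < e & forall x, K x -> e <= ldist B (s - graph_point p x).
  have [->|/set0P K0] := eqVneq K set0; first by exists 1.
  have [x0 Kx0 hx0] := compact_EVT_min K0 cK cld; rewrite inE in Kx0.
  exists (ldist B (s - graph_point p x0)); last by move=> x Kx; apply: hx0; rewrite inE.
  rewrite lt_def ldist_ge0 andbT; apply/eqP => /(ldist_eq0 uB) ll.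
  by apply: nx; exists x0 => //; exact: Kp.
have cl : {for s, continuous (fun k : 'rV[R]_3 => ldist B (s - k))}.
  apply: (@continuous_comp _ _ _ (fun k : 'rV[R]_3 => s - k) (ldist B)); last exact: continuous_ldist.
  by apply: (@continuousB _ _ _ (fun=> s) id); [exact: cst_continuous|].
have [r r0 hr] : exists2 r, 0 < r & forall k, `|k - s| < r -> ldist B (s - k) < e.
  by apply: near_box; apply: (continuous_for_lt cl); rewrite subrr ldist0.
exists r => // v [cv pv _ vs].
have dens0 k : E k = mu -> patch_density v k = 0.
  move=> Ek; rewrite /patch_density; have [->|vk] := eqVneq (v k) 0; first by rewrite mulr0.
  have [->|wk] := eqVneq (weight p k) 0; first by rewrite mulr0 mul0r.
  have [q lq kq] := vs k vk; have [x Kx lx] := Kw k Ek wk.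
  have := he x Kx; rewrite leNgt.
  have -> : s - graph_point p x = s - (k - q) + ((k - graph_point p x) - q).
    by apply/rowP => i; rewrite !mxE; ring.
  by rewrite (ldist_periodic uB _ (latticeB lx lq)) hr.
have int0 x : patch_dom p x -> patch_integrand v x = 0.
  by move=> px; rewrite patch_integrandE// dens0 ?mul0r//; exact: Sp.
split.
  apply: (@eq_integrable _ _ _ leb2 _ (measurable_patch_dom p) (cst 0%E)); last exact: integrable0.
  by move=> x; rewrite inE => px; rewrite /= int0.
rewrite Rintegral0//; apply: level_limit_zero => //; exact: tame_patch_density.
Qed.

(** A good box is taken around the graph point [s0] that [s] repeats modulo the lattice, along the
    axis of the patch. By uniqueness of the root the surface inside the box is the graph of
    [height p], so the integrand on the patch and the limit density on the square, both extended by
    0, are the same function. *)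
Lemma patch_limit_close s : E s = mu ->
  (exists2 x, patch_dom p x & lattice B (s - graph_point p x)) ->
  exists2 r, 0 < r & forall v, near_lattice_point B s r v ->
    leb2.-integrable (patch_dom p : set (Rm * Rm)) (EFin \o patch_integrand v) /\
    level_int (patch_density v) @ \oo --> \int[leb2]_(x in patch_dom p) patch_integrand v x.
Proof.
move=> Es [x0 px0 l0]; have [_ Sp inj _ _] := pp.
pose s0 := graph_point p x0; have Es0 : E s0 = mu by exact: Sp.
have pa := patch_transverse regular_on_surface gradS pp px0.
have [r [r0 [c [M [sg [rr _ gb]]]]]] :=
  exists_good_box B cE (regular_on_surface Es0) (regular_near_surface Es0) Es0 pa ltr01.
have s0a : s0 0 a = height p x0 by rewrite /s0 graph_pointE axis_point_axis.
have [e e0 he] : exists2 e, 0 < e & forall x, `|x.1 - x0.1| < e -> `|x.2 - x0.2| < e ->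
    patch_dom p x /\ `|height p x - s0 0 a| < r0.
  have n1 : nbhs x0 (patch_dom p) by apply: open_nbhs_nbhs; split => //; exact: open_patch_dom.
  have n2 : \forall x \near x0, `|height p x - s0 0 a| < r0.
    have /cvgrPdist_lt/(_ _ (gb_r0 gb)) := continuous_height pp px0.
    by apply: filterS => x; rewrite distrC s0a.
  have [e e0 he] := near_pair (filterI n1 n2).
  by exists e => // x h1 h2; exact: he.
pose r1 := Num.min r (e / 2).
have r10 : 0 < r1 by rewrite lt_min (gb_r gb) divr_gt0.
have r1r : r1 <= r by rewrite ge_min lexx.
have r1e : r1 < e by rewrite gt_min orbC gtr_pMr// invf_lt1// ltr1n.
have gb1 := good_box_le gb r10 r1r.
have hsq x : square a s0 r1 x -> patch_dom p x /\ `|height p x - s0 0 a| <= r0.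
  rewrite /square /= /s0 graph_pointE !axis_point_lift => -[/le_lt_trans h1 /le_lt_trans h2].
  by have [? /ltW ?] := he x (h1 _ r1e) (h2 _ r1e).
exists r1 => // v [cv pv v0 vs].
have vs0 k : v k != 0 -> exists2 q, lattice B q & box a s0 r1 r0 (k - q).
  move=> /vs[q lq kq]; exists (q + (s - s0)); first exact: latticeD.
  apply: (ball_box _ (le_trans r1r rr)).
  by rewrite (_ : _ - s0 = k - q - s)//; apply/rowP => i; rewrite !mxE; ring.
have tG := tame_patch_density cv pv.
have hh x : square a s0 r1 x ->
    `|height p x - s0 0 a| <= r0 /\ E (axis_point a x (height p x)) = mu.
  by move=> sx; have [px ?] := hsq x sx; split => //; exact: Sp.
have [|li Llim] := local_limit uB cE pE d0 regd gb1 hh tG.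
  by move=> k; rewrite mulf_eq0 negb_or => /andP[_ /vs0].
have patch_eq : patch_integrand v \_ (patch_dom p) =
    (fun x => patch_density v (axis_point a x (height p x)) /
              (sg * pd a E (axis_point a x (height p x)))) \_ (square a s0 r1).
  apply/funext => x; rewrite !patchE; case: ifPn => px; case: ifPn => sx //.
  - rewrite inE in px; rewrite patch_integrandE//; congr (_ / _).
    rewrite inE in sx; have [_ hx] := hsq x sx.
    have bx := (box_axis_point a s0 r1 r0 x (height p x)).2 (conj sx hx).
    have := lt_le_trans (gb_c gb1) (gb_slope gb1 bx); rewrite graph_pointE => /gtr0_norm <-.
    by rewrite normrM; case: (gb_sg gb1) => ->; rewrite ?normrN normr1 mul1r.
  - rewrite inE in px; rewrite patch_integrandE// /patch_density.
    (* Otherwise a lattice translate of this point lies in the box. As the unique root there, it is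
       the graph point over some [y] in the square, and injectivity of the patch modulo the lattice
       gives [y = x], which is outside the square. *)
    suff -> : v (graph_point p x) = 0 by rewrite mulr0 mul0r.
    apply/eqP/negPn/negP => /vs0[q lq bq]; move: sx; rewrite notin_setE; apply.
    have [sy hy] := bq; set y := base a (graph_point p x - q) in sy.
    have [py hy'] := hsq y sy.
    have Eq : E (graph_point p x - q) = mu by rewrite (lattice_periodicB _ pE lq); exact: Sp.
    have gy : graph_point p x - q = graph_point p y.
      rewrite graph_pointE -[LHS](axis_pointK a) -/y; congr (axis_point a y _).
      apply: (root_unique gb1 sy hy hy'); last exact: Sp.
      by rewrite /y axis_pointK.
    suff <- : y = x by [].
    by apply: inj => //; rewrite -gy addrAC subrr sub0r; exact: latticeN.
  - by rewrite inE in sx; have [] := hsq x sx; move: px; rewrite notin_setE.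
have ms := @measurable_square R a s0 r1.
have mp := measurable_patch_dom p.
have Epatch (D : set (Rm * Rm)) (f : R * R -> R) : (EFin \o f) \_ D = EFin \o (f \_ D).
  by apply/funext => x; rewrite /= !patchE; case: ifP.
split.
  apply/(integrable_mkcond _ mp); rewrite Epatch patch_eq -Epatch.
  exact/(integrable_mkcond _ ms).
by rewrite Rintegral_mkcond patch_eq -Rintegral_mkcond.
Qed.

(** Every surface point has a radius for which the claim holds for densities supported near it,
    whether or not the patch passes through it. A partition of unity with these radii adds the
    pieces up on both sides. *)
Lemma patch_limit : level_int (patch_density (fun=> 1)) @ \oo -->
  \int[leb2]_(x in patch_dom p)
    (weight p (graph_point p x) *
     cross (fermi_normal E (graph_point p x)) (W (graph_point p x)) 0 l * area_element p x).
Proof.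
have [_ Sp _ _ _] := pp.
have /choice[r hr] : forall s, exists r, E s = mu -> 0 < r /\ forall v, near_lattice_point B s r v ->
    leb2.-integrable (patch_dom p : set (Rm * Rm)) (EFin \o patch_integrand v) /\
    level_int (patch_density v) @ \oo --> \int[leb2]_(x in patch_dom p) patch_integrand v x.
  move=> s; have [Es|] := pselect (E s = mu); last by exists 0.
  have [cl|fa] := pselect (exists2 x, patch_dom p x & lattice B (s - graph_point p x)).
    by have [r r0 h] := patch_limit_close Es cl; exists r.
  by have [r r0 h] := patch_limit_far Es fa; exists r.
have [q [v [e [e0 hv hq v1]]]] := partition_of_unity uB cE pE (fun s Ss => (hr s Ss).1).
have hqs s : s \in q -> leb2.-integrable (patch_dom p : set (Rm * Rm)) (EFin \o patch_integrand (v s)) /\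
    level_int (patch_density (v s)) @ \oo --> \int[leb2]_(x in patch_dom p) patch_integrand (v s) x.
  by move=> /hq[Ss vs]; have [_] := hr s Ss; apply.
have -> : \int[leb2]_(x in patch_dom p)
    (weight p (graph_point p x) *
     cross (fermi_normal E (graph_point p x)) (W (graph_point p x)) 0 l * area_element p x) =
    \sum_(s <- q) \int[leb2]_(x in patch_dom p) patch_integrand (v s) x.
  rewrite -Rintegral_sum_seq; last 2 first.
  - exact: measurable_patch_dom.
  - by move=> s /hqs[].
  apply: eq_Rintegral => x; rewrite inE => px.
  rewrite /patch_integrand -!mulr_suml -mulr_sumr v1 ?mulr1//.
  by rewrite (Sp x px) subrr normr0.
apply: (level_localize e0 hv v1).
  by apply: tame_patch_density => //; exact: cst_continuous.
move=> s /hqs[_].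
have -> : (fun k => patch_density (fun=> 1) k * v s k) = patch_density (v s).
  by apply/funext => k; rewrite /patch_density mulr1.
by [].
Qed.

End OnePatch.

(** The sequence does not mention the atlas, only the limit does; this is why all atlases give the
    same value. *)
Lemma atlas_limit (W : 'rV[R]_3 -> 'rV[R]_3) l ps : C1_field W -> lattice_periodic B W ->
  atlas B S ps ->
  level_int (flux E W l) @ \oo -->
  atlas_int ps (fun k => cross (fermi_normal E k) (W k) 0 l).
Proof.
move=> cW pW [hp w1]; rewrite /atlas_int big_tnth.
pose P i := tnth (in_tuple ps) i.
(* [None] carries the defect [1 - \sum_(p <- ps) weight p k], which vanishes on the surface but
   perhaps not around it. *)
pose G (o : option 'I_(size ps)) (k : 'rV[R]_3) : R :=
  if o is Some i then flux E W l k * weight (P i) k * 1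
  else flux E W l k * (1 - \sum_(p <- ps) weight p k).
pose L (o : option 'I_(size ps)) : R := if o is Some i then
  \int[leb2]_(x in patch_dom (P i))
    (weight (P i) (graph_point (P i) x) *
     cross (fermi_normal E (graph_point (P i) x)) (W (graph_point (P i) x)) 0 l * area_element (P i) x) else 0.
have tf := tame_flux l cW pW.
have sumE k : \sum_(p <- ps) weight p k = \sum_(i < size ps) weight (P i) k by rewrite big_tnth.
have tG o : tame B E (G o).
  case: o => [i|] /=; first by apply: (tame_patch_density (hp i)) => //; exact: cst_continuous.
  apply: (tameM tf).
    move=> k; apply: continuous_forB; first exact: continuous_forcst.
    have -> : (fun k => \sum_(p <- ps) weight p k) = (fun k => \sum_(i < size ps) weight (P i) k).
      by apply/funext => x; exact: sumE.
    apply: (@continuous_sum _ _ _ (index_enum 'I_(size ps)) (fun i k => weight (P i) k)) => i.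
    by have [_ _ _ [cw _ _] _] := hp i.
  move=> k q lq; congr (1 - _); rewrite (sumE k) (sumE (k + q)); apply: eq_bigr => i _.
  by have [_ _ _ [_ pw _] _] := hp i; exact: pw.
pose q : seq (option 'I_(size ps)) := None :: [seq Some i | i <- index_enum 'I_(size ps)].
have hL o : o \in q -> level_int (G o) @ \oo --> L o.
  move=> _; case: o => [i|] /=; first exact: (patch_limit (hp i)).
  by apply: level_limit_zero => [|k Ek]; [exact: (tG None)|rewrite /G (w1 k Ek) subrr mulr0].
have := level_limit_sum tG hL.
have sumo (F : option 'I_(size ps) -> R) : \sum_(o <- q) F o = F None + \sum_(i < size ps) F (Some i).
  by rewrite big_cons big_map.
rewrite sumo /= add0r.
have -> // : (fun k => \sum_(o <- q) G o k) = flux E W l.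
apply/funext => k; rewrite sumo /=.
have -> : \sum_(i < size ps) flux E W l k * weight (P i) k * 1 = flux E W l k * \sum_(p <- ps) weight p k.
  by rewrite sumE mulr_sumr; apply: eq_bigr => i _; rewrite mulr1.
by rewrite -mulrDr subrK mulr1.
Qed.

End SurfaceValue.

(** * Implicit function theorem in a good box *)

Section ImplicitFunction.
Context {R : realType}.
Variable B : 'M[R]_3.
Hypothesis uB : B \in unitmx.
Variables (E : 'rV[R]_3 -> R) (mu : R).
Hypotheses (cE : continuous E) (pE : lattice_periodic B E).
Local Notation S := (fermi_surface E mu).
Variables (a : 'I_3) (s : 'rV[R]_3) (r r0 c M sg : R).
Hypothesis gb : good_box B E mu a s r r0 c M sg.
Variable h : R * R -> R.
Hypothesis hh : forall x, square a s r x ->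
  `|h x - s 0 a| <= r0 /\ E (axis_point a x (h x)) = mu.

Lemma axis_pointB (x y : R * R) t u :
  axis_point a x t - axis_point a y u = axis_point a (x - y) (t - u).
Proof.
apply/rowP; apply: (liftP (a := a)); rewrite mxE [in X in _ + X]mxE.
- by rewrite !axis_point_axis.
- by rewrite !axis_point_lift.
- by rewrite !axis_point_lift.
Qed.

Lemma norm_axis_point (x : R * R) t : `|axis_point a x t| <= `|x| + `|t|.
Proof.
rewrite [leLHS]mx_normrE; apply: bigmax_le => [|[i j] _ /=]; first by rewrite addr_ge0.
have -> : i = 0 by apply/val_inj; case: i => -[].
have [h1 h2] : `|x.1| <= `|x| /\ `|x.2| <= `|x|.
  by rewrite [`|x|]/Num.norm/= !le_max !lexx orbT.
move: j; apply: (liftP (a := a)); rewrite ?axis_point_axis ?axis_point_lift /=.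
- by rewrite lerDr.
- by rewrite (le_trans h1)// lerDl.
- by rewrite (le_trans h2)// lerDl.
Qed.

Lemma box_gb x t : square a s r x -> `|t - s 0 a| <= r0 -> box a s r r0 (axis_point a x t).
Proof. by move=> sx ht; exact/box_axis_point. Qed.

Lemma box_convex k v t : box a s r r0 k -> box a s r r0 (k + v) -> 0 <= t <= 1 ->
  box a s r r0 (k + t *: v).
Proof.
move=> [[h1 h2] h3] [[h4 h5] h6] /andP[t0 t1].
have conv (x y z e : R) : `|x - z| <= e -> `|x + y - z| <= e -> `|x + t * y - z| <= e.
  rewrite !ler_norml => /andP[? ?] /andP[? ?]; apply/andP; split; nra.
rewrite /base /= !mxE in h1 h2 h4 h5 h6.
by split; [split|]; rewrite /base/= !mxE; [exact: conv h1 h4|exact: conv h2 h5|exact: conv h3 h6].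
Qed.

(** Moving from [x] to [y] at the height [h x] changes [E] by at most [M] times the displacement in
    each of the two coordinates, whence [M * 2]. The slope bound along the axis over [y] converts
    this into a bound on the heights. *)
Lemma root_lipschitz x y : square a s r x -> square a s r y ->
  c * `|h y - h x| <= M * 2 * `|y - x|.
Proof.
move=> sx sy; have [hx Ex] := hh sx; have [hy Ey] := hh sy.
apply: le_trans (box_slope gb sy hx hy) _.
rewrite Ey -Ex distrC.
pose k := axis_point a x (h x); pose v := axis_point a (y - x) (0 : R).
have kv : axis_point a y (h x) = k + v.
  by rewrite /v -[0](subrr (h x)) -axis_pointB addrC subrK.
have bk t : 0 <= t <= 1 -> box a s r r0 (k + t *: v).
  by apply: box_convex; [exact: box_gb|rewrite -kv; exact: box_gb].
have [t ht|t /andP[t0 t1]] := @MVT_line _ E k v 1 ltr01.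
  by apply: diff_derivable; have [] := gb_reg gb (bk t ht).
have b01 : 0 <= t <= 1 by rewrite !ltW.
have [dE _] := gb_reg gb (bk t b01).
rewrite scale1r -kv mulr1 => ->; rewrite deriveE_pd// (sum_lift a).
rewrite axis_point_axis !axis_point_lift mul0r add0r.
have [h1 h2] : `|(y - x).1| <= `|y - x| /\ `|(y - x).2| <= `|y - x|.
  by rewrite [`|y - x|]/Num.norm/= !le_max !lexx orbT.
apply: le_trans (ler_normD _ _) _; rewrite !normrM.
rewrite [leRHS](_ : _ = `|y - x| * M + `|y - x| * M); last by ring.
apply: lerD; apply: ler_pM => //; exact: (gb_bound gb _ (bk t b01)).
Qed.

Local Notation D := (`]s 0 (lift a 0) - r, s 0 (lift a 0) + r[ `*`
                     `]s 0 (lift a 1) - r, s 0 (lift a 1) + r[ : set (R * R)).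

Lemma open_square : open D.
Proof.
have -> : D = fst @^-1` `]s 0 (lift a 0) - r, s 0 (lift a 0) + r[ `&`
    snd @^-1` `]s 0 (lift a 1) - r, s 0 (lift a 1) + r[ by apply/seteqP; split => x.
by apply: openI; apply: open_comp => [x _|]; [exact: cvg_fst|exact: interval_open|
  exact: cvg_snd|exact: interval_open].
Qed.

Lemma open_square_sub : D `<=` square a s r.
Proof. by move=> x [] /=; rewrite !in_itv/= -!ltr_distl => h1 h2; split; exact: ltW. Qed.

Definition root_slope (x u : R * R) : R :=
  - (u.1 * pd (lift a 0) E (axis_point a x (h x)) + u.2 * pd (lift a 1) E (axis_point a x (h x)))
    / pd a E (axis_point a x (h x)).

Lemma root_slope_linear x : linear (root_slope x).
Proof. by move=> t u v; rewrite /root_slope /= /GRing.scale /=; ring. Qed.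

Lemma pd_neq0 k : box a s r r0 k -> pd a E k != 0.
Proof.
move=> bk; have := lt_le_trans (gb_c gb) (gb_slope gb bk).
by apply: contraTneq => ->; rewrite mulr0 ltxx.
Qed.

(** [E] equals [mu] at both graph points, so its first-order expansion at [k] makes the linear part
    along the chord small compared with the chord. The chord is at most [C * |u|], with 1 for the
    displacement of the base point and [M * 2 / c] for that of the root; dividing by the slope gives
    the expansion of [h]. *)
Lemma differentiable_root x : D x ->
  differentiable h x /\ forall u, 'D_u h x = root_slope x u.
Proof.
move=> Dx; have sx := open_square_sub Dx; have [hx Ex] := hh sx.
pose k := axis_point a x (h x).
have bk : box a s r r0 k by exact: box_gb.
have pa0 := pd_neq0 bk; have [dE _] := gb_reg gb bk.
have M0 : 0 <= M by apply: le_trans (gb_bound gb a bk).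
pose C := 1 + M * 2 / c.
have C0 : 0 < C by rewrite ltr_wpDr// divr_ge0 ?mulr_ge0// ltW// (gb_c gb).
pose LM := GRing.isLinear.Build _ _ _ _ _ (root_slope_linear x).
pose L : {linear _ -> _} := HB.pack (root_slope x) LM.
have cL : continuous L.
  move=> u; apply: cvgM; last exact: cvg_cst.
  apply: cvgN; apply: cvgD; apply: cvgM; try exact: cvg_cst; [exact: cvg_fst|exact: cvg_snd].
suff littleo : forall e : R, 0 < e ->
    \forall u \near (0 : R * R), `|h (u + x) - h x - root_slope x u| <= e * `|u|.
  have [dh dL] := differentiable_littleo cL littleo.
  by split => // u; rewrite deriveE// dL.
move=> e e0.
(* The precision asked of the expansion of [E]: the Lipschitz bound multiplies it by [C], and the
   final division by [|pd a E k|] leaves [e]. *)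
have eta0 : 0 < e * `|pd a E k| / C by rewrite divr_gt0// mulr_gt0// normr_gt0.
have nD : \forall u \near (0 : R * R), D (u + x).
  have cx : {for (0 : R * R), continuous (fun u : R * R => u + x)}.
    by apply: (@continuousD _ _ _ id (cst x)); [|exact: cst_continuous].
  have nx : nbhs ((0 : R * R) + x) D.
    by rewrite add0r; apply: open_nbhs_nbhs; split => //; exact: open_square.
  exact: (cx _ nx).
have lipn u : D (u + x) -> `|axis_point a (u + x) (h (u + x)) - k| <= C * `|u|.
  move=> Dux; have sux := open_square_sub Dux.
  rewrite axis_pointB addrK; apply: le_trans (norm_axis_point _ _) _.
  rewrite mulrDl mul1r lerD2l; have := root_lipschitz sx sux; rewrite addrK => hl.
  by rewrite mulrAC ler_pdivlMr ?(gb_c gb)// mulrC.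
have := diff_locally dE => /eqaddoP/(_ _ eta0).
move=> /nbhs_ballP[d /= d0 hd].
have nd : \forall u \near (0 : R * R), `|u| < d / C.
  apply: (@cvgr0_norm_lt _ _ _ (nbhs (0 : R * R)) _ id) => //.
  by rewrite divr_gt0.
near=> u.
have Dux : D (u + x) by near: u.
have ud : `|u| < d / C by near: u.
pose w := axis_point a (u + x) (h (u + x)) - k.
have wd : `|w| < d.
  by apply: le_lt_trans (lipn u Dux) _; rewrite mulrC -ltr_pdivlMr.
have := hd w; rewrite -ball_normE /= sub0r normrN => /(_ wd).
rewrite !fctE /= subrK -/k.
have [_ Eux] := hh (open_square_sub Dux).
rewrite Eux Ex opprD addrA subrr sub0r normrN -deriveE// deriveE_pd// (sum_lift a).
rewrite /w axis_pointB addrK axis_point_axis !axis_point_lift /=.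
move=> hw.
have : `|pd a E k| * `|h (u + x) - h x - root_slope x u| <= `|pd a E k| * (e * `|u|).
  rewrite -normrM.
  have -> : pd a E k * (h (u + x) - h x - root_slope x u) =
      (h (u + x) - h x) * pd a E k + u.1 * pd (lift a 0) E k + u.2 * pd (lift a 1) E k.
    by rewrite /root_slope -/k; field.
  apply: le_trans hw _; have := lipn u Dux; rewrite axis_pointB addrK => hl.
  apply: le_trans (ler_wpM2l (ltW eta0) hl) _.
  rewrite (_ : _ * (C * `|u|) = `|pd a E k| * (e * `|u|))//.
  by field; rewrite gt_eqF.
by rewrite ler_pM2l ?normr_gt0.
Unshelve. all: by end_near.
Qed.

Definition root_patch (w : 'rV[R]_3 -> R) : graph_patch :=
  Patch a (s 0 (lift a 0) - r, s 0 (lift a 1) - r) (s 0 (lift a 0) + r, s 0 (lift a 1) + r) h w.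

Lemma continuous_root x : D x -> {for x, continuous (fun x => axis_point a x (h x))}.
Proof.
move=> Dx; apply: cvg_axis_point; first exact: cvg_id.
exact: (differentiable_continuous (differentiable_root Dx).1).
Qed.

Lemma continuous_root_slope x u : D x -> {for x, continuous (fun y => 'D_u h y)}.
Proof.
move=> Dx; have sx := open_square_sub Dx; have [hx Ex] := hh sx.
have bk : box a s r r0 (axis_point a x (h x)) by exact: box_gb.
have pa0 := pd_neq0 bk; have [_ cpd] := gb_reg gb bk.
have cj j : {for x, continuous (fun y => pd j E (axis_point a y (h y)))}.
  apply: (@continuous_comp _ _ _ (fun y => axis_point a y (h y)) (pd j E)).
    exact: continuous_root.
  exact: cpd.
have nD : \forall y \near x, D y.
  by apply: open_nbhs_nbhs; split => //; exact: open_square.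
have cs : (fun y => root_slope y u) @ x --> root_slope x u.
  apply: cvgM; last by apply: cvgV; [exact: pa0|exact: cj].
  by apply: cvgN; apply: cvgD; apply: cvgM; try exact: cvg_cst; exact: cj.
change ('D_u h y @[y --> x] --> 'D_u h x).
rewrite (differentiable_root Dx).2.
apply: cvg_trans cs; apply: near_eq_cvg; apply: filterS nD => y Dy.
by rewrite (differentiable_root Dy).2.
Qed.

(** The weight is supported within [r / 2] of [s] modulo the lattice, so that the closed square of
    radius [r / 2] serves as the compact set inside the open domain of radius [r]. *)
Lemma root_patch_of w : r <= r0 -> near_lattice_point B s (r / 2) w ->
  patch_of B S (root_patch w).
Proof.
move=> rr [cw pw w0 ws].
have domD x : patch_dom (root_patch w) x -> D x by [].
split.
- move=> x Dx; split; first exact: (differentiable_root (domD x Dx)).1.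
    exact: (continuous_root_slope (u := (1, 0)) (domD x Dx)).
  exact: (continuous_root_slope (u := (0, 1)) (domD x Dx)).
- by move=> x /domD/open_square_sub/hh[].
- move=> x y /domD/open_square_sub sx /domD/open_square_sub sy ll.
  have [hx _] := hh sx; have [hy _] := hh sy.
  have [n En] := ll.
  suff n0 : n = 0.
    move: En; rewrite n0 map_mx0 mul0mx => /eqP; rewrite subr_eq0 => /eqP/(congr1 (base a)).
    by rewrite !base_axis_point.
  apply/rowP => i; rewrite mxE.
  (* Both points are within 1/4 of [s] in lattice coordinates, so an integer difference of these
     coordinates must be 0. *)
  have cx := gb_cell gb i (box_gb sx hx); have cy := gb_cell gb i (box_gb sy hy).
  have Eni : (n 0 i)%:~R = ((axis_point a x (h x) - s) *m invmx B) 0 i -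
      ((axis_point a y (h y) - s) *m invmx B) 0 i.
    have := congr1 (fun v : 'rV[R]_3 => (v *m invmx B) 0 i) En.
    rewrite /= mulmxK// [RHS]mxE => <-.
    rewrite !graph_pointE /=.
    have -> : axis_point a x (h x) - axis_point a y (h y) =
        (axis_point a x (h x) - s) - (axis_point a y (h y) - s) by rewrite opprB addrA subrK.
    by rewrite mulmxBl mxE [X in _ + X]mxE.
  have : `|(n 0 i)%:~R : R| < 1.
    rewrite Eni; apply: le_lt_trans (ler_normB _ _) _; apply: lt_le_trans (ltrD cx cy) _.
    lra.
  by rewrite -intr_norm ltrz1; case: (n 0 i) => [[|m]|m].
- by split.
- exists (square a s (r / 2)); split.
  + have := compact_setX (@segment_compact R (s 0 (lift a 0) - r / 2) (s 0 (lift a 0) + r / 2))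
      (@segment_compact R (s 0 (lift a 1) - r / 2) (s 0 (lift a 1) + r / 2)).
    congr compact; apply/seteqP; split => x /=; by rewrite !in_itv/= -!ler_distl.
  + have r2 : r / 2 < r by rewrite gtr_pMr ?(gb_r gb)// invf_lt1// ltr1n.
    move=> x [h1 h2]; split; rewrite /= in_itv/= -ltr_distl; [exact: le_lt_trans h1 r2|exact: le_lt_trans h2 r2].
  + move=> k Ek /ws[l ll kl].
    have r2 : r / 2 <= r by have := gb_r gb; lra.
    have [sk hk] := ball_box a (le_trans r2 rr) kl.
    exists (base a (k - l)) => //.
    have sk' := square_le r2 sk; have [hb Eb] := hh sk'.
    suff -> : graph_point (root_patch w) (base a (k - l)) = k - l by rewrite opprB addrCA subrr addr0.
    rewrite graph_pointE -[RHS](axis_pointK a); congr axis_point.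
    apply: (root_unique gb sk' hb hk Eb).
    by rewrite axis_pointK (lattice_periodicB _ pE ll).
Qed.

End ImplicitFunction.

Section AtlasExists.
Context {R : realType}.
Variable B : 'M[R]_3.
Hypothesis uB : B \in unitmx.
Variables (E : 'rV[R]_3 -> R) (mu : R).
Hypotheses (bE : band B E) (rE : regular_fermi_surface E mu).

Lemma atlas_exists : exists ps, atlas B (fermi_surface E mu) ps.
Proof.
have [cE pE] := bE; have [d d0 regd] := regular_near uB cE pE rE.
have gradS := rE.2.
have /choice[f hf] : forall s, exists f : 'I_3 * R * (R * R -> R), E s = mu ->
    0 < f.1.2 /\ forall w, near_lattice_point B s (f.1.2 / 2) w ->
    patch_of B (fermi_surface E mu) (root_patch f.1.1 s f.1.2 f.2 w).
  move=> s; have [Es|] := pselect (E s = mu); last by exists (0, 0, fun=> 0).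
  have [a pa] := exists_transverse_axis gradS Es.
  have [r [r0 [c [M [sg [rr _ gb]]]]]] := exists_good_box B cE (regular_on_surface d0 regd Es)
    (regular_near_surface cE d0 regd Es) Es pa ltr01.
  have /choice[h hh] : forall x, exists t, square a s r x ->
      `|t - s 0 a| <= r0 /\ E (axis_point a x t) = mu.
    move=> x; have [sx|] := pselect (square a s r x); last by exists 0.
    by have [t ? ?] := root_exists gb sx; exists t.
  exists (a, r, h) => _ /=; split; first exact: gb_r gb.
  by move=> w; exact: (root_patch_of uB pE gb hh rr).
have [|q [v [e [e0 hv hq v1]]]] := @partition_of_unity _ _ uB _ mu cE pE (fun s => (f s).1.2 / 2).
  by move=> s /hf[r0 _]; rewrite divr_gt0.
exists [seq root_patch (f s).1.1 s (f s).1.2 (f s).2 (v s) | s <- q]; split.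
  move=> i; have iq : (i < size q)%N by rewrite -(size_map (fun s => root_patch (f s).1.1 s (f s).1.2 (f s).2 (v s))).
  rewrite (tnth_nth (root_patch 0 0 0 (fun=> 0) (fun=> 0))) /= (nth_map 0)//.
  have [Ss vs] := hq _ (mem_nth 0 iq).
  by have [_] := hf _ Ss; apply.
move=> k Ek; rewrite big_map /=; apply: v1.
by rewrite Ek subrr normr0.
Qed.

(** Both [P_obs] and the integral over an arbitrary atlas are limits of one sequence of volume
    integrals, and limits are unique. *)
Lemma surface_int_flux (W : 'rV[R]_3 -> 'rV[R]_3) l : C1_field W -> lattice_periodic B W ->
  is_surface_int B (fermi_surface E mu)
    (fun k => cross (fermi_normal E k) (W k) 0 l) (P_obs B E mu W 0 l).
Proof.
move=> cW pW; split; first exact: atlas_exists.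
move=> ps hps; have [cE pE] := bE; have [d d0 regd] := regular_near uB cE pE rE.
have L1 := P_obs_flux_limit uB bE rE (l := l) cW pW.
have L2 := atlas_limit uB cE pE d0 regd rE.2 (l := l) cW pW hps.
exact: (cvg_unique (@Rhausdorff R) L2 L1).
Qed.

End AtlasExists.

(** * Polar crystal classes *)

Section PlaneMatrices.
Context {R : realType}.
Implicit Types (c s e : R) (g h : 'M[R]_3).

(* Rotation about the third axis for e = 1, reflection through a plane containing it for e = -1. *)
Definition plane_mx c s e : 'M[R]_3 :=
  \matrix_(i, j) (nth [::] [:: [:: c; s; 0]; [:: - (e * s); e * c; 0]; [:: 0; 0; 1]] i)`_j.

Definition ez : 'rV[R]_3 := delta_mx 0 2.

Lemma matrix3P (A C : 'M[R]_3) : (forall i, A i 0 = C i 0 /\ A i 1 = C i 1 /\ A i 2 = C i 2) -> A = C.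
Proof. by move=> h; apply/matrixP => i; apply: ord3P; have [? []] := h i. Qed.

Lemma plane_mxM c s e c' s' e' : e' * e' = 1 -> plane_mx c s e *m plane_mx c' s' e' =
  plane_mx (c * c' - e' * s * s') (c * s' + e' * s * c') (e * e').
Proof.
move=> ee; apply: matrix3P; apply: ord3P; rewrite !mxE !sum3E !mxE /=.
- by split; [ring|split; ring].
- split; first by rewrite mulrDr !mulrA -[e * e' * e']mulrA ee; ring.
  by split; [rewrite mulrBr !mulrA -[e * e' * e']mulrA ee; ring|ring].
- by split; [ring|split; ring].
Qed.

Lemma plane_mx1 : plane_mx 1 0 1 = 1%:M.
Proof.
apply: matrix3P; apply: ord3P; rewrite !mxE /=; by split; [|split]; rewrite ?mulr0 ?oppr0 ?mulr1.
Qed.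

Lemma plane_mx_tr c s e : e * e = 1 -> (plane_mx c s e)^T = plane_mx c (- (e * s)) e.
Proof.
move=> ee; apply: matrix3P; apply: ord3P; rewrite !mxE /=.
- by split; [|split].
- by split; [rewrite mulrN mulrA ee mul1r opprK|split].
- by split; [|split].
Qed.

Lemma O3_plane c s e : e * e = 1 -> c ^+ 2 + s ^+ 2 = 1 -> O3 (plane_mx c s e).
Proof.
move=> ee cs; rewrite /O3 /= plane_mx_tr// plane_mxM// -plane_mx1; congr plane_mx => //.
- by rewrite -cs mulrN opprK mulrA -[e * s * _]mulrAC ee; ring.
- by ring.
Qed.

Lemma det_plane c s e : c ^+ 2 + s ^+ 2 = 1 -> \det (plane_mx c s e) = e.
Proof.
move=> cs; rewrite det3 !mxE /=; transitivity (e * (c ^+ 2 + s ^+ 2)); first by ring.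
by rewrite cs mulr1.
Qed.

Lemma tr_plane c s e : \tr (plane_mx c s e) = c + e * c + 1.
Proof. by rewrite /mxtrace sum3E !mxE /=. Qed.

Lemma ez_plane c s e : ez *m plane_mx c s e = ez.
Proof.
rewrite -rowE; apply/rowP; apply: ord3P; by rewrite !mxE.
Qed.

(** Fixing the third axis makes the last row, and by orthogonality the last column, trivial. In the
    plane the second row is a unit vector orthogonal to the first, so it is determined up to the
    sign [e], the determinant. *)
Lemma O3_fix_ez g : O3 g -> ez *m g = ez ->
  exists c s e, [/\ c ^+ 2 + s ^+ 2 = 1, e = 1 \/ e = -1 & g = plane_mx c s e].
Proof.
move=> Og; rewrite -rowE => /rowP gz.
have g20 : g 2 0 = 0 by have := gz 0; rewrite !mxE.
have g21 : g 2 1 = 0 by have := gz 1; rewrite !mxE.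
have g22 : g 2 2 = 1 by have := gz 2; rewrite !mxE.
have dotr i j : g i 0 * g j 0 + g i 1 * g j 1 + g i 2 * g j 2 = (i == j)%:R.
  by have := congr1 (fun A : 'M[R]_3 => A i j) Og; rewrite !mxE sum3E !mxE.
have := dotr 0 2; rewrite g20 g21 g22 !mulr0 !add0r mulr1 /= => g02.
have := dotr 1 2; rewrite g20 g21 g22 !mulr0 !add0r mulr1 /= => g12.
have := dotr 0 0; have := dotr 0 1; have := dotr 1 1; rewrite g02 g12 !mulr0 !addr0 /=.
set c := g 0 0; set s := g 0 1; set p := g 1 0; set q := g 1 1 => h1 h2 h3.
(* Lagrange's identity for the two orthonormal planar rows. *)
have ee : (c * q - s * p) * (c * q - s * p) = 1.
  rewrite [LHS](_ : _ = (c * c + s * s) * (p * p + q * q) - (c * p + s * q) * (c * p + s * q)); last by ring.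
  by rewrite h1 h2 h3 mulr1 mulr0 subr0.
exists c, s, (c * q - s * p); split.
- by rewrite !expr2.
- by move/eqP: ee; rewrite -expr2 sqrf_eq1 => /orP[] /eqP; [left|right].
- have g10 : g 1 0 = - ((c * q - s * p) * s).
    rewrite -/p [RHS](_ : _ = (c * c + s * s) * p - c * (c * p + s * q)); last by ring.
    by rewrite h3 h2 mulr0 subr0 mul1r.
  have g11 : g 1 1 = (c * q - s * p) * c.
    rewrite -/q [RHS](_ : _ = (c * c + s * s) * q - s * (c * p + s * q)); last by ring.
    by rewrite h3 h2 mulr0 subr0 mul1r.
  apply: matrix3P; apply: ord3P; rewrite [plane_mx _ _ _ _ 0]mxE [plane_mx _ _ _ _ 1]mxE [plane_mx _ _ _ _ 2]mxE /=.
  + by split; [|split].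
  + by split; [|split].
  + by split; [|split].
Qed.

End PlaneMatrices.

(** * Conjugation in O(3) *)

Section Conjugation.
Context {R : realType}.
Implicit Types (g h k : 'M[R]_3) (G H : set 'M[R]_3).

Definition conjs h G := [set invmx h *m g *m h | g in G].

Lemma O3_1 : O3 (1%:M : 'M[R]_3). Proof. by rewrite /O3 /= trmx1 mulmx1. Qed.

Lemma O3_mul h k : O3 h -> O3 k -> O3 (h *m k).
Proof. by rewrite /O3 /= => Oh Ok; rewrite trmx_mul mulmxA -(mulmxA h) Ok mulmx1. Qed.

Lemma O3_invmx h : O3 h -> O3 (invmx h).
Proof. by move=> Oh; rewrite O3_inv// /O3 /= trmxK; exact: O3_trmul. Qed.

Lemma invmxM h k : h \in unitmx -> k \in unitmx -> invmx (h *m k) = invmx k *m invmx h.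
Proof.
exact: (@invrM _ h k).
Qed.

Lemma conjs_conjs h k G : h \in unitmx -> k \in unitmx -> conjs k (conjs h G) = conjs (h *m k) G.
Proof.
move=> uh uk; rewrite /conjs image_comp; apply: eq_imagel => g _ /=.
by rewrite invmxM// !mulmxA.
Qed.

Lemma conjs1 G : conjs 1%:M G = G.
Proof.
rewrite /conjs invmx1; apply/seteqP; split => [_ [g Gg <-]|g Gg].
  by rewrite mul1mx mulmx1.
by exists g => //; rewrite mul1mx mulmx1.
Qed.

Lemma crystal_class_conjs h G : O3 h -> crystal_class (conjs h G) = crystal_class G.
Proof.
move=> Oh; have uh := O3_unit Oh; apply/seteqP; split => _ [k Ok ->].
  by exists (h *m k); [exact: O3_mul|rewrite -/(conjs k _) conjs_conjs// (O3_unit Ok)].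
have Ohk : O3 (invmx h *m k) by apply: O3_mul => //; exact: O3_invmx.
exists (invmx h *m k) => //; rewrite -/(conjs _ (conjs h G)) conjs_conjs ?(O3_unit Ohk)//.
by rewrite mulmxA mulmxV// mul1mx.
Qed.

Lemma crystal_class_inj G H : crystal_class G = crystal_class H -> exists2 h, O3 h & H = conjs h G.
Proof.
move=> GH; have : crystal_class H H by exists 1%:M; [exact: O3_1|rewrite -/(conjs _ _) conjs1].
by rewrite -GH => -[h Oh ->]; exists h.
Qed.

Lemma conjs_tr_det h g : h \in unitmx ->
  \tr (invmx h *m g *m h) = \tr g /\ \det (invmx h *m g *m h) = \det g.
Proof.
move=> uh; split; first by rewrite -mulmxA mxtrace_mulC -mulmxA mulmxV// mulmx1.
by rewrite !det_mulmx mulrAC -det_mulmx mulVmx// det1 mul1r.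
Qed.

Lemma lattice_mulmx (B : 'M[R]_3) h v : h \in unitmx -> lattice (B *m h) v <-> lattice B (v *m invmx h).
Proof.
move=> uh; split=> [[n ->]|[n En]]; exists n; first by rewrite mulmxA mulmxK.
by rewrite mulmxA -En mulmxKV.
Qed.

Lemma crystallographic_conjs h G : O3 h -> crystallographic G -> crystallographic (conjs h G).
Proof.
move=> Oh [B uB [G1 GM GV GO GB]]; have uh := O3_unit Oh.
exists (B *m h); first by rewrite unitmx_mul uB.
split.
- by exists 1%:M => //; rewrite mulmx1 mulVmx.
- move=> _ _ [g Gg <-] [k Gk <-]; exists (g *m k); first exact: GM.
  by rewrite !mulmxA -(mulmxA _ h) mulmxV// mulmx1.
- move=> _ [g Gg <-]; exists (invmx g); first exact: GV.
  have ug := O3_unit (GO _ Gg).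
  by rewrite !invmxM ?unitmx_mul ?unitmx_inv ?uh// invmxK mulmxA.
- by move=> _ [g /GO Og <-]; apply: O3_mul => //; apply: O3_mul => //; exact: O3_invmx.
- move=> _ [g /GB Bg <-] v; rewrite !lattice_mulmx// -(Bg (v *m invmx h)) -!mulmxA mulmxV//.
  by rewrite mulmx1.
Qed.

(** The conjugating matrix is the Householder reflection in the plane orthogonal to [w = u - ez],
    which exchanges the unit vectors [u] and [ez]; it is the identity when they coincide. *)
Lemma polar_fix_ez G : polar G -> exists2 h, O3 h & forall g, conjs h G g -> ez *m g = ez.
Proof.
move=> [v [v0 Gv]].
pose N := Num.sqrt (dot v v).
have vv : 0 < dot v v.
  rewrite lt_def; apply/andP; split; last by apply: sumr_ge0 => i _; rewrite -expr2 sqr_ge0.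
  apply: contraNneq v0 => /eqP; rewrite psumr_eq0 => [/allP h|i _]; last by rewrite -expr2 sqr_ge0.
  by apply/eqP/rowP => i; have := h i (mem_index_enum i); rewrite -expr2 sqrf_eq0 mxE => /eqP.
have N0 : 0 < N by rewrite sqrtr_gt0.
pose u := N^-1 *: v.
have uu : dot u u = 1.
  have -> : dot u u = N^-1 * N^-1 * dot v v.
    by rewrite /dot mulr_sumr; apply: eq_bigr => i _; rewrite !mxE; ring.
  by rewrite -[dot v v]sqr_sqrtr ?(ltW vv)// -/N; field; rewrite gt_eqF.
have [h Oh uh] : exists2 h, O3 h & u *m h = ez.
  have [->|uz] := eqVneq u ez; first by exists 1%:M; [exact: O3_1|rewrite mulmx1].
  pose w := u - ez.
  have w_0 : w 0 0 = u 0 0 by rewrite [LHS]mxE [X in _ + X]mxE [X in _ - X]mxE /= subr0.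
  have w_1 : w 0 1 = u 0 1 by rewrite [LHS]mxE [X in _ + X]mxE [X in _ - X]mxE /= subr0.
  have w_2 : w 0 2 = u 0 2 - 1 by rewrite [LHS]mxE [X in _ + X]mxE [X in _ - X]mxE.
  have ww : dot w w = 2 * (1 - u 0 2).
    by rewrite /dot sum3E w_0 w_1 w_2; have := uu; rewrite /dot sum3E; nra.
  have w0 : dot w w != 0.
    apply: contra uz; rewrite psumr_eq0 => [/allP h|i _]; last by rewrite -expr2 sqr_ge0.
    rewrite -subr_eq0; apply/eqP/rowP => i.
    by have := h i (mem_index_enum i); rewrite -expr2 sqrf_eq0 [RHS]mxE => /eqP.
  pose X := (2 / dot w w) *: (w^T *m w).
  exists (1%:M - X).
    have tr : (1%:M - X)^T = 1%:M - X.
      by rewrite linearB /= linearZ /= trmx_mul trmxK trmx1.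
    have XX : X *m X = X + X.
      rewrite /X -scalemxAl -scalemxAr scalerA mulmxA -(mulmxA w^T).
      have -> : w *m w^T = (dot w w)%:M by rewrite dotE -mx11_scalar.
      rewrite mul_mx_scalar -scalemxAl scalerA -scalerDl; congr (_ *: _); by field.
    by rewrite /O3 /= tr mulmxBl mul1mx mulmxBr mulmx1 XX opprB addrK subrK.
  rewrite /X mulmxBr mulmx1 -scalemxAr mulmxA.
  have -> : u *m w^T = (dot u w)%:M by rewrite dotE -mx11_scalar.
  (* Because [u] and [ez] both have length 1. The reflection then subtracts exactly [w] from [u],
     leaving [ez]. *)
  have -> : dot u w = dot w w / 2.
    by rewrite ww /dot sum3E w_0 w_1 w_2; have := uu; rewrite /dot sum3E; lra.
  rewrite mul_scalar_mx scalerA.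
  have -> : 2 / dot w w * (dot w w / 2) = 1 by field.
  by rewrite scale1r /w opprB addrC subrK.
exists h => // _ [g Gg <-].
have -> : ez = u *m h by [].
have ug : u *m g = u by rewrite /u -scalemxAl Gv.
by rewrite !mulmxA mulmxK ?(O3_unit Oh)// ug.
Qed.

End Conjugation.

(** * The ten axial groups and their classes *)

Section PolarGroups.
Context {R : realType}.
Implicit Types (c s e : R) (g h : 'M[R]_3) (G H : set 'M[R]_3) (X : seq R) (b : bool).

(* The cyclic group whose rotations have their cosines in X, extended by the reflections
   through the planes that contain the axis when b holds. *)
Definition axial_group X b : set 'M[R]_3 :=
  [set g | exists c s e, [/\ c ^+ 2 + s ^+ 2 = 1, c \in X, e = 1 \/ b /\ e = -1 &
                             g = plane_mx c s e]].

(* C1, C2, C3, C4, C6 *)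
Definition cosines : seq (seq R) :=
  [:: [:: 1]; [:: 1; -1]; [:: 1; - 2^-1]; [:: 1; -1; 0]; [:: 1; -1; - 2^-1; 2^-1]].

Definition cos_closed X := forall c s c' s' : R, c ^+ 2 + s ^+ 2 = 1 -> c' ^+ 2 + s' ^+ 2 = 1 ->
  c \in X -> c' \in X -> c * c' - s * s' \in X.

Lemma half_cos (c s : R) : c ^+ 2 + s ^+ 2 = 1 -> (c = 2^-1 \/ c = - 2^-1) -> s ^+ 2 = 3 / 4.
Proof. by move=> cs [] hc; rewrite hc in cs; lra. Qed.

Lemma sqr_pm (s t : R) : s ^+ 2 = t ^+ 2 -> s = t \/ s = - t.
Proof. by move/eqP; rewrite eqf_sqr => /orP[] /eqP; [left|right]. Qed.

Lemma sin_eq0 (c s : R) : c ^+ 2 + s ^+ 2 = 1 -> c = 1 \/ c = -1 -> s = 0.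
Proof. by move=> cs [] hc; apply/eqP; rewrite -sqrf_eq0; apply/eqP; rewrite hc in cs; lra. Qed.

Lemma cos_closed_cosines X : X \in cosines -> cos_closed X.
Proof.
rewrite !inE => /or4P[|||/orP[]] /eqP -> c s c' s' cs cs'; rewrite !inE.
- move=> /eqP hc /eqP hc'.
  by rewrite (sin_eq0 cs (or_introl hc)) hc hc' mul0r subr0 mulr1.
- move=> hc hc'; have s0 : s = 0 by apply: (sin_eq0 cs); case/orP: hc => /eqP; [left|right].
  rewrite s0; case/orP: hc => /eqP ->; case/orP: hc' => /eqP ->; apply/orP;
    by [left; apply/eqP; ring|right; apply/eqP; ring].
- move=> /orP[] /eqP hc /orP[] /eqP hc'.
  + by rewrite (sin_eq0 cs (or_introl hc)) hc hc' mul0r subr0 mulr1 eqxx.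
  + by rewrite (sin_eq0 cs (or_introl hc)) hc hc' mul0r subr0 mul1r eqxx orbT.
  + by rewrite (sin_eq0 cs' (or_introl hc')) hc hc' mulr0 subr0 mulr1 eqxx orbT.
  + have h1 := half_cos cs (or_intror hc); have h2 := half_cos cs' (or_intror hc').
    have [ss|ss] := @sqr_pm s s' (etrans h1 (esym h2)); rewrite ss hc hc'.
      by apply/orP; right; apply/eqP; rewrite expr2 in h2; lra.
    by apply/orP; left; apply/eqP; rewrite expr2 in h2; lra.
- move=> /or3P[] /eqP hc /or3P[] /eqP hc'.
  + by rewrite (sin_eq0 cs (or_introl hc)) hc hc' mul0r subr0 mulr1 eqxx.
  + by rewrite (sin_eq0 cs (or_introl hc)) hc hc' mul0r subr0 mul1r eqxx !orbT.
  + by rewrite (sin_eq0 cs (or_introl hc)) hc hc' mul0r subr0 mulr0 eqxx !orbT.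
  + by rewrite (sin_eq0 cs' (or_introl hc')) hc hc' mulr0 subr0 mulr1 eqxx !orbT.
  + by rewrite (sin_eq0 cs' (or_intror hc')) hc hc' mulr0 subr0 mulrNN mulr1 eqxx.
  + by rewrite (sin_eq0 cs (or_intror hc)) hc hc' mul0r subr0 mulr0 eqxx !orbT.
  + by rewrite (sin_eq0 cs' (or_introl hc')) hc hc' mulr0 subr0 mul0r eqxx !orbT.
  + by rewrite (sin_eq0 cs' (or_intror hc')) hc hc' mulr0 subr0 mul0r eqxx !orbT.
  + have h1 : s ^+ 2 = 1 ^+ 2 by rewrite hc in cs; lra.
    have h2 : s' ^+ 2 = 1 ^+ 2 by rewrite hc' in cs'; lra.
    rewrite hc hc'; have [->|->] := sqr_pm h1; have [->|->] := sqr_pm h2;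
      by rewrite mul0r sub0r ?mulr1 ?mul1r ?mulrNN ?mulr1 ?opprK ?eqxx ?orbT.
- have h4 : forall x y : R, x ^+ 2 = 3 / 4 -> y ^+ 2 = 3 / 4 -> x * y = 3 / 4 \/ x * y = - (3 / 4).
    move=> x y hx hy; have [->|->] := @sqr_pm x y (etrans hx (esym hy)).
      by left; rewrite -expr2.
    by right; rewrite mulNr -expr2 hy.
  move=> /or4P hc /or4P hc'.
  have [hc1|hc2] : (c = 1 \/ c = -1) \/ (c = 2^-1 \/ c = - 2^-1).
    by case: hc => /eqP ->; [left; left|left; right|right; right|right; left].
  + rewrite (sin_eq0 cs hc1) mul0r subr0.
    by case: hc1 => ->; case: hc' => /eqP ->; rewrite ?mul1r ?mulN1r ?opprK ?eqxx ?orbT.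
  have [hc1'|hc2'] : (c' = 1 \/ c' = -1) \/ (c' = 2^-1 \/ c' = - 2^-1).
    by case: hc' => /eqP ->; [left; left|left; right|right; right|right; left].
  + rewrite (sin_eq0 cs' hc1') mulr0 subr0.
    by case: hc1' => ->; case: hc2 => ->; rewrite ?mulr1 ?mulrN1 ?opprK ?eqxx ?orbT.
  have hs := h4 _ _ (half_cos cs hc2) (half_cos cs' hc2').
  apply/or4P; case: hc2 => ->; case: hc2' => ->; case: hs => ->;
    by [constructor 1; apply/eqP; lra|constructor 2; apply/eqP; lra|
        constructor 3; apply/eqP; lra|constructor 4; apply/eqP; lra].
Qed.

Lemma one_cosines X : X \in cosines -> 1 \in X.
Proof. by rewrite !inE => /or4P[|||/orP[]] /eqP ->; rewrite !inE eqxx. Qed.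

Lemma axial_group_O3 X b : axial_group X b `<=` O3.
Proof.
move=> _ [c [s [e [cs _ he ->]]]]; apply: O3_plane => //.
by case: he => [->|[_ ->]]; rewrite ?mulr1// mulrNN mulr1.
Qed.

Lemma sign_sqr b e : e = 1 \/ b /\ e = -1 -> e * e = 1.
Proof. by case=> [->|[_ ->]]; rewrite ?mulr1// mulrNN mulr1. Qed.

Lemma axial_group_ez X b g : axial_group X b g -> ez *m g = ez.
Proof. by move=> [c [s [e [_ _ _ ->]]]]; exact: ez_plane. Qed.

Lemma axial_group_group X b : X \in cosines ->
  [/\ axial_group X b 1%:M,
      forall g h, axial_group X b g -> axial_group X b h -> axial_group X b (g *m h) &
      forall g, axial_group X b g -> axial_group X b (invmx g)].
Proof.
move=> XX; split.
- exists 1, 0, 1; split; [by rewrite expr1n expr0n addr0|exact: one_cosines|by left|].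
  by rewrite plane_mx1.
- move=> _ _ [c [s [e [cs cX he ->]]]] [c' [s' [e' [cs' cX' he' ->]]]].
  have ee := sign_sqr he; have ee' := sign_sqr he'.
  rewrite plane_mxM//; exists (c * c' - e' * s * s'), (c * s' + e' * s * c'), (e * e'); split => //.
  + transitivity ((c ^+ 2 + (e' * e') * s ^+ 2) * (c' ^+ 2 + s' ^+ 2)); first by ring.
    by rewrite ee' mul1r cs cs' mulr1.
  + apply: (cos_closed_cosines XX) => //.
    by rewrite exprMn [e' ^+ 2]expr2 ee' mul1r.
  + by case: he => [->|[hb ->]]; case: he' => [->|[hb' ->]];
      rewrite ?mulr1 ?mul1r ?mulrNN ?mulr1; auto.
- move=> g Gg; have Og := axial_group_O3 Gg; move: Gg => [c [s [e [cs cX he ge]]]].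
  have ee := sign_sqr he.
  rewrite O3_inv// ge plane_mx_tr//; exists c, (- (e * s)), e; split => //.
  by rewrite sqrrN exprMn [e ^+ 2]expr2 ee mul1r.
Qed.

Lemma axial_group_polar X b : polar (axial_group X b).
Proof.
exists ez; split; last by move=> g /axial_group_ez.
by apply/eqP => /rowP/(_ 2); rewrite !mxE /= => /eqP; rewrite oner_eq0.
Qed.

Definition planar_vec (c s : R) : 'rV[R]_3 := \row_j [:: c; s; 0]`_j.

(** Used with the second vector at a right angle to the first, for the square lattice, and at 120
    degrees, for the hexagonal one; the third vector lies along the axis. *)
Definition axial_basis (c s : R) : 'M[R]_3 := \matrix_(i, j) (nth [::] [:: [:: 1; 0; 0]; [:: c; s; 0]; [:: 0; 0; 1]] i)`_j.

Lemma lattice_mx_stable (B g : 'M[R]_3) : (forall i, lattice B (row i B *m g)) ->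
  forall k, lattice B k -> lattice B (k *m g).
Proof.
move=> hB k [n ->]; rewrite -mulmxA.
have [M hM] : exists M : 'M[int]_3, B *m g = map_mx intr M *m B.
  have /choice[m hm] : forall i, exists n : 'rV[int]_3, row i B *m g = map_mx intr n *m B.
    by move=> i; have [n' ->] := hB i; exists n'.
  exists (\matrix_i m i); apply/row_matrixP => i.
  rewrite row_mul hm row_mul; congr (_ *m B).
  by apply/rowP => j; rewrite !mxE.
by exists (n *m M); rewrite hM mulmxA map_mxM.
Qed.

(** The second basis vector is itself a rotation of the first with cosine in [X]. Every element of
    the group therefore sends both planar basis vectors to rotations of the first with cosine in
    [X], by closure under addition of angles; it suffices that these lie in the lattice. *)
Lemma axial_group_lattice X b (a t : R) : X \in cosines ->
  a \in X -> a ^+ 2 + t ^+ 2 = 1 -> t != 0 ->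
  (forall c s, c \in X -> c ^+ 2 + s ^+ 2 = 1 -> lattice (axial_basis a t) (planar_vec c s)) ->
  forall Y, Y \in cosines -> {subset Y <= X} -> crystallographic (axial_group Y b).
Proof.
move=> XX aX at1 t0 hl Y YX YsX.
have [G1 GM GV] := axial_group_group b YX.
exists (axial_basis a t).
  by rewrite unitmxE unitfE det3 !mxE /= !(mul0r, mulr0, subr0, mul1r, mulr1, addr0).
split => //; first exact: axial_group_O3.
have stable g : axial_group Y b g -> forall k, lattice (axial_basis a t) k -> lattice (axial_basis a t) (k *m g).
  move=> [c [s [e [cs /YsX cX he ->]]]]; have ee := sign_sqr he.
  apply: lattice_mx_stable; apply: ord3P.
  - have -> : row 0 (axial_basis a t) *m plane_mx c s e = planar_vec c s.
      by apply/rowP; apply: ord3P; rewrite !mxE sum3E !mxE /=; ring.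
    exact: hl.
  - have -> : row 1 (axial_basis a t) *m plane_mx c s e = planar_vec (a * c - (e * t) * s) (a * s + e * t * c).
      by apply/rowP; apply: ord3P; rewrite !mxE sum3E !mxE /=; ring.
    have et : a ^+ 2 + (e * t) ^+ 2 = 1 by rewrite exprMn [e ^+ 2]expr2 ee mul1r.
    apply: hl; first exact: (cos_closed_cosines XX).
    transitivity ((a ^+ 2 + (e * t) ^+ 2) * (c ^+ 2 + s ^+ 2)); first by ring.
    by rewrite et cs mulr1.
  - have -> : row 2 (axial_basis a t) *m plane_mx c s e = map_mx intr (delta_mx 0 2 : 'rV[int]_3) *m axial_basis a t.
      by apply/rowP; apply: ord3P; rewrite !mxE !sum3E !mxE /=; ring.
    by eexists.
move=> g Gg k; split; last exact: stable.
have ug := O3_unit (axial_group_O3 Gg).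
by move=> /(stable _ (GV g Gg)); rewrite mulmxK.
Qed.

Lemma planar_vec_lattice (a t : R) (n m : int) (c s : R) :
  c = n%:~R + m%:~R * a -> s = m%:~R * t -> lattice (axial_basis a t) (planar_vec c s).
Proof.
move=> -> ->; exists (\row_j [:: n; m; 0]`_j).
by apply/rowP; apply: ord3P; rewrite !mxE !sum3E !mxE /=; ring.
Qed.

(** Two lattices are enough: the square one carries the rotations of order 1, 2 and 4, the hexagonal
    one those of order 3 and 6. *)
Lemma crystallographic_axial X b : X \in cosines -> crystallographic (axial_group X b).
Proof.
have sq4 : crystallographic (axial_group [:: 1; -1; 0] b) /\
    forall Y, Y \in cosines -> {subset Y <= [:: 1; -1; 0]} -> crystallographic (axial_group Y b).
  have h Y : Y \in cosines -> {subset Y <= [:: 1; -1; 0]} -> crystallographic (axial_group Y b).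
    apply: (@axial_group_lattice [:: 1; -1; 0] b 0 1).
    - by rewrite !inE eqxx !orbT.
    - by rewrite !inE eqxx !orbT.
    - by rewrite expr0n expr1n add0r.
    - exact: oner_neq0.
    move=> c s; rewrite !inE => /or3P[] /eqP hc cs.
    + by apply: (@planar_vec_lattice _ _ 1 0); rewrite ?hc ?(sin_eq0 cs (or_introl hc)); ring.
    + by apply: (@planar_vec_lattice _ _ (-1) 0); rewrite ?hc ?(sin_eq0 cs (or_intror hc)); ring.
    + have h1 : s ^+ 2 = 1 ^+ 2 by rewrite hc in cs; lra.
      case: (sqr_pm h1) => hs; first by apply: (@planar_vec_lattice _ _ 0 1); rewrite ?hc ?hs; ring.
      by apply: (@planar_vec_lattice _ _ 0 (-1)); rewrite ?hc ?hs; ring.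
  by split => //; apply: h; rewrite // !inE eqxx !orbT.
have hex Y : Y \in cosines -> {subset Y <= [:: 1; -1; - 2^-1; 2^-1]} -> crystallographic (axial_group Y b).
  pose t : R := Num.sqrt 3 / 2.
  have tt : t ^+ 2 = 3 / 4 by rewrite /t exprMn sqr_sqrtr//; lra.
  have t0 : t != 0 by rewrite -sqrf_eq0 tt; apply/eqP; lra.
  apply: (@axial_group_lattice [:: 1; -1; - 2^-1; 2^-1] b (- 2^-1) t) => //.
  - by rewrite !inE eqxx !orbT.
  - by rewrite !inE eqxx !orbT.
  - by rewrite tt; lra.
  move=> c s; rewrite !inE => /or4P[] /eqP hc cs.
  + by apply: (@planar_vec_lattice _ _ 1 0); rewrite ?hc ?(sin_eq0 cs (or_introl hc)); ring.
  + by apply: (@planar_vec_lattice _ _ (-1) 0); rewrite ?hc ?(sin_eq0 cs (or_intror hc)); ring.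
  + case: (sqr_pm (etrans (half_cos cs (or_intror hc)) (esym tt))) => hs.
      by apply: (@planar_vec_lattice _ _ 0 1); rewrite ?hc ?hs; ring.
    by apply: (@planar_vec_lattice _ _ (-1) (-1)); rewrite ?hc ?hs; [field|ring].
  + case: (sqr_pm (etrans (half_cos cs (or_introl hc)) (esym tt))) => hs.
      by apply: (@planar_vec_lattice _ _ 1 1); rewrite ?hc ?hs; [field|ring].
    by apply: (@planar_vec_lattice _ _ 0 (-1)); rewrite ?hc ?hs; ring.
move=> XX; move: (XX); rewrite !inE => /or4P[|||/orP[]] /eqP EX.
- by apply: sq4.2 => //; rewrite EX => x; rewrite !inE => ->.
- by apply: sq4.2 => //; rewrite EX => x; rewrite !inE => /orP[] ->; rewrite ?orbT.
- by apply: hex => //; rewrite EX => x; rewrite !inE => /orP[] ->; rewrite ?orbT.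
- by rewrite EX; exact: sq4.1.
- by apply: hex => //; rewrite EX.
Qed.

Lemma axial_det_tr X b c s e : c ^+ 2 + s ^+ 2 = 1 -> e * e = 1 ->
  forall g, axial_group X b g -> \det g = e -> \tr g = c + e * c + 1 ->
  (e = 1 -> c \in X) /\ (e = -1 -> b).
Proof.
move=> cs ee g [c' [s' [e' [cs' cX' he' ->]]]]; rewrite det_plane// tr_plane => Ee; rewrite Ee => Ec.
split=> e1.
  by rewrite e1 in Ec; have -> : c = c' by lra.
by case: he' => [e'1|[]//]; move: e'1; rewrite Ee e1 => /eqP; rewrite eqNr oner_eq0.
Qed.

Lemma axial_group_conj_sub X b Y b' h : X \in cosines -> h \in unitmx ->
  axial_group Y b' = conjs h (axial_group X b) -> {subset X <= Y} /\ (b -> b').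
Proof.
move=> XX uh Eh.
have c1 c : c \in X -> c ^+ 2 <= 1.
  move: XX; rewrite !inE => /or4P[|||/orP[]] /eqP ->; rewrite !inE.
  - by move=> /eqP ->; lra.
  - by move=> /orP[] /eqP ->; lra.
  - by move=> /orP[] /eqP ->; lra.
  - by move=> /or3P[] /eqP ->; lra.
  - by move=> /or4P[] /eqP ->; lra.
split=> [c cX|hb].
  have cs : c ^+ 2 + Num.sqrt (1 - c ^+ 2) ^+ 2 = 1 by rewrite sqr_sqrtr ?subr_ge0 ?c1// addrC subrK.
  pose g := plane_mx c (Num.sqrt (1 - c ^+ 2)) 1.
  have Gg : axial_group X b g by exists c, (Num.sqrt (1 - c ^+ 2)), 1; split => //; left.
  have Hg : axial_group Y b' (invmx h *m g *m h) by rewrite Eh; exists g.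
  have [tg dg] := conjs_tr_det g uh.
  have [|h1 _] := axial_det_tr cs (mulr1 1) Hg (etrans dg (det_plane _ cs)); last exact: h1.
  by rewrite tg tr_plane.
have cs : 1 ^+ 2 + 0 ^+ 2 = 1 :> R by rewrite expr1n expr0n addr0.
pose g := plane_mx (1 : R) 0 (-1).
have Gg : axial_group X b g by exists 1, 0, (-1); split => //; [exact: one_cosines|right].
have Hg : axial_group Y b' (invmx h *m g *m h) by rewrite Eh; exists g.
have [tg dg] := conjs_tr_det g uh.
have ee : -1 * -1 = 1 :> R by rewrite mulrNN mulr1.
have [|_ h1] := axial_det_tr cs ee Hg (etrans dg (det_plane _ cs)); last exact: h1.
by rewrite tg tr_plane.
Qed.

Lemma cosines_inj (i j : nat) : (i < 5)%N -> (j < 5)%N ->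
  (nth [::] cosines i) =i (nth [::] cosines j) -> i = j.
Proof.
move=> hi hj h.
(* Membership of the cosines -1, -1/2 and 0 separates the five lists. *)
pose sig (X : seq R) := (-1 \in X, - 2^-1 \in X, 0 \in X).
have sigs : [seq sig X | X <- cosines] = [:: (false, false, false); (true, false, false);
    (false, true, false); (true, false, true); (true, true, false)].
  have f1 : (-1 == 1 :> R) = false by apply/eqP; lra.
  have f2 : (-1 == - 2^-1 :> R) = false by apply/eqP; lra.
  have f3 : (- 2^-1 == 1 :> R) = false by apply/eqP; lra.
  have f4 : (- 2^-1 == -1 :> R) = false by apply/eqP; lra.
  have f5 : (- 2^-1 == 0 :> R) = false by apply/eqP; lra.
  have f6 : (0 == 1 :> R) = false by apply/eqP; lra.
  have f7 : (0 == -1 :> R) = false by apply/eqP; lra.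
  have f8 : (0 == - 2^-1 :> R) = false by apply/eqP; lra.
  have f9 : (0 == 2^-1 :> R) = false by apply/eqP; lra.
  by rewrite /sig /= !inE !eqxx f1 f2 f3 f4 f5 f6 f7 f8 f9 ?orbT.
have sigE k : (k < 5)%N -> nth (sig [::]) [seq sig X | X <- cosines] k = sig (nth [::] cosines k).
  by move=> hk; rewrite (nth_map [::]).
have : sig (nth [::] cosines i) = sig (nth [::] cosines j) by rewrite /sig !h.
rewrite -!sigE// sigs => /eqP; rewrite nth_uniq//; exact/eqP.
Qed.

(** A group of planar rotations is closed under the change of sign of the sine, hence determined by
    its cosines. Testing in turn for the cosines 0, 1/2, -1/2 and -1 identifies C4, C6, C3 and C2;
    otherwise the group is trivial. *)
Lemma rotation_cosines (H : R -> R -> Prop) :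
  (forall c s, H c s -> c ^+ 2 + s ^+ 2 = 1 /\ c \in [:: 1; -1; 0; 2^-1; - 2^-1]) ->
  H 1 0 -> (forall c s, H c s -> H c (- s)) ->
  (forall c s c' s', H c s -> H c' s' -> H (c * c' - s * s') (c * s' + s * c')) ->
  exists2 X, X \in cosines & forall c s, H c s <-> c ^+ 2 + s ^+ 2 = 1 /\ c \in X.
Proof.
move=> Hc H1 HV HM.
have Hs c s s' : H c s -> c ^+ 2 + s' ^+ 2 = 1 -> H c s'.
  move=> Hcs cs'; have [cs _] := Hc _ _ Hcs.
  have ss : s' ^+ 2 = s ^+ 2 by lra.
  by have [->|->] := sqr_pm ss; [exact: Hcs|exact: HV].
pose P c := exists s, H c s.
have HP c s : H c s <-> c ^+ 2 + s ^+ 2 = 1 /\ P c.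
  split; first by move=> Hcs; split; [have [] := Hc _ _ Hcs|exists s].
  by move=> [cs [s' Hcs']]; exact: (Hs _ _ _ Hcs').
have PM c s c' s' : H c s -> H c' s' -> P (c * c' - s * s').
  by move=> h h'; exists (c * s' + s * c'); exact: HM.
suff [X XX hX] : exists2 X, X \in cosines & forall c, P c <-> c \in X.
  by exists X => // c s; rewrite HP; split => -[? /hX].
have Pin c : P c -> c \in [:: 1; -1; 0; 2^-1; - 2^-1] by move=> [s /Hc[]].
have P1 : P 1 by exists 0.
have [P0|nP0] := pselect (P 0).
  have [s Hs0] := P0; have [s1 _] := Hc _ _ Hs0.
  have Pm1 : P (-1).
    by have := PM _ _ _ _ Hs0 Hs0; rewrite mul0r sub0r (_ : s * s = 1)//; rewrite -expr2; lra.
  (* A quarter turn composed with a rotation of cosine 1/2 or -1/2 has a cosine of square 3/4, which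
     is not an allowed value. *)
  have nhalf c : P c -> (c = 2^-1 \/ c = - 2^-1) -> False.
    move=> [t Ht] hc; have [ct _] := Hc _ _ Ht; have tt := half_cos ct hc.
    have /Pin := PM _ _ _ _ Ht Hs0; rewrite mulr0 sub0r => hin.
    have : (- (t * s)) ^+ 2 = 3 / 4.
      have ss : s ^+ 2 = 1 by lra.
      by rewrite sqrrN exprMn tt ss mulr1.
    move: hin; rewrite !inE => /or4P[|||/orP[]] /eqP ->; lra.
  exists [:: 1; -1; 0]; first by rewrite !inE eqxx !orbT.
  move=> c; split=> [Pc|].
    move: (Pin _ Pc); rewrite !inE => /or4P[|||/orP[]] /eqP hc; rewrite hc ?eqxx ?orbT//.
      by case: (nhalf _ Pc); left.
    by case: (nhalf _ Pc); right.
  by rewrite !inE => /or3P[] /eqP ->.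
have [Ph|nPh] := pselect (P 2^-1).
  have [t Ht] := Ph; have [ct _] := Hc _ _ Ht; have tt := half_cos ct (or_introl erefl).
  have Pmh : P (- 2^-1).
    by have := PM _ _ _ _ Ht Ht; rewrite (_ : _ - _ = - 2^-1)//; rewrite -[t * t]expr2 tt; lra.
  (* Turns of 60 and 120 degrees with the same sine compose to a half turn. *)
  have Pm1 : P (-1).
    have h2 : H (- 2^-1) t by apply/HP; split; [lra|].
    by have := PM _ _ _ _ Ht h2; rewrite (_ : _ - _ = -1)//; rewrite -[t * t]expr2 tt; lra.
  exists [:: 1; -1; - 2^-1; 2^-1]; first by rewrite !inE eqxx !orbT.
  move=> c; split=> [Pc|].
    move: (Pin _ Pc); rewrite !inE => /or4P[|||/orP[]] /eqP hc; rewrite ?hc ?eqxx ?orbT//.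
    by exfalso; apply: nP0; rewrite -hc.
  by rewrite !inE => /or4P[] /eqP ->.
have [Pmh|nPmh] := pselect (P (- 2^-1)).
  have [t Ht] := Pmh; have [ct _] := Hc _ _ Ht; have tt := half_cos ct (or_intror erefl).
  exists [:: 1; - 2^-1]; first by rewrite !inE eqxx !orbT.
  move=> c; split=> [Pc|]; last by rewrite !inE => /orP[] /eqP ->.
  move: (Pin _ Pc); rewrite !inE => /or4P[|||/orP[]] /eqP hc; rewrite ?hc ?eqxx ?orbT//.
  - exfalso; apply: nPh; have h2 : H (-1) 0.
      by apply/HP; split; [rewrite sqrrN expr1n expr0n addr0|rewrite -hc].
    by have := PM _ _ _ _ Ht h2; rewrite mulr0 subr0 mulrNN mulr1.
  - by exfalso; apply: nP0; rewrite -hc.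
  - by exfalso; apply: nPh; rewrite -hc.
have notin c : P c -> c = 1 \/ c = -1.
  move=> Pc; move: (Pin _ Pc); rewrite !inE => /or4P[|||/orP[]] /eqP hc; rewrite hc in Pc *; auto; by exfalso; auto.
have [Pm1|nPm1] := pselect (P (-1)).
  exists [:: 1; -1]; first by rewrite !inE eqxx !orbT.
  move=> c; split=> [/notin[] ->|]; rewrite !inE ?eqxx ?orbT//.
  by move=> /orP[] /eqP ->.
exists [:: 1]; first by rewrite !inE eqxx.
move=> c; split=> [Pc|]; rewrite !inE; last by move=> /eqP ->.
by case: (notin _ Pc) => hc; rewrite hc ?eqxx//; exfalso; apply: nPm1; rewrite -hc.
Qed.

Lemma crystallographic_trace G g : crystallographic G -> G g -> exists z : int, \tr g = z%:~R.
Proof.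
move=> [B uB [_ _ _ _ GB]] Gg; have [M hM] := lattice_preserving_int (GB g Gg).
exists (\tr M); have -> : g = invmx B *m (map_mx intr M *m B) by rewrite -hM mulmxA mulVmx// mul1mx.
by rewrite mxtrace_mulC mulmxK// /mxtrace rmorph_sum; apply: eq_bigr => i _; rewrite mxE.
Qed.

(** Crystallographic restriction: the trace [2 c + 1] is an integer between -1 and 3. The factor 1
    is the sign [e] of a rotation in the trace formula for [plane_mx]. *)
Lemma crystallographic_cos (c s : R) (z : int) : c ^+ 2 + s ^+ 2 = 1 -> c + 1 * c + 1 = z%:~R ->
  c \in [:: 1; -1; 0; 2^-1; - 2^-1].
Proof.
move=> cs cz.
have c1 : c ^+ 2 <= 1 by have := sqr_ge0 s; lra.
have /andP[cl cu] : -1 <= c <= 1 by apply/andP; split; nra.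
have zl : -1 <= z by rewrite -(ler_int R) -cz; lra.
have zu : z <= 3 by rewrite -(ler_int R) -cz; lra.
have : z \in [:: -1; 0; 1; 2; 3].
  by move: z zl zu {cz} => [[|[|[|[|z]]]]|[|z]].
rewrite !inE => /or4P[|||/orP[]] /eqP zE; rewrite zE in cz.
- by apply/or4P; constructor 2; apply/eqP; lra.
- by apply/or4P; constructor 4; apply/orP; right; apply/eqP; lra.
- by apply/or4P; constructor 3; apply/eqP; lra.
- by apply/or4P; constructor 4; apply/orP; left; apply/eqP; lra.
- by apply/or4P; constructor 1; apply/eqP; lra.
Qed.

(** When [b] holds, the group contains one fixed reflection, and multiplication by it exchanges
    rotations and reflections; the group is then determined by its rotations in either case. *)
Lemma axial_normal_form G b : crystallographic G -> (forall g, G g -> ez *m g = ez) ->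
  (if b then G (plane_mx 1 0 (-1)) else forall g, G g -> \det g != -1) ->
  exists2 X, X \in cosines & G = axial_group X b.
Proof.
move=> cG Gz hb; have [B uB [G1 GM GV GO _]] := cG.
pose H c s := c ^+ 2 + s ^+ 2 = 1 /\ G (plane_mx c s 1).
have [||||X XX HX] := @rotation_cosines H.
- move=> c s [cs Gcs]; split => //; have [z] := crystallographic_trace cG Gcs.
  by rewrite tr_plane => /(crystallographic_cos cs).
- by split; [rewrite expr1n expr0n addr0|rewrite plane_mx1].
- move=> c s [cs Gcs]; split; first by rewrite sqrrN.
  by have := GV _ Gcs; rewrite (O3_inv (GO _ Gcs)) plane_mx_tr ?mulr1// mul1r.
- move=> c s c' s' [cs Gcs] [cs' Gcs']; split.
    by transitivity ((c ^+ 2 + s ^+ 2) * (c' ^+ 2 + s' ^+ 2)); [ring|rewrite cs cs' mulr1].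
  by have := GM _ _ Gcs Gcs'; rewrite plane_mxM ?mulr1// !mul1r.
exists X => //; have ee : -1 * -1 = 1 :> R by rewrite mulrNN mulr1.
have mplane c s e : e * e = 1 -> plane_mx 1 0 (-1) *m plane_mx c s e = plane_mx c s (- e).
  by move=> e1; rewrite plane_mxM//; congr plane_mx; ring.
apply/seteqP; split => [g Gg|_ [c [s [e [cs cX he ->]]]]].
  have [c [s [e [cs he ge]]]] := O3_fix_ez (GO g Gg) (Gz g Gg).
  have dg : \det g = e by rewrite ge det_plane.
  case: he => e1.
    exists c, s, e; split => //; last by left.
    by have [_] : c ^+ 2 + s ^+ 2 = 1 /\ c \in X by apply/HX; split => //; rewrite -e1 -ge.
  have {}hb : b && `[<G (plane_mx 1 0 (-1))>].
    case: b hb => [Gm|/(_ g Gg)]; first exact/asboolP.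
    by rewrite dg e1 eqxx.
  have /andP[bt /asboolP Gm] := hb.
  exists c, s, e; split => //; last by right.
  have := GM _ _ Gm Gg; rewrite ge e1 mplane// opprK => Gcs.
  by have [_] : c ^+ 2 + s ^+ 2 = 1 /\ c \in X by apply/HX.
have [_ Gcs] : H c s by apply/HX.
case: he => [->//|[bt ->]]; rewrite bt in hb.
by have := GM _ _ hb Gcs; rewrite mplane// mulr1.
Qed.

(** [a + i t] is a square root of [c - i s] on the unit circle. When [c = -1] the formula for [t]
    would divide by [a = 0], so this case has its own witness. *)
Lemma half_angle (c s : R) : c ^+ 2 + s ^+ 2 = 1 ->
  exists a t : R, [/\ a ^+ 2 + t ^+ 2 = 1, a ^+ 2 - t ^+ 2 = c & 2 * a * t = - s].
Proof.
move=> cs; have [c1|c1] := eqVneq c (-1).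
  exists 0, 1; rewrite expr0n expr1n; split; [by rewrite add0r|by rewrite c1 sub0r|].
  have s0 : s = 0 by apply: (sin_eq0 cs); right.
  by rewrite s0; ring.
have c0 : 0 < 1 + c.
  rewrite lt_def; apply/andP; split; first by apply: contra c1 => /eqP h; apply/eqP; lra.
  by have := sqr_ge0 s; nra.
pose a := Num.sqrt ((1 + c) / 2).
have aa : a ^+ 2 = (1 + c) / 2 by rewrite sqr_sqrtr// divr_ge0// ltW.
have a0 : a != 0 by rewrite -sqrf_eq0 aa gt_eqF// divr_gt0.
have tt : (- s / (2 * a)) ^+ 2 = (1 - c) / 2.
  have -> : (- s / (2 * a)) ^+ 2 = s ^+ 2 / (4 * a ^+ 2) by field.
  have -> : s ^+ 2 = (1 - c) * (1 + c) by have := cs; lra.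
  by rewrite aa; field; rewrite gt_eqF.
exists a, (- s / (2 * a)); split; [by rewrite tt aa; lra|by rewrite tt aa; lra|by field].
Qed.

(** After the axis has been aligned, a reflection in the group may still have its plane at any
    azimuth. Conjugating by the rotation through half of its angle, with the opposite sign, brings
    it to the standard reflection and keeps the axis fixed. *)
Lemma polar_normal_form G : crystallographic G -> polar G ->
  exists X b, X \in cosines /\ crystal_class G = crystal_class (axial_group X b).
Proof.
move=> cG pG; have [h Oh hz] := polar_fix_ez pG.
have c1 := crystallographic_conjs Oh cG.
rewrite -(crystal_class_conjs G Oh); set G1 := conjs h G in hz c1 *.
have [[g [G1g dg]]|nref] := pselect (exists g, G1 g /\ \det g = -1); last first.
  have [|X XX ->] := @axial_normal_form G1 false c1 hz; last by exists X, false.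
  by move=> g G1g; apply/eqP => dg; apply: nref; exists g.
have [B uB [_ _ _ GO _]] := c1.
have [c [s [e [cs _ ge]]]] := O3_fix_ez (GO g G1g) (hz g G1g).
have e1 : e = -1 by rewrite -dg ge det_plane.
have [a [t [at1 at2 at3]]] := half_angle cs.
pose k := plane_mx a t 1; have Ok : O3 k by apply: O3_plane; rewrite ?mulr1.
have kz : ez *m invmx k = ez.
  by rewrite -{1}(ez_plane a t 1) -/k mulmxK// (O3_unit Ok).
rewrite -(crystal_class_conjs G1 Ok).
have [||X XX ->] := @axial_normal_form (conjs k G1) true (crystallographic_conjs Ok c1).
- by move=> _ [g' G1g' <-]; rewrite !mulmxA kz hz// ez_plane.
- exists g => //; rewrite ge e1 (O3_inv Ok) /k plane_mx_tr ?mulr1// mul1r.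
  have ee : -1 * -1 = 1 :> R by rewrite mulrNN mulr1.
  rewrite plane_mxM// plane_mxM ?mulr1//; congr plane_mx.
  + transitivity ((a ^+ 2 - t ^+ 2) * c - 2 * a * t * s); first by ring.
    by rewrite at2 at3 mulNr opprK -!expr2.
  + transitivity (2 * a * t * c + (a ^+ 2 - t ^+ 2) * s); first by ring.
    by rewrite at2 at3; ring.
  + by ring.
- by exists X, true.
Qed.

(** The ten pairs are numbered by [n < 10]: half of [n] selects the rotations, its parity the
    presence of reflections. *)
Definition axial_class (n : nat) := crystal_class (axial_group (nth [::] cosines n./2) (odd n)).

Lemma polar_classesE : @polar_classes R = axial_class @` `I_10.
Proof.
apply/seteqP; split => [_ [G [cG pG] <-]|_ [n n10 <-]].
  have [X [b [XX ->]]] := polar_normal_form cG pG.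
  exists (b + (index X cosines).*2)%N.
    have : (index X cosines < 5)%N by rewrite -[5%N]/(size cosines) index_mem.
    by rewrite /=; case: b; lia.
  by rewrite /axial_class half_bit_double oddD odd_double addbF oddb nth_index.
have n2 : (n./2 < 5)%N by rewrite /= in n10; lia.
have XX : nth [::] cosines n./2 \in cosines by exact: mem_nth.
by exists (axial_group (nth [::] cosines n./2) (odd n)) => //; split;
  [exact: crystallographic_axial|exact: axial_group_polar].
Qed.

Lemma axial_class_inj : {in `I_10 &, injective axial_class}.
Proof.
move=> i j; rewrite !inE /= => hi hj Eij.
have ci n : (n < 10)%N -> nth [::] cosines n./2 \in cosines by move=> hn; apply: mem_nth; rewrite /=; lia.
have sub n m : (n < 10)%N -> axial_class n = axial_class m ->
    {subset nth [::] cosines n./2 <= nth [::] cosines m./2} /\ (odd n -> odd m).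
  move=> hn /crystal_class_inj[h Oh Eh].
  exact: (axial_group_conj_sub (ci n hn) (O3_unit Oh) Eh).
have [s1 o1] := sub i j hi Eij; have [s2 o2] := sub j i hj (esym Eij).
have E2 : i./2 = j./2.
  by apply: cosines_inj; [lia|lia|move=> x; apply/idP/idP; [exact: s1|exact: s2]].
have E1 : odd i = odd j by apply/idP/idP.
by rewrite -(odd_double_half i) -(odd_double_half j) E1 E2.
Qed.

Lemma card_polar_classes : (@polar_classes R #= `I_10)%card.
Proof. by rewrite polar_classesE; exact: (inj_card_eq axial_class_inj). Qed.

End PolarGroups.

Theorem mainTheorem5 (R : realType) (B : 'M[R]_3) (hB : B \in unitmx) :
  [/\ (* (1), regular curvature *)
      forall Om Oh Oe Oc : 'rV[R]_3 -> 'rV[R]_3,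
        lattice_periodic B Om -> C1_field Om -> helmholtz B Om Oh Oe Oc ->
        [/\ forall k, curl Oh k = 0,
            forall k, curl Oc k = 0 &
            forall g : 'rV[R]_3 -> R,
              [/\ curl_functional B g Om = curl_functional B g Oe,
                  curl_functional B g Oh = 0 & curl_functional B g Oc = 0]],
      (* (1), integrable curvature, in the sense of distributions *)
      forall (Om : 'rV[R]_3 -> 'rV[R]_3) (Th Te Tc : 'I_3 -> functional),
        lattice_periodic B Om -> (forall i, torus_integrable B (component Om i)) ->
        distr_helmholtz B Om Th Te Tc ->
        forall (g : 'rV[R]_3 -> R) (l : 'I_3), test_fun B g ->
        [/\ distr_curl (distr_field B Om) l g = distr_curl Te l g,
            distr_curl Th l g = 0 & distr_curl Tc l g = 0],
      (* (2) *)
      forall (r : resolution) (Om : 'rV[R]_3 -> 'rV[R]_3)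
             (E : 'rV[R]_3 -> R) (mu : R),
        curvature B r Om -> band B E ->
        let W := resolve B r Om in
        (regular_fermi_surface E mu -> forall l,
           is_surface_int B (fermi_surface E mu)
             (fun k => cross (fermi_normal E k) (W k) 0 l) (P_obs B E mu W 0 l)) /\
        (forall l, P_obs B E mu W 0 l =
           \sum_(i < 3) \sum_(j < 3) eps l i j * dipole B E mu W i j),
      (* (3), transformation law *)
      forall (r : resolution) (Om : 'rV[R]_3 -> 'rV[R]_3)
             (E : 'rV[R]_3 -> R) (mu : R) (g : 'M[R]_3),
        curvature B r Om -> band B E ->
        O3 g -> lattice_preserving B g -> resolution_invariant B r g ->
        P_obs B (act_scalar g E) mu (resolve B r (act_pseudovector g Om)) =
        P_obs B E mu (resolve B r Om) *m g &
      (* (3), consequence of invariance under the point group *)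
      (@polar_classes R #= `I_10)%card /\
      forall (r : resolution) (Om : 'rV[R]_3 -> 'rV[R]_3)
             (E : 'rV[R]_3 -> R) (mu : R) (G : set 'M[R]_3),
        curvature B r Om -> band B E -> point_group B G ->
        (forall g, G g -> [/\ act_scalar g E = E, act_pseudovector g Om = Om
                            & resolution_invariant B r g]) ->
        let P := P_obs B E mu (resolve B r Om) in
        (forall g, G g -> P *m g = P) /\
        (P != 0 -> polar G /\ polar_classes (crystal_class G))].
Proof.
split.
- by move=> Om Oh Oe Oc _ _; exact: exact_sector_regular.
- by move=> Om Th Te Tc _ _ hT g l; exact: exact_sector_distr.
- move=> r Om E mu cOm bE W; have [cW pW] := resolve_regular hB cOm.
  split=> [rE l|l]; first exact: surface_int_flux.
  by have [cE _] := bE; exact: P_obs_dipole.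
- by move=> r Om E mu g cOm bE Og gB gr; exact: P_obs_transform.
- split; first exact: card_polar_classes.
  move=> r Om E mu G cOm bE GB Gsym P.
  have PG g : G g -> P *m g = P.
    move=> Gg; have [gE gOm gr] := Gsym g Gg; have [_ _ _ GO GL] := GB.
    by have := P_obs_transform hB mu cOm bE (GO g Gg) (GL g Gg) gr; rewrite gE gOm.
  (* The observable itself is the nonzero vector fixed by the group. *)
  split=> // P0; have pG : polar G by exists P.
  by split => //; exists G => //; split => //; exists B.
Qed.
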